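(* Let $m$ be a positive integer, and suppose that $f$ and $g$ are functions in $D$ (finite linear combinations of reproducing kernel functions of $F^{2,m}(\mathbb{C})$). Then the following statements are equivalent. (a) $H_{\overline{f}}^* H_{\overline{g}}=0$ on $F^{2,m}(\mathbb{C})$. (b) $T_{f}T_{\overline{g}}=T_{f\overline{g}}$ on $F^{2,m}(\mathbb{C})$. (c) $\widetilde{f\overline{g}}=f\overline{g}$ on $\mathbb{C}$. (d) At least one of $f$ and $g$ is a constant function.
   Context: Let $dA$ be area measure on $\mathbb{C}$ and $m$ a non-negative integer. The Fock space $F^2$ is the space of entire functions $f$ with $\frac1\pi\int_{\mathbb{C}}|f(z)|^2e^{-|z|^2}dA(z)<\infty$. The Fock-Sobolev space $F^{2,m}(\mathbb{C})$ consists of all entire $f$ with $f^{(m)}\in F^2$; equivalently, all entire $f$ with $z^m f(z)\in F^2$. Let $L^2_m$ be the Hilbert space of measurable functions $f$ on $\mathbb{C}$ with $|z|^m f(z)\in L^2(\mathbb{C},e^{-|z|^2}dA)$, with inner product $$\langle f,g\rangle_m=\frac{1}{\pi m!}\int_{\mathbb{C}} f(z)\overline{g(z)}|z|^{2m}e^{-|z|^2}dA(z).$$ $F^{2,m}(\mathbb{C})$ is regarded as a closed subspace of $L^2_m$ with this inner product. Its reproducing kernel is $K_m(z,w)=\sum_{k=0}^\infty \frac{m!}{(k+m)!}(z\overline{w})^k$, and $P$ denotes the orthogonal projection of $L^2_m$ onto $F^{2,m}(\mathbb{C})$, $Pf(z)=\frac{1}{\pi m!}\int_{\mathbb{C}}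 f(w)K_m(z,w)|w|^{2m}e^{-|w|^2}dA(w)$. $D$ is the set of all finite linear combinations of kernel functions, i.e. functions $f(z)=\sum_{k=1}^N c_kK_m(z,\omega_k)$ with $N$ a positive integer and $c_k,\omega_k\in\mathbb{C}$; $D$ is dense in $F^{2,m}(\mathbb{C})$. For a measurable symbol $\varphi$ on $\mathbb{C}$ with $\int_{\mathbb{C}}|\varphi(w)||K_m(z,w)||w|^{2m}e^{-|w|^2}dA(w)<\infty$, the Toeplitz operator is densely defined on $F^{2,m}(\mathbb{C})$ by $$T_\varphi f(z)=\frac{1}{\pi m!}\int_{\mathbb{C}} \varphi(w)f(w)K_m(z,w)|w|^{2m}e^{-|w|^2}dA(w),$$ and the Hankel operator by $H_\varphi f=(I-P)(\varphi f)$, with $I$ the identity on $L^2_m$. These operators may be unbounded and are considered as densely defined operators; one has $H_{\overline f}^*H_{\overline g}=T_{f\overline g}-T_fT_{\overline g}$. The Berezin transform of $\varphi$ is $\widetilde{\varphi}(z)=\langle \varphi k_z,k_z\rangle_m$, where $k_z(w)=K_m(w,z)/\sqrt{K_m(z,z)}$ is the normalized reproducing kernel. *)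

(* Defs.v *)
(* MathComp-Analysis; the complex plane is R[i] for R : realType. *)
From HB Require Import structures.
From mathcomp Require Import all_boot all_order all_algebra.
From mathcomp Require Import complex.
From mathcomp Require Import all_classical all_reals all_analysis.
Set Implicit Arguments.
Unset Strict Implicit.
Unset Printing Implicit Defensive.
Import Order.TTheory GRing.Theory Num.Theory.
Import numFieldNormedType.Exports.
Local Open Scope classical_set_scope.
Local Open Scope ring_scope.

(* R[i] carries no measurable structure in the library: area measure lives on
   R * R, and functions on the plane are integrated through [plane]. *)
Definition plane (R : realType) (p : R * R) : R[i] := Complex p.1 p.2.

Definition area (R : realType) :
    {measure set (measurableTypeR R * measurableTypeR R) -> \bar R} :=
  (@lebesgue_measure R \x @lebesgue_measure R)%E.

Definition cmod (R : realType) (z : R[i]) : R := complex.Re `|z|.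

Definition cmeasurable (R : realType) (h : R[i] -> R[i]) : Prop :=
  measurable_fun [set: measurableTypeR R * measurableTypeR R]
    (fun p => complex.Re (h (plane p))) /\
  measurable_fun [set: measurableTypeR R * measurableTypeR R]
    (fun p => complex.Im (h (plane p))).

Definition cintegral_finite (R : realType) (r : R[i] -> R) : Prop :=
  (\int[area R]_p (r (plane p))%:E < +oo)%E.

Definition cintegrable (R : realType) (h : R[i] -> R[i]) : Prop :=
  cmeasurable h /\ cintegral_finite (fun z => cmod (h z)).

Definition cintegral (R : realType) (h : R[i] -> R[i]) : R[i] :=
  Complex (\int[area R]_p complex.Re (h (plane p)))
          (\int[area R]_p complex.Im (h (plane p))).

Definition conjf (R : realType) (f : R[i] -> R[i]) : R[i] -> R[i] :=
  fun z => (f z)^*.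

(* Derivative in the complex direction 1, over the field R[i]: this is complex
   differentiability at every point. *)
Definition entire (R : realType) (f : R[i] -> R[i]) : Prop :=
  forall z, derivable (f : R[i]^o -> R[i]^o) z 1.

Definition fock (R : realType) (f : R[i] -> R[i]) : Prop :=
  entire f /\
  cintegral_finite (fun z => cmod (f z) ^+ 2 * expR (- cmod z ^+ 2)).

(* The description of F^{2,m} inside L^2_m: f is entire and z^m f(z) is in the
   Fock space, equivalently the m-th derivative of f is in the Fock space. *)
Definition fock_sobolev (R : realType) (m : nat) (f : R[i] -> R[i]) : Prop :=
  entire f /\ fock (fun z => z ^+ m * f z).

Definition weight (R : realType) (m : nat) (z : R[i]) : R :=
  cmod z ^+ (2 * m) * expR (- cmod z ^+ 2).

Definition L2 (R : realType) (m : nat) (f : R[i] -> R[i]) : Prop :=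
  cmeasurable f /\ cintegral_finite (fun z => cmod (f z) ^+ 2 * weight m z).

Definition inner (R : realType) (m : nat) (f g : R[i] -> R[i]) : R[i] :=
  (real_complex R (pi * m`!%:R))^-1 *
  cintegral (fun z => f z * (g z)^* * real_complex R (weight m z)).

Definition repro_kernel (R : realType) (m : nat) (z w : R[i]) : R[i] :=
  lim (series (fun k : nat =>
    (m`!%:R / (k + m)`!%:R * (z * w^*) ^+ k : R[i]^o)) @ \oo).

Definition fock_proj (R : realType) (m : nat) (f : R[i] -> R[i]) :
    R[i] -> R[i] :=
  fun z => (real_complex R (pi * m`!%:R))^-1 *
  cintegral (fun w => f w * repro_kernel m z w * real_complex R (weight m w)).

Definition kernel_span (R : realType) (m : nat) (f : R[i] -> R[i]) : Prop :=
  exists (N : nat) (c omega : 'I_N -> R[i]), (0 < N)%N /\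
    forall z, f z = \sum_(k < N) c k * repro_kernel m z (omega k).

(* Unbounded operators are given by their graphs: [A u v] means that u is in
   the domain of A and A u = v. *)
Definition operator (R : realType) := (R[i] -> R[i]) -> (R[i] -> R[i]) -> Prop.

Definition toeplitz_symbol (R : realType) (m : nat) (phi : R[i] -> R[i]) :
    Prop :=
  cmeasurable phi /\
  forall z, cintegral_finite
    (fun w => cmod (phi w) * cmod (repro_kernel m z w) * weight m w).

(* Maximal domain: all u in F^{2,m} for which the defining integral converges
   absolutely at every point and gives an element of F^{2,m}. *)
Definition toeplitz (R : realType) (m : nat) (phi : R[i] -> R[i]) :
    operator R := fun u v =>
  [/\ toeplitz_symbol m phi,
      fock_sobolev m u,
      forall z, cintegrable (fun w => phi w * u w * repro_kernel m z w *
                                      real_complex R (weight m w)),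
      v = fock_proj m (fun w => phi w * u w)
    & fock_sobolev m v].

(* Maximal domain: all u in F^{2,m} with phi u in L^2_m. *)
Definition hankel (R : realType) (m : nat) (phi : R[i] -> R[i]) :
    operator R := fun u h =>
  [/\ fock_sobolev m u,
      L2 m (fun w => phi w * u w)
    & h = (fun z => phi z * u z - fock_proj m (fun w => phi w * u w) z)].

(* Adjoint of a densely defined operator A from F^{2,m} to L^2_m. *)
Definition adjoint (R : realType) (m : nat) (A : operator R) : operator R :=
  fun h k =>
  [/\ L2 m h, fock_sobolev m k
    & forall u v, A u v -> inner m v h = inner m u k].

Definition op_comp (R : realType) (A B : operator R) : operator R :=
  fun u w => exists2 v, B u v & A v w.

Definition op_zero (R : realType) (m : nat) : operator R :=
  fun u v => fock_sobolev m u /\ v = (fun _ => 0).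

(* Equality of densely defined operators on F^{2,m}: both are defined on the
   dense subspace spanned by the kernels, and they agree at every function at
   which both are defined.  The domains themselves are not compared: for f = 0
   the domain of T_f T_(conj g) is the one of T_(conj g), while
   T_(f conj g) = 0 is defined everywhere. *)
Definition op_eq (R : realType) (m : nat) (A B : operator R) : Prop :=
  (forall u, kernel_span m u -> (exists v, A u v) /\ (exists v, B u v)) /\
  (forall u v w, A u v -> B u w -> v = w).

Definition normalized_kernel (R : realType) (m : nat) (z : R[i]) :
    R[i] -> R[i] :=
  fun w => repro_kernel m w z / sqrtC (repro_kernel m z z).

Definition berezin (R : realType) (m : nat) (phi : R[i] -> R[i]) (z : R[i]) :
    R[i] :=
  inner m (fun w => phi w * normalized_kernel m z w) (normalized_kernel m z).

Definition constant_fun (R : realType) (f : R[i] -> R[i]) : Prop :=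
  exists c, forall z, f z = c.

(* Main.v *)
(* The kernel of F^{2,m} is E(z conj(w)) with E(x) = sum_k m!/(k+m)! x^k, which
   satisfies x E' + m E = x E + m. This equation makes
   (z - w) E(z conj(w)) |w|^{2m} e^{-|w|^2} the dbar-derivative in w of an
   explicit decaying function psi, and Stokes' theorem (by Goursat's bisection,
   so that mere differentiability suffices) applied to
   psi(w) (u(w) - u(z)) / (w - z) gives P u = u for every u in F^{2,m}.

   Tested on the kernel functions K_z, each of (a), (b), (c) says that
   P(f conj(g) K_z)(z) = f(z) conj(g(z)) K(z,z) for all z. Put z = t a with t
   real and compare the powers of t, then those of a and conj(a): with
   k_j = m!/(j+m)! and the Taylor coefficients F, G of f, g, one gets for q <= p
     k_p k_q <w^p f, w^q g> = sum_(l <= q) k_l F_(q-l) conj(G_(p-l)),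
   where <w^p f, w^q g> is a Parseval sum. For fixed q and p = n + q both sides,
   divided by k_p, are exponential polynomials in n, because conj(G_k) is k_k
   times a combination of powers nu^k. If g is not constant, some node nu <> 0
   survives, and the resulting polynomial identity in n, evaluated at
   n = -(q+m) for q = r and q = r + 1 and at n = 1 - (q+m) for q = r + 1, gives
   r m F_r = 0, so f is constant. *)
Require Import Defs.
From mathcomp Require Import all_boot all_order all_algebra.
From mathcomp Require Import complex ring lra zify.
From mathcomp Require Import all_classical all_reals all_analysis.
From mathcomp Require Import measurable_realfun.
Set Implicit Arguments.
Unset Strict Implicit.
Unset Printing Implicit Defensive.
Import Order.TTheory GRing.Theory Num.Theory.
Import numFieldNormedType.Exports.
Local Open Scope classical_set_scope.
Local Open Scope ring_scope.

Local Notation Re := complex.Re.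
Local Notation Im := complex.Im.

(** Members of $F^{2,m}$ are only known to be complex differentiable at each point, so no Taylor
    expansion is at hand for them; power series serve only functions with explicit coefficients,
    such as kernels and their combinations and products. The identity [P u = u] is nevertheless
    needed for arbitrary members, because [op_eq] compares two operators at every common point of
    their maximal domains. The points $n = -(q+m)$ and $n = 1-(q+m)$ lie outside the range where the
    coefficient identity was obtained. They can be used because independence of the exponentials
    $\nu^n$ makes the polynomial attached to a node vanish identically. They are chosen because the
    falling factorial of $n+q+m$ of length $j$ is zero there for $j \ge 1$, respectively $j \ge 2$,
    so that only one or two terms are left. The unknown is then not $F$ alone but also $x^r
    f^{(r)}(x)$ at the node $x$; three evaluations suffice to eliminate it. Positivity of $m$ enters
    twice: in the construction of psi, and at the end in $r m F_r = 0$. *)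

Lemma eqW d (T : porderType d) (x y : T) : x = y -> (x <= y)%O.
Proof. by move=> ->. Qed.

(** * The modulus and convergence in R[i] *)

Section Cmod.
Variable R : realType.
Implicit Types (z w : R[i]) (a b : R).

Lemma cmodE z : cmod z = Num.sqrt (Re z ^+ 2 + Im z ^+ 2).
Proof. by rewrite /cmod normc_def. Qed.

Lemma normC_cmod z : `|z| = real_complex R (cmod z).
Proof. by rewrite normc_def cmodE. Qed.

Lemma cmod_ge0 z : 0 <= cmod z.
Proof. by rewrite cmodE sqrtr_ge0. Qed.

Lemma sqr_cmod z : cmod z ^+ 2 = Re z ^+ 2 + Im z ^+ 2.
Proof. by rewrite cmodE sqr_sqrtr// addr_ge0// sqr_ge0. Qed.

Lemma cmodM z w : cmod (z * w) = cmod z * cmod w.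
Proof.
by apply/complexI; rewrite rmorphM/= -!normC_cmod normrM.
Qed.

Lemma cmodD z w : cmod (z + w) <= cmod z + cmod w.
Proof. by rewrite -lecR rmorphD/= -!normC_cmod ler_normD. Qed.

Lemma cmod0 : cmod (0 : R[i]) = 0.
Proof. by apply/complexI; rewrite -normC_cmod normr0. Qed.

Lemma cmod1 : cmod (1 : R[i]) = 1.
Proof. by apply/complexI; rewrite -normC_cmod normr1. Qed.

Lemma cmodX z n : cmod (z ^+ n) = cmod z ^+ n.
Proof. by elim: n => [|n IH]; rewrite ?expr0 ?cmod1// !exprS cmodM IH. Qed.

Lemma cmodN z : cmod (- z) = cmod z.
Proof. by apply/complexI; rewrite -!normC_cmod normrN. Qed.

Lemma cmodB z w : cmod (z - w) <= cmod z + cmod w.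
Proof. by rewrite (le_trans (cmodD _ _))// cmodN. Qed.

Lemma cmod_distC z w : cmod (z - w) = cmod (w - z).
Proof. by rewrite -cmodN opprB. Qed.

Lemma cmod_conj z : cmod z^* = cmod z.
Proof. by rewrite !cmodE; case: z => a b /=; rewrite sqrrN. Qed.

Lemma cmod_real a : cmod (real_complex R a) = `|a|.
Proof. by rewrite cmodE/= expr0n addr0 sqrtr_sqr. Qed.

Lemma cmod_nat n : cmod (n%:R : R[i]) = n%:R.
Proof. by rewrite -(rmorph_nat (real_complex R)) cmod_real ger0_norm. Qed.

Lemma cmodV z : cmod z^-1 = (cmod z)^-1.
Proof. by apply/complexI; rewrite -normC_cmod normfV normC_cmod fmorphV. Qed.

Lemma cmod_eq0 z : (cmod z == 0) = (z == 0).
Proof.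
by rewrite -(inj_eq (@complexI R)) -normC_cmod normr_eq0.
Qed.

Lemma cmod_gt0 z : (0 < cmod z) = (z != 0).
Proof. by rewrite lt0r cmod_ge0 andbT cmod_eq0. Qed.

Lemma Re_le_cmod z : `|Re z| <= cmod z.
Proof. by rewrite -lecR (le_trans (normc_ge_Re _))// normC_cmod. Qed.

Lemma Im_le_cmod z : `|Im z| <= cmod z.
Proof.
rewrite -(ler_pXn2r (n := 2))// ?nnegrE ?cmod_ge0//.
by rewrite sqr_cmod real_normK ?num_real// lerDr sqr_ge0.
Qed.

Lemma cmod_le_ReIm z : cmod z <= `|Re z| + `|Im z|.
Proof.
rewrite -(ler_pXn2r (n := 2))// ?nnegrE ?cmod_ge0 ?addr_ge0//.
rewrite sqr_cmod -[Re z ^+ 2]real_normK ?num_real//.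
rewrite -[Im z ^+ 2]real_normK ?num_real//.
by rewrite sqrrD lerD2r lerDl mulrn_wge0// mulr_ge0.
Qed.

Lemma cmod_sum (I : Type) (r : seq I) (P : pred I) (F : I -> R[i]) :
  cmod (\sum_(i <- r | P i) F i) <= \sum_(i <- r | P i) cmod (F i).
Proof.
elim/big_ind2 : _ => //; first by rewrite cmod0.
by move=> x y u v xy uv; rewrite (le_trans (cmodD _ _))// lerD.
Qed.

Lemma ReM z w : Re (z * w) =
  Re z * Re w - Im z * Im w.
Proof. by case: z; case: w. Qed.

Lemma ImM z w : Im (z * w) =
  Re z * Im w + Im z * Re w.
Proof. by case: z => a b; case: w => c d /=; rewrite addrC. Qed.

Lemma ReD z w : Re (z + w) = Re z + Re w.
Proof. by case: z; case: w. Qed.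
Lemma ImD z w : Im (z + w) = Im z + Im w.
Proof. by case: z; case: w. Qed.
Lemma ReN z : Re (- z) = - Re z. Proof. by case: z. Qed.
Lemma ImN z : Im (- z) = - Im z. Proof. by case: z. Qed.
Lemma ReB z w : Re (z - w) = Re z - Re w.
Proof. by rewrite ReD ReN. Qed.
Lemma ImB z w : Im (z - w) = Im z - Im w.
Proof. by rewrite ImD ImN. Qed.
Lemma Re_conj z : Re z^* = Re z. Proof. by case: z. Qed.
Lemma Im_conj z : Im z^* = - Im z. Proof. by case: z. Qed.
Lemma complexP z w :
  Re z = Re w -> Im z = Im w -> z = w.
Proof. by case: z => a b; case: w => c d /= -> ->. Qed.

Lemma mulJ_cmod z : z * z^* = real_complex R (cmod z ^+ 2).
Proof. by rewrite -sqr_normc normC_cmod rmorphXn. Qed.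

Lemma Re_sum (I : Type) (r : seq I) (P : pred I) (F : I -> R[i]) :
  Re (\sum_(i <- r | P i) F i) = \sum_(i <- r | P i) Re (F i).
Proof. by elim/big_ind2 : _ => // x y u v; rewrite ReD => -> ->. Qed.

Lemma Im_sum (I : Type) (r : seq I) (P : pred I) (F : I -> R[i]) :
  Im (\sum_(i <- r | P i) F i) = \sum_(i <- r | P i) Im (F i).
Proof. by elim/big_ind2 : _ => // x y u v; rewrite ImD => -> ->. Qed.

Lemma planeE z : z = plane (Re z, Im z).
Proof. by case: z. Qed.

(* Convergence in R[i], measured in R: the norm of R[i] takes values in R[i]. *)
Definition ccvg (u : nat -> R[i]) (l : R[i]) : Prop :=
  (fun n => cmod (u n - l)) @ \oo --> (0 : R).

Lemma ccvg_lim (u : nat -> R[i]^o) l : ccvg u l -> lim (u @ \oo) = l :> R[i].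
Proof.
move=> ul; have : (u @ \oo --> (l : R[i]^o)); last by move/cvg_lim; apply.
apply/cvgrPdist_lt => /= e e0.
have [e1 ee] : exists e1, e = real_complex R e1.
  by exists (Re e); rewrite RRe_real// gtr0_real.
rewrite ee ltcR in e0.
move/cvgrPdist_lt : ul => /(_ _ e0)[N _ H].
exists N => // n Nn; have := H n Nn.
rewrite /= sub0r normrN ger0_norm ?cmod_ge0// => {}H.
by rewrite ee (_ : `|l - u n| = real_complex R (cmod (u n - l))) ?ltcR// distrC normC_cmod.
Qed.

Lemma ccvg_unique u l l' : ccvg u l -> ccvg u l' -> l = l'.
Proof. by move=> /(@ccvg_lim u) <- /(@ccvg_lim u) <-. Qed.

Lemma ccvg_squeeze u l (v : nat -> R) :
  (forall n, cmod (u n - l) <= v n) -> v @ \oo --> (0 : R) -> ccvg u l.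
Proof.
move=> uv v0; apply: (@squeeze_cvgr _ _ _ _ (fun=> 0) v) => //.
  by apply: nearW => n; rewrite cmod_ge0 uv.
exact: cvg_cst.
Qed.

Lemma ccvg_cst l : ccvg (fun=> l) l.
Proof. by apply: (@ccvg_squeeze _ _ (fun=> 0)); [move=> n; rewrite subrr cmod0|exact: cvg_cst]. Qed.

Lemma ccvgD u v l l' : ccvg u l -> ccvg v l' -> ccvg (fun n => u n + v n) (l + l').
Proof.
move=> ul vl; apply: (@ccvg_squeeze _ _ (fun n => cmod (u n - l) + cmod (v n - l'))).
  by move=> n; rewrite opprD addrACA cmodD.
by rewrite -[X in _ --> X]addr0; apply: cvgD.
Qed.

Lemma ccvgM u v l l' : ccvg u l -> ccvg v l' -> ccvg (fun n => u n * v n) (l * l').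
Proof.
move=> ul vl; apply: (@ccvg_squeeze _ _ (fun n => cmod (u n - l) * cmod (v n - l') +
   cmod (u n - l) * cmod l' + cmod l * cmod (v n - l'))).
  move=> n; rewrite -!cmodM -[X in cmod X <= _](_ : (u n - l) * (v n - l') + (u n - l) * l' + l * (v n - l') = _); last by ring.
  by rewrite (le_trans (cmodD _ _))// lerD2r cmodD.
rewrite (_ : 0 = 0 * 0 + 0 * cmod l' + cmod l * 0); last by rewrite !mul0r mulr0 !addr0.
apply: cvgD; [apply: cvgD|]; apply: cvgM => //; exact: cvg_cst.
Qed.

Lemma ccvgB u v l l' : ccvg u l -> ccvg v l' -> ccvg (fun n => u n - v n) (l - l').
Proof.
move=> ul vl; apply: (@ccvg_squeeze _ _ (fun n => cmod (u n - l) + cmod (v n - l'))).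
  by move=> n; rewrite opprD addrACA -opprD cmodB.
by rewrite -[X in _ --> X]addr0; apply: cvgD.
Qed.

Lemma ccvg_conj u l : ccvg u l -> ccvg (fun n => (u n)^*) l^*.
Proof.
by move=> ul; apply: (@ccvg_squeeze _ _ (fun n => cmod (u n - l))) => // n; rewrite -rmorphB cmod_conj.
Qed.

Lemma ccvg_ReIm u (a b : R) : (fun n => Re (u n)) @ \oo --> a ->
  (fun n => Im (u n)) @ \oo --> b -> ccvg u (Complex a b).
Proof.
move=> ua ub; apply: (@ccvg_squeeze _ _
  (fun n => `|Re (u n) - a| + `|Im (u n) - b|)).
  by move=> n; rewrite (le_trans (cmod_le_ReIm _))// ReB ImB.
rewrite -[X in _ --> X]addr0; apply: cvgD.
  rewrite -[X in _ --> X](@normr0 _ R); apply: cvg_norm.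
  by rewrite -(subrr a); apply: cvgB => //; exact: cvg_cst.
rewrite -[X in _ --> X](@normr0 _ R); apply: cvg_norm.
by rewrite -(subrr b); apply: cvgB => //; exact: cvg_cst.
Qed.

Lemma ccvg_ext u v l : u =1 v -> ccvg u l -> ccvg v l.
Proof. by move=> /funext ->. Qed.

Lemma ccvg_shift u l N : ccvg u l -> ccvg (fun n => u (n + N)%N) l.
Proof. by rewrite /ccvg -(cvg_shiftn N). Qed.

Lemma ccvg_Re u l : ccvg u l -> (fun n => Re (u n)) @ \oo --> Re l.
Proof.
move=> ul; apply/cvgrPdist_le => e e0; near=> n.
rewrite distrC -ReB (le_trans (Re_le_cmod _))//.
have : `|0 - cmod (u n - l)| <= e by near: n; move/cvgrPdist_le : ul; exact.
by rewrite sub0r normrN ger0_norm ?cmod_ge0.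
Unshelve. all: by end_near. Qed.

Lemma ccvg_Im u l : ccvg u l -> (fun n => Im (u n)) @ \oo --> Im l.
Proof.
move=> ul; apply/cvgrPdist_le => e e0; near=> n.
rewrite distrC -ImB (le_trans (Im_le_cmod _))//.
have : `|0 - cmod (u n - l)| <= e by near: n; move/cvgrPdist_le : ul; exact.
by rewrite sub0r normrN ger0_norm ?cmod_ge0.
Unshelve. all: by end_near. Qed.

End Cmod.

(** * Entire functions of exponential type as power series *)

Section PowerSeries.
Variable R : realType.
Implicit Types (z w x : R[i]) (A : nat -> R[i]) (C B y : R).

Lemma exp_coeff_ge0 y n : 0 <= y -> 0 <= exp_coeff y n.
Proof. by move=> y0; rewrite divr_ge0// exprn_ge0. Qed.

Lemma series_exp_coeff_cvg y : series (exp_coeff y) @ \oo --> expR y.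
Proof. exact: is_cvg_series_exp_coeff. Qed.

Lemma series_exp_coeff_le y n : 0 <= y -> series (exp_coeff y) n <= expR y.
Proof.
move=> y0; apply: nondecreasing_cvgn_le; last exact: is_cvg_series_exp_coeff.
apply/nondecreasing_seqP => k; rewrite /series/= big_nat_recr//= lerDl.
exact: exp_coeff_ge0.
Qed.

Lemma sum_exp_coeff_le y n : 0 <= y -> \sum_(k < n) exp_coeff y k <= expR y.
Proof. by move=> y0; have := series_exp_coeff_le n y0; rewrite seriesEord. Qed.

Lemma real_expdom_cvg (t : nat -> R) C y : 0 <= y ->
  (forall k, `|t k| <= C * exp_coeff y k) -> cvg (series t @ \oo).
Proof.
move=> y0 tC; apply: (@normed_cvg _ R^o); apply: (series_le_cvg _ _ tC) => //.
  by move=> n; exact: le_trans (tC n).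
exact: is_cvg_seriesZ (is_cvg_series_exp_coeff _).
Qed.

(** Real and imaginary parts converge absolutely by comparison. The tail estimate is the bound for
    the block of terms from n to n + k, with k sent to infinity; its case n = 0 bounds the sum
    itself. *)
Lemma expdom_cvg (t : nat -> R[i]) C y : 0 <= y ->
  (forall k, cmod (t k) <= C * exp_coeff y k) ->
  exists2 l, ccvg (fun n => \sum_(k < n) t k) l &
    forall n, cmod (l - \sum_(k < n) t k) <= C * (expR y - series (exp_coeff y) n).
Proof.
move=> y0 tC.
have cRe : cvg (series (fun k => Re (t k)) @ \oo).
  by apply: (@real_expdom_cvg _ C y y0) => k; rewrite (le_trans (Re_le_cmod _)).
have cIm : cvg (series (fun k => Im (t k)) @ \oo).
  by apply: (@real_expdom_cvg _ C y y0) => k; rewrite (le_trans (Im_le_cmod _)).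
have tl : ccvg (fun n => \sum_(k < n) t k) (Complex (limn (series (fun k => Re (t k))))
      (limn (series (fun k => Im (t k))))).
  apply: ccvg_ReIm.
  - under eq_fun do rewrite Re_sum.
    by move: cRe; rewrite seriesEord.
  - under eq_fun do rewrite Im_sum.
    by move: cIm; rewrite seriesEord.
eexists; first exact: tl.
move=> n.
set l := Complex _ _ in tl *.
have H k : cmod (\sum_(j < n + k) t j - \sum_(j < n) t j) <=
    C * (series (exp_coeff y) (n + k)%N - series (exp_coeff y) n).
  rewrite big_split_ord/= addrAC subrr add0r (le_trans (cmod_sum _ _ _))//.
  rewrite !seriesEord/= big_split_ord/= addrAC subrr add0r mulr_sumr.
  by apply: ler_sum => j _; exact: tC.
have H2 k : cmod (l - \sum_(j < n) t j) <= C * (expR y - series (exp_coeff y) n) +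
     cmod (\sum_(j < k + n) t j - l).
  rewrite -[X in cmod X](_ : (\sum_(j < k + n) t j - \sum_(j < n) t j) - (\sum_(j < k + n) t j - l) = _); last by ring.
  rewrite (le_trans (cmodB _ _))// lerD2r addnC (le_trans (H _))//.
  have C0 : 0 <= C by have := tC 0%N; rewrite /exp_coeff/= expr0 fact0 invr1 !mulr1; apply: le_trans; rewrite cmod_ge0.
  by rewrite ler_wpM2l// lerD2r series_exp_coeff_le.
have cR : (fun k => C * (expR y - series (exp_coeff y) n) +
     cmod (\sum_(j < k + n) t j - l)) @ \oo --> C * (expR y - series (exp_coeff y) n) + 0.
  by apply: cvgD; [exact: cvg_cst|exact: (ccvg_shift n tl)].
rewrite addr0 in cR; rewrite -(cvg_lim _ cR)//.
by apply: limr_ge; [apply/cvg_ex; eexists; exact: cR|exact: nearW].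
Qed.

Lemma expdom_bound (t : nat -> R[i]) C y l : 0 <= y ->
  (forall k, cmod (t k) <= C * exp_coeff y k) -> ccvg (fun n => \sum_(k < n) t k) l ->
  cmod l <= C * expR y.
Proof.
move=> y0 tC tl; have [l' tl' /(_ 0%N)] := expdom_cvg y0 tC.
by rewrite (ccvg_unique tl tl') big_ord0 subr0 seriesEord/= big_ord0 subr0.
Qed.

Lemma expdom_psum_bound (t : nat -> R[i]) C y n : 0 <= y ->
  (forall k, cmod (t k) <= C * exp_coeff y k) ->
  cmod (\sum_(k < n) t k) <= C * expR y.
Proof.
move=> y0 tC; rewrite (le_trans (cmod_sum _ _ _))//.
apply: (@le_trans _ _ (\sum_(k < n) C * exp_coeff y k)); first by apply: ler_sum => j _; exact: tC.
rewrite -mulr_sumr ler_wpM2l ?sum_exp_coeff_le//.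
by have := tC 0%N; rewrite /exp_coeff/= expr0 fact0 invr1 !mulr1; apply: le_trans; rewrite cmod_ge0.
Qed.

(** Exponential type read off from Taylor coefficients. The class is closed under sums, Cauchy
    products, conjugation and differentiation, with explicit constants, so this single bound
    justifies every manipulation of series below. *)
Definition egf C B A : Prop :=
  0 <= B /\ forall k, cmod (A k) <= C * exp_coeff B k.

(** Written as the limit of [series], exactly as in [repro_kernel], so that the kernel is a [ps] by
    conversion. *)
Definition ps A x : R[i] := limn (series (fun k : nat => A k * x ^+ k : R[i]^o)).

Definition psum A x n : R[i] := \sum_(k < n) A k * x ^+ k.

Lemma egf_ge0 C B A : egf C B A -> 0 <= C.
Proof.
move=> [_ /(_ 0%N)]; rewrite /exp_coeff/= expr0 fact0 invr1 !mulr1.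
by apply: le_trans; rewrite cmod_ge0.
Qed.

Lemma egf_term C B A x : egf C B A ->
  forall k, cmod (A k * x ^+ k) <= C * exp_coeff (B * cmod x) k.
Proof.
move=> [B0 AB] k; rewrite cmodM cmodX.
rewrite (_ : exp_coeff _ k = exp_coeff B k * cmod x ^+ k); last first.
  by rewrite /exp_coeff/= exprMn mulrAC.
rewrite mulrA ler_wpM2r//.
by rewrite exprn_ge0// cmod_ge0.
Qed.

Lemma ps_unique C B A x l : egf C B A -> ccvg (psum A x) l -> ps A x = l.
Proof.
move=> AB Al; rewrite /ps; apply: ccvg_lim.
by rewrite seriesEord.
Qed.

Lemma ps_cvg C B A x : egf C B A -> ccvg (psum A x) (ps A x).
Proof.
move=> AB; have B0 : 0 <= B * cmod x by rewrite mulr_ge0 ?cmod_ge0//; case: AB.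
have [l Al _] := expdom_cvg B0 (egf_term x AB).
by rewrite (ps_unique AB Al).
Qed.

Lemma ps_bound C B A x : egf C B A -> cmod (ps A x) <= C * expR (B * cmod x).
Proof.
move=> AB; have B0 : 0 <= B * cmod x by rewrite mulr_ge0 ?cmod_ge0//; case: AB.
exact: expdom_bound B0 (egf_term x AB) (ps_cvg x AB).
Qed.

Lemma psum_bound C B A x n : egf C B A -> cmod (psum A x n) <= C * expR (B * cmod x).
Proof.
move=> AB; have B0 : 0 <= B * cmod x by rewrite mulr_ge0 ?cmod_ge0//; case: AB.
exact: expdom_psum_bound B0 (egf_term x AB).
Qed.

Lemma egf_conj C B A : egf C B A -> egf C B (fun k => (A k)^*).
Proof. by move=> [B0 AB]; split=> // k; rewrite cmod_conj. Qed.

Lemma conj_ps C B A x : egf C B A -> (ps A x)^* = ps (fun k => (A k)^*) x^*.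
Proof.
move=> AB; apply/esym; apply: (ps_unique (egf_conj AB)).
apply: ccvg_ext (ccvg_conj (ps_cvg x AB)) => n.
by rewrite rmorph_sum; apply: eq_bigr => k _; rewrite rmorphM rmorphXn.
Qed.

Lemma egfZ C B A (a : R[i]) : egf C B A -> egf (cmod a * C) B (fun k => a * A k).
Proof.
by move=> [B0 AB]; split=> // k; rewrite cmodM -mulrA ler_wpM2l ?cmod_ge0.
Qed.

Lemma psZ C B A (a : R[i]) x : egf C B A -> ps (fun k => a * A k) x = a * ps A x.
Proof.
move=> AB; apply: (ps_unique (egfZ a AB)).
apply: ccvg_ext (ccvgM (ccvg_cst a) (ps_cvg x AB)) => n.
by rewrite /psum mulr_sumr; apply: eq_bigr => k _; rewrite mulrA.
Qed.

Lemma ler_exp_coeff y y' k : 0 <= y -> y <= y' -> exp_coeff y k <= exp_coeff y' k.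
Proof.
move=> y0 yy; rewrite ler_wpM2r ?invr_ge0//.
by case: k => [|k]; rewrite ?expr0// ler_pXn2r// nnegrE// (le_trans y0).
Qed.

Lemma egfD C B A C' B' A' : egf C B A -> egf C' B' A' ->
  egf (C + C') (B + B') (fun k => A k + A' k).
Proof.
move=> [B0 AB] [B'0 AB'].
have C0 := egf_ge0 (conj B0 AB); have C'0 := egf_ge0 (conj B'0 AB').
split; first exact: addr_ge0.
move=> k; rewrite (le_trans (cmodD _ _))// mulrDl lerD//.
  by rewrite (le_trans (AB k))// ler_wpM2l// ler_exp_coeff// lerDl.
by rewrite (le_trans (AB' k))// ler_wpM2l// ler_exp_coeff// lerDr.
Qed.

Lemma psD C B A C' B' A' x : egf C B A -> egf C' B' A' ->
  ps (fun k => A k + A' k) x = ps A x + ps A' x.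
Proof.
move=> AB AB'; apply: (ps_unique (egfD AB AB')).
apply: ccvg_ext (ccvgD (ps_cvg x AB) (ps_cvg x AB')) => n.
by rewrite /psum -big_split/=; apply: eq_bigr => k _; rewrite mulrDl.
Qed.

Lemma egf0 : egf 0 0 (fun=> 0).
Proof. by split=> // k; rewrite cmod0 mul0r. Qed.

Lemma ps_zero x : ps (fun=> 0) x = 0.
Proof.
apply: (ps_unique egf0); apply: ccvg_ext (ccvg_cst 0) => n.
by rewrite /psum big1// => k _; rewrite mul0r.
Qed.

Lemma egf_sum (I : Type) (r : seq I) (P : pred I) (A : I -> nat -> R[i]) :
  (forall i, exists C B, egf C B (A i)) ->
  (exists C B, egf C B (fun k => \sum_(i <- r | P i) A i k)) /\
  forall x, ps (fun k => \sum_(i <- r | P i) A i k) x = \sum_(i <- r | P i) ps (A i) x.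
Proof.
move=> HA; elim: r => [|i r [[C [B IH1]] IH2]].
  rewrite (_ : (fun _ => _) = fun=> 0); last by apply/funext => k; rewrite big_nil.
  split; first by exists 0, 0; exact: egf0.
  by move=> x; rewrite ps_zero big_nil.
have [Pi|Pi] := boolP (P i); last first.
  rewrite (_ : (fun _ => _) = (fun k => \sum_(j <- r | P j) A j k)); last first.
    by apply/funext => k; rewrite big_cons (negbTE Pi).
  split; first by exists C, B.
  by move=> x; rewrite IH2 big_cons (negbTE Pi).
rewrite (_ : (fun _ => _) = (fun k => A i k + \sum_(j <- r | P j) A j k)); last first.
  by apply/funext => k; rewrite big_cons Pi.
have [C' [B' Ai]] := HA i.
split; first by do 2 eexists; exact: egfD Ai IH1.
by move=> x; rewrite (psD _ Ai IH1) IH2 big_cons Pi.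
Qed.

Definition cauchyprod A A' k : R[i] := \sum_(j < k.+1) A j * A' (k - j)%N.

(** The binomial theorem divided by k!. It makes the bounds in [egf] multiply without loss under
    Cauchy products. *)
Lemma exp_coeff_conv (B B' : R) k :
  \sum_(j < k.+1) exp_coeff B j * exp_coeff B' (k - j)%N = exp_coeff (B + B') k.
Proof.
rewrite /exp_coeff/= addrC exprDn mulr_suml; apply: eq_bigr => j _.
have jk : (j <= k)%N by rewrite -ltnS.
have fk : k`!%:R = 'C(k, j)%:R * (j`!%:R * (k - j)`!%:R) :> R by rewrite -!natrM bin_fact.
have bn0 : 'C(k, j)%:R != 0 :> R by rewrite pnatr_eq0 -lt0n bin_gt0.
have f1 : j`!%:R != 0 :> R by rewrite pnatr_eq0 -lt0n fact_gt0.
have f2 : (k - j)`!%:R != 0 :> R by rewrite pnatr_eq0 -lt0n fact_gt0.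
by rewrite fk -[_ *+ _ in RHS]mulr_natr; field; rewrite bn0 f1 f2.
Qed.

Lemma egfM C B A C' B' A' : egf C B A -> egf C' B' A' ->
  egf (C * C') (B + B') (cauchyprod A A').
Proof.
move=> [B0 AB] [B'0 AB']; split; first exact: addr_ge0.
move=> k; rewrite (le_trans (cmod_sum _ _ _))// -exp_coeff_conv mulr_sumr.
apply: ler_sum => j _; rewrite cmodM mulrACA ler_pM ?cmod_ge0//.
Qed.

Lemma cauchyprod_scale A A' x k :
  cauchyprod A A' k * x ^+ k = cauchyprod (fun j => A j * x ^+ j) (fun j => A' j * x ^+ j) k.
Proof.
rewrite /cauchyprod mulr_suml; apply: eq_bigr => j _.
have jk : (j <= k)%N by rewrite -ltnS.
have -> : x ^+ k = x ^+ j * x ^+ (k - j) by rewrite -exprD subnKC.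
by ring.
Qed.

Lemma triangular_sum (V : zmodType) (F : nat -> nat -> V) n :
  \sum_(k < n) \sum_(j < k.+1) F j (k - j)%N = \sum_(j < n) \sum_(i < n - j) F j i.
Proof.
elim: n => [|n IH]; first by rewrite !big_ord0.
rewrite big_ord_recr/= IH [RHS]big_ord_recr/= subSnn big_ord1.
rewrite [X in _ + X = _]big_ord_recr/= subnn addrA; congr (_ + _).
rewrite -big_split/=; apply: eq_bigr => j _.
by rewrite subSn ?big_ord_recr//= ltnW.
Qed.

(** What remains are the index pairs of the square beyond its antidiagonal. The ring is arbitrary
    because the identity is applied both to the complex terms and to their real majorants. *)
Lemma square_triangular_sum (V : pzRingType) (a b : nat -> V) n :
  (\sum_(k < n) a k) * (\sum_(k < n) b k) - \sum_(k < n) \sum_(j < k.+1) a j * b (k - j)%N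
  = \sum_(j < n) \sum_(n - j <= i < n) a j * b i.
Proof.
rewrite (triangular_sum (fun i j => a i * b j)) mulr_suml -sumrB; apply: eq_bigr => j _.
rewrite mulr_sumr -!(big_mkord xpredT (fun i => a j * b i)).
by rewrite (big_cat_nat (leq0n (n - j)) (leq_subr j n))/= addrAC subrr add0r.
Qed.

(** The gap between the product of partial sums and the partial sum of the Cauchy product is
    dominated by the same gap for two exponential series, which tends to 0 because the exponential
    is multiplicative. *)
Lemma psM C B A C' B' A' x : egf C B A -> egf C' B' A' ->
  ps (cauchyprod A A') x = ps A x * ps A' x.
Proof.
move=> AB AB'; apply: (ps_unique (egfM AB AB')).
have B0 : 0 <= B * cmod x by rewrite mulr_ge0 ?cmod_ge0//; case: AB.
have B'0 : 0 <= B' * cmod x by rewrite mulr_ge0 ?cmod_ge0//; case: AB'.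
pose y := B * cmod x; pose y' := B' * cmod x.
have d0 : ccvg (fun n => psum A x n * psum A' x n - psum (cauchyprod A A') x n) 0.
  apply: (@ccvg_squeeze _ _ _ (fun n => C * C' * (series (exp_coeff y) n * series (exp_coeff y') n -
      series (exp_coeff (y + y')) n))).
    move=> n; rewrite subr0 /psum.
    under [X in _ - X]eq_bigr do rewrite cauchyprod_scale.
    rewrite /cauchyprod (square_triangular_sum (fun k => A k * x ^+ k) (fun k => A' k * x ^+ k)).
    rewrite !seriesEord/=.
    under [X in _ * (_ - X)]eq_bigr do rewrite -exp_coeff_conv.
    rewrite (square_triangular_sum (exp_coeff y) (exp_coeff y')) mulr_sumr.
    rewrite (le_trans (cmod_sum _ _ _))//; apply: ler_sum => j _.
    rewrite mulr_sumr (le_trans (cmod_sum _ _ _))//; apply: ler_sum => i _.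
    by rewrite cmodM mulrACA ler_pM ?cmod_ge0//; exact: egf_term.
  rewrite -(mulr0 (C * C')) -(subrr (expR (y + y'))); apply: cvgM; first exact: cvg_cst.
  apply: cvgB; last exact: series_exp_coeff_cvg.
  by rewrite expRD; apply: cvgM; exact: series_exp_coeff_cvg.
have := ccvgB (ccvgM (ps_cvg x AB) (ps_cvg x AB')) d0; rewrite subr0.
by apply: ccvg_ext => n; rewrite opprB addrC subrK.
Qed.

Definition dcoef A k : R[i] := k.+1%:R * A k.+1.

Lemma egf_dcoef C B A : egf C B A -> egf (C * B) B (dcoef A).
Proof.
move=> [B0 AB]; split=> // k; rewrite cmodM cmod_nat.
apply: (@le_trans _ _ (k.+1%:R * (C * exp_coeff B k.+1))); first by rewrite ler_wpM2l.
rewrite /exp_coeff/= exprS factS natrM.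
have f1 : k`!%:R != 0 :> R by rewrite pnatr_eq0 -lt0n fact_gt0.
apply: eqW; field.
by rewrite f1 nat1r pnatr_eq0.
Qed.

(** The factorisation of a difference of powers is applied twice. The factor (n + 2)(n + 1) cancels
    against the factorial in the coefficient bound, so that the remainders sum to an exponential in
    [ps_diff]. *)
Lemma expr_taylor2 (x h : R[i]) (r : R) n : cmod x <= r -> cmod (x + h) <= r ->
  cmod ((x + h) ^+ n.+2 - x ^+ n.+2 - n.+2%:R * x ^+ n.+1 * h) <=
    cmod h ^+ 2 * (n.+2 * n.+1)%:R * r ^+ n.
Proof.
move=> xr xhr.
have r0 : 0 <= r by exact: le_trans (cmod_ge0 x) xr.
have H1 k : cmod ((x + h) ^+ k.+1 - x ^+ k.+1) <= cmod h * k.+1%:R * r ^+ k.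
  rewrite subrXX cmodM [x + h]addrC addrK -mulrA ler_wpM2l ?cmod_ge0//.
  rewrite (le_trans (cmod_sum _ _ _))//.
  apply: (@le_trans _ _ (\sum_(i < k.+1) r ^+ k)).
    apply: ler_sum => i _; rewrite cmodM !cmodX.
    have ik : (i <= k)%N by rewrite -ltnS.
    have -> : r ^+ k = r ^+ (k - i) * r ^+ i by rewrite -exprD subnK.
    rewrite ?subSS ler_pM ?exprn_ge0 ?cmod_ge0//.
      by rewrite lerXn2r// ?nnegrE ?cmod_ge0// addrC.
    by rewrite lerXn2r// ?nnegrE ?cmod_ge0.
  by rewrite sumr_const card_ord mulr_natl.
rewrite subrXX [x + h - x]addrAC subrr add0r.
rewrite (_ : n.+2%:R * x ^+ n.+1 * h = h * \sum_(i < n.+2) x ^+ n.+1); last first.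
  by rewrite sumr_const card_ord -mulr_natl; ring.
rewrite -mulrBr cmodM expr2 -!mulrA ler_wpM2l ?cmod_ge0// -sumrB.
rewrite (le_trans (cmod_sum _ _ _))//.
apply: (@le_trans _ _ (\sum_(i < n.+2) cmod h * n.+1%:R * r ^+ n)).
  apply: ler_sum => i _; have ik : (i <= n.+1)%N by rewrite -ltnS.
  have -> : x ^+ n.+1 = x ^+ (n.+1 - i) * x ^+ i by rewrite -exprD subnK.
  rewrite ?subSS -mulrBl cmodM.
  case ni : (n.+1 - i)%N => [|j].
    by rewrite !expr0 subrr cmod0 mul0r !mulr_ge0 ?cmod_ge0 ?exprn_ge0.
  have jn : (j.+1 + i = n.+1)%N by rewrite -ni subnK.
  have nji : n = (j + i)%N by move: jn; rewrite addSn => -[].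
  have -> : r ^+ n = r ^+ j * r ^+ i by rewrite -exprD -nji.
  rewrite mulrA ler_pM ?cmod_ge0//; last by rewrite cmodX lerXn2r// ?nnegrE ?cmod_ge0.
  rewrite (le_trans (H1 j))// ler_wpM2r ?exprn_ge0// ler_wpM2l ?cmod_ge0//.
  by rewrite ler_nat nji ltnS leq_addr.
by rewrite sumr_const card_ord -mulr_natl natrM; apply: eqW; ring.
Qed.

Lemma ps_diff C B A x h : egf C B A ->
  cmod (ps A (x + h) - ps A x - ps (dcoef A) x * h) <=
    cmod h ^+ 2 * (C * B ^+ 2 * expR (B * (cmod x + cmod h))).
Proof.
move=> AB; have [B0 AB'] := AB; have C0 := egf_ge0 AB.
set r := cmod x + cmod h; have r0 : 0 <= r by rewrite addr_ge0 ?cmod_ge0.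
(* The terms of degree 0 and 1 cancel, hence the shift by two; [dcoef] is already shifted by one, so
   n + 1 of its terms match n + 2 terms of [A]. *)
have S n : psum A (x + h) n.+2 - psum A x n.+2 - psum (dcoef A) x n.+1 * h =
    \sum_(k < n) A k.+2 * ((x + h) ^+ k.+2 - x ^+ k.+2 - k.+2%:R * x ^+ k.+1 * h).
  rewrite /psum mulr_suml [X in X - _ - _]big_ord_recl [X in _ - X - _]big_ord_recl.
  rewrite !expr0 /= opprD addrACA subrr add0r -!sumrB big_ord_recl/= !expr0 /dcoef/=.
  rewrite [X in X + _](_ : _ = 0) ?add0r; last by rewrite !expr1; ring.
  by apply: eq_bigr => k _; rewrite /bump/= !add1n; ring.
have cv : ccvg (fun n => \sum_(k < n) A k.+2 * ((x + h) ^+ k.+2 - x ^+ k.+2 - k.+2%:R * x ^+ k.+1 * h))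
   (ps A (x + h) - ps A x - ps (dcoef A) x * h).
  have c1 := ccvg_shift 2 (ccvgB (ps_cvg (x + h) AB) (ps_cvg x AB)).
  have c2 := ccvg_shift 1 (ccvgM (ps_cvg x (egf_dcoef AB)) (ccvg_cst h)).
  by apply: ccvg_ext (ccvgB c1 c2) => n; rewrite addn2 addn1 S.
rewrite mulrA; apply: (@expdom_bound (fun k => A k.+2 * ((x + h) ^+ k.+2 - x ^+ k.+2 - k.+2%:R * x ^+ k.+1 * h)) _ (B * r)).
- by rewrite mulr_ge0.
- move=> k; rewrite cmodM.
  have H := @expr_taylor2 x h r k _ _.
  apply: (@le_trans _ _ (C * exp_coeff B k.+2 * (cmod h ^+ 2 * (k.+2 * k.+1)%:R * r ^+ k))).
    by rewrite ler_pM ?cmod_ge0// H// ?lerDl ?cmod_ge0// cmodD.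
  rewrite /exp_coeff/= !exprS exprMn !factS !natrM.
  have f1 : k`!%:R != 0 :> R by rewrite pnatr_eq0 -lt0n fact_gt0.
  apply: eqW; field.
  by rewrite f1 nat1r -natrD !pnatr_eq0.
- exact: cv.
Qed.

End PowerSeries.

(** * Borel measurability of continuous functions on the plane *)

Section PlaneMeasure.
Variable R : realType.
Local Notation RR := (measurableTypeR R * measurableTypeR R)%type.

(** An open set is the union of those boxes with rational centre and half-width 1/(n + 1) that it
    contains, a countable family of measurable sets. *)
Lemma open_measurable2 (O : set (R * R)) : open O -> measurable (O : set RR).
Proof.
move=> oO.
have H1 (a b c : R) : a - c < b -> b < a + c -> b - c < a < b + c.
  by move=> ? ?; apply/andP; split; lra.
have H2 (a q u c e : R) : a - c < q -> q < a + c -> q - c < u -> u < q + c -> c < e / 2 ->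
    `|a - u| < e.
  by move=> *; rewrite ltr_norml; apply/andP; split; lra.
pose bx (q : rat * rat * nat) : set RR :=
  `]ratr q.1.1 - q.2.+1%:R^-1, ratr q.1.1 + q.2.+1%:R^-1[%classic `*`
  `]ratr q.1.2 - q.2.+1%:R^-1, ratr q.1.2 + q.2.+1%:R^-1[%classic.
have -> : O = \bigcup_q (if `[< bx q `<=` O >] then bx q else set0).
  apply/seteqP; split=> [[x y] Oxy|p [q _]]; last by case: asboolP => // qO /qO.
  have /nbhs_ballP[e /= e0 eO] : nbhs (x, y) O by exact: open_nbhs_nbhs.
  (* In each coordinate the rational centre is within 1/(n + 1) of the given point and the box
     within 1/(n + 1) of its centre, so half of e is the right threshold. *)
  have [n ne] : exists n : nat, (n.+1%:R : R)^-1 < e / 2.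
    have e2 : 0 < e / 2 by rewrite divr_gt0.
    exists (Num.truncn (e / 2)^-1); rewrite invf_plt ?posrE//.
    by rewrite Num.Theory.truncnS_gt ?num_real.
  have n0 : 0 < (n.+1%:R : R)^-1 by rewrite invr_gt0.
  have [|q1 q1x] := @rat_in_itvoo _ (x - n.+1%:R^-1) (x + n.+1%:R^-1).
    by rewrite ltrD2l (lt_trans _ n0)// oppr_lt0.
  have [|q2 q2y] := @rat_in_itvoo _ (y - n.+1%:R^-1) (y + n.+1%:R^-1).
    by rewrite ltrD2l (lt_trans _ n0)// oppr_lt0.
  exists (q1, q2, n) => //; rewrite /bx/=; clear bx.
  move: q1x q2y; rewrite !in_itv/= => /andP[a1 a2] /andP[b1 b2].
  case: asboolP => [_|].
    by split; rewrite /= in_itv/= H1.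
  case => -[u v] [/= uv1 uv2]; apply: eO; split => /=; move: uv1 uv2; rewrite !in_itv/= /ball/= => /andP[u1 u2] /andP[v1 v2].
    exact: H2 a1 a2 u1 u2 ne.
  exact: H2 b1 b2 v1 v2 ne.
apply: countable_bigcupT_measurable => [|q]; first exact: countableP.
case: asboolP => // _.
exact: measurableX.
Qed.

Lemma continuous_measurable2 (k : R * R -> R) : continuous k ->
  measurable_fun [set: RR] k.
Proof.
move=> /continuousP ck.
apply: (measurability _ (RGenOInfty.measurableE R)) => //.
move=> _ [_ [a ->] <-]; rewrite setTI.
by apply: open_measurable2; apply: ck; exact: interval_open.
Qed.

End PlaneMeasure.

(** * Integrals of bounded functions over sets of finite measure *)

Section RintegralBound.
Context {d} {T : measurableType d} {R : realType} (mu : {measure set T -> \bar R}).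

Lemma bounded_integrable (D : set T) (f : T -> R) (M : R) : measurable D ->
  (mu D < +oo)%E -> measurable_fun [set: T] f -> (forall x, D x -> `|f x| <= M) ->
  mu.-integrable D (EFin \o f).
Proof.
move=> mD Dfin mf fM; apply: measurable_bounded_integrable => //.
  exact: measurable_funTS.
exists M; split; first exact: num_real.
by move=> y My x Dx /=; rewrite (le_trans (fM x Dx))// ltW.
Qed.

Lemma Rintegral_approx (D : set T) (f : T -> R) (c e : R) : measurable D ->
  (mu D < +oo)%E -> measurable_fun [set: T] f -> (forall x, D x -> `|f x - c| <= e) ->
  `|\int[mu]_(x in D) f x - c * fine (mu D)| <= e * fine (mu D).
Proof.
move=> mD Dfin mf fc.
have cI (b : R) : mu.-integrable D (EFin \o cst b).
  by apply: (@bounded_integrable _ _ `|b|) => //.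
have fI : mu.-integrable D (EFin \o f).
  apply: (@bounded_integrable _ _ (e + `|c|)) => // x Dx.
  by rewrite -[f x](subrK c) (le_trans (ler_normD _ _))// lerD2r fc.
rewrite -!Rintegral_cst// -RintegralB//; last exact: cI.
have fcI : mu.-integrable D (EFin \o (fun x => f x - c)).
  apply: (@bounded_integrable _ _ e) => //.
  by apply: measurable_funB => //.
rewrite (le_trans (le_normr_Rintegral _ fcI))//.
apply: le_Rintegral => //; last exact: cI.
apply: (@bounded_integrable _ _ e) => //; last by move=> x Dx; rewrite normr_id fc.
by apply: measurableT_comp => //; exact: measurable_funB.
Qed.

End RintegralBound.

Lemma setXUl (T U : Type) (A B : set T) (C : set U) :
  (A `|` B) `*` C = A `*` C `|` B `*` C.
Proof. by apply/predeqP => -[a b] /=; split=> [[[?|?] ?]|[[? ?]|[? ?]]]; tauto. Qed.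

Lemma setXUr (T U : Type) (A : set T) (B C : set U) :
  A `*` (B `|` C) = A `*` B `|` A `*` C.
Proof. by apply/predeqP => -[a b] /=; split=> [[? [?|?]]|[[? ?]|[? ?]]]; tauto. Qed.

(** * Green's formula for differentiable functions *)

Section GoursatGreen.
Variable R : realType.
Local Notation RR := (measurableTypeR R * measurableTypeR R)%type.
Local Notation leb := (@lebesgue_measure R).
Implicit Types (P Q k : R * R -> R) (x y s : R) (p : R * R).

(** Total differentiability at the single point [p], with partial derivatives [a] and [b]. Nothing
    is asked of the partial derivatives nearby, which is why Green's formula has to go through
    bisection. *)
Definition rdiff P p (a b : R) : Prop := forall e, 0 < e -> exists2 d, 0 < d &
  forall q : R * R, `|q.1 - p.1| <= d -> `|q.2 - p.2| <= d ->
    `|P q - P p - a * (q.1 - p.1) - b * (q.2 - p.2)| <=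
      e * (`|q.1 - p.1| + `|q.2 - p.2|).

Lemma leb_itv x s : 0 <= s -> leb `[x, x + s[%classic = s%:E.
Proof.
move=> s0; rewrite lebesgue_measure_itv/= lte_fin ltrDl -EFinD [x + s]addrC addrK.
by case: ltP => // s0'; congr EFin; apply/le_anti; rewrite s0 s0'.
Qed.

Lemma leb_itv_lty x s : 0 <= s -> (leb `[x, (x + s)%R[%classic < +oo)%E.
Proof. by move=> s0; rewrite leb_itv// ltry. Qed.

Lemma area_rect x s y s' : 0 <= s -> 0 <= s' ->
  area R (`[x, x + s[%classic `*` `[y, y + s'[%classic) = (s * s')%:E.
Proof.
move=> s0 s'0.
transitivity (leb `[x, (x + s)%R[%classic * leb `[y, (y + s')%R[%classic)%E; last by rewrite !leb_itv.
exact: product_measure1E.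
Qed.

Lemma continuous_slice1 P y : continuous P -> continuous (fun t => P (t, y)).
Proof.
move=> cP t; apply: (@continuous_comp _ _ _ (fun t => (t, y)) P); last exact: cP.
exact: (@cvg_pair _ _ _ (nbhs t) (nbhs t) (nbhs y) _ _ _ id (fun=> y) cvg_id (cvg_cst _)).
Qed.

Lemma continuous_slice2 P x : continuous P -> continuous (fun t => P (x, t)).
Proof.
move=> cP t; apply: (@continuous_comp _ _ _ (fun t => (x, t)) P); last exact: cP.
exact: (@cvg_pair _ _ _ (nbhs t) (nbhs x) (nbhs t) _ _ _ (fun=> x) id (cvg_cst _) cvg_id).
Qed.

Lemma continuous_bounded_rect k x s y s' : continuous k ->
  exists M, forall p, x <= p.1 <= x + s -> y <= p.2 <= y + s' -> `|k p| <= M.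
Proof.
move=> ck.
have cK : compact (k @` (`[x, x + s]%classic `*` `[y, y + s']%classic)).
  apply: continuous_compact; first by apply: continuous_subspaceT => p; exact: ck.
  by apply: compact_setX; exact: segment_compact.
have /compact_bounded[M [_ HM]] := cK.
exists (M + 1) => p px py; apply: (HM (M + 1)); first by rewrite ltrDl.
by exists p => //; split; rewrite /= in_itv.
Qed.

Lemma rect_integrable k x s y s' : continuous k -> 0 <= s -> 0 <= s' ->
  (area R).-integrable (`[x, x + s[%classic `*` `[y, y + s'[%classic) (EFin \o k).
Proof.
move=> ck s0 s'0; have [M HM] := continuous_bounded_rect x s y s' ck.
apply: (@bounded_integrable _ _ _ _ _ _ M) => //.
- exact: measurableX.
- by rewrite -/(area R) area_rect// ltry.
- exact: continuous_measurable2.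
- move=> p [/= p1 p2]; apply: HM; move: p1 p2; rewrite !in_itv/= => /andP[a b] /andP[c d].
    by rewrite a ltW.
  by rewrite c ltW.
Qed.

Lemma edge_integrable (f : R -> R) x s : continuous f -> leb.-integrable `[x, x + s[%classic (EFin \o f).
Proof.
move=> cf; have h : leb.-integrable `[x, x + s]%classic (EFin \o f).
  apply: continuous_compact_integrable; first exact: segment_compact.
  by apply: continuous_subspaceT => t; exact: cf.
apply: integrableS h => //.
by apply: subset_itvl; rewrite bnd_simp.
Qed.

(** Half-open intervals make the two halves disjoint, so integrals add up exactly under
    bisection. *)
Definition edge (f : R -> R) x s := \int[leb]_(t in `[x, x + s[) f t.

Lemma itv_halves x s : 0 <= s -> `[x, x + s[%classic =
  `[x, x + s / 2[%classic `|` `[x + s / 2, x + s / 2 + s / 2[%classic :> set R.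
Proof.
move=> s0; rewrite -addrA -splitr; apply/seteqP; split=> t /=; rewrite !in_itv/=.
  by move=> /andP[-> ->]; case: (ltP t (x + s / 2)) => H; [left|right].
move=> [/andP[-> H]|/andP[H ->]]; rewrite ?andbT.
  by rewrite (lt_le_trans H)// lerD2l; lra.
by rewrite (le_trans _ H)// lerDl; lra.
Qed.

Lemma itv_halves_disj x s : [disjoint `[x, x + s / 2[%classic &
   `[x + s / 2, x + s / 2 + s / 2[%classic : set R].
Proof.
rewrite disj_set2E; apply/eqP/seteqP; split => // t [/=]; rewrite !in_itv/=.
by move=> /andP[_ H] /andP[/(lt_le_trans H)]; rewrite ltxx.
Qed.

Lemma edge_split (f : R -> R) x s : continuous f -> 0 <= s ->
  edge f x s = edge f x (s / 2) + edge f (x + s / 2) (s / 2).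
Proof.
move=> cf s0; rewrite /edge [in LHS]itv_halves// Rintegral_setU//.
- by rewrite -itv_halves//; exact: edge_integrable.
- exact: itv_halves_disj.
Qed.

Definition rint k x s y s' :=
  \int[area R]_(p in `[x, x + s[ `*` `[y, y + s'[) k p.

Lemma rint_split1 k x s y s' : continuous k -> 0 <= s -> 0 <= s' ->
  rint k x s y s' = rint k x (s / 2) y s' + rint k (x + s / 2) (s / 2) y s'.
Proof.
move=> ck s0 s'0; rewrite /rint [in LHS]itv_halves// setXUl Rintegral_setU//.
- exact: measurableX.
- exact: measurableX.
- by rewrite -setXUl -itv_halves//; exact: rect_integrable.
- rewrite disj_set2E; apply/eqP; rewrite -setXI.
  have := itv_halves_disj x s; rewrite disj_set2E => /eqP ->.
  by rewrite set0X.
Qed.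

Lemma rint_split2 k x s y s' : continuous k -> 0 <= s -> 0 <= s' ->
  rint k x s y s' = rint k x s y (s' / 2) + rint k x s (y + s' / 2) (s' / 2).
Proof.
move=> ck s0 s'0; rewrite /rint [`[y, _[%classic in LHS]itv_halves// setXUr Rintegral_setU//.
- exact: measurableX.
- exact: measurableX.
- by rewrite -setXUr -itv_halves//; exact: rect_integrable.
- rewrite disj_set2E; apply/eqP; rewrite -setXI.
  have := itv_halves_disj y s'; rewrite disj_set2E => /eqP ->.
  by rewrite setX0.
Qed.

(** The counterclockwise integral of P dx + Q dy along the boundary of a square, minus the double
    integral of k; Green's formula is its vanishing for $k = Q_x - P_y$. *)
Definition green_defect P Q k x y s : R :=
  edge (fun t => P (t, y)) x s - edge (fun t => P (t, y + s)) x s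
  + edge (fun t => Q (x + s, t)) y s - edge (fun t => Q (x, t)) y s
  - rint k x s y s.

Lemma green_defect_split P Q k x y s : continuous P -> continuous Q -> continuous k -> 0 <= s ->
  green_defect P Q k x y s =
    green_defect P Q k x y (s / 2) + green_defect P Q k (x + s / 2) y (s / 2) +
    (green_defect P Q k x (y + s / 2) (s / 2) + green_defect P Q k (x + s / 2) (y + s / 2) (s / 2)).
Proof.
move=> cP cQ ck s0; have s20 : 0 <= s / 2 by rewrite divr_ge0.
have ys : y + s / 2 + s / 2 = y + s by rewrite -addrA -splitr.
have xs : x + s / 2 + s / 2 = x + s by rewrite -addrA -splitr.
rewrite /green_defect xs ys (rint_split1 _ _ ck s0 s0).
rewrite (rint_split2 x y ck s20 s0) (rint_split2 (x + s / 2) y ck s20 s0).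
rewrite (edge_split x (continuous_slice1 (y := y) cP) s0).
rewrite (edge_split x (continuous_slice1 (y := y + s) cP) s0).
rewrite (edge_split y (continuous_slice2 (x := x) cQ) s0).
rewrite (edge_split y (continuous_slice2 (x := x + s) cQ) s0).
by ring.
Qed.

(** The property [B] stands for a lower bound on the defect. Choosing a good quarter again and again
    gives nested squares, and [p] is their common point, with coordinates the suprema of the lower
    left corners. *)
Lemma bisection (B : R -> R -> R -> Prop) x0 y0 s0 : 0 < s0 -> B x0 y0 s0 ->
  (forall x y s, 0 < s -> B x y s -> exists x' y', [/\ B x' y' (s / 2), x <= x' <= x + s / 2 & y <= y' <= y + s / 2]) ->
  exists p : R * R, forall d, 0 < d -> exists x y s,
    [/\ B x y s, 0 < s < d, x <= p.1 <= x + s & y <= p.2 <= y + s].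
Proof.
move=> s0_gt0 B0 step.
pose good (t : R * R * R) := 0 < t.2 /\ B t.1.1 t.1.2 t.2.
(* The choice function has to be total, so a triple that is not good is sent to itself without any
   promise. *)
have /choice[f Hf] : forall t : R * R * R, exists t' : R * R * R, good t ->
    [/\ good t', t'.2 = t.2 / 2, t.1.1 <= t'.1.1 <= t.1.1 + t.2 / 2 & t.1.2 <= t'.1.2 <= t.1.2 + t.2 / 2].
  move=> t; have [[t0 tB]|?] := pselect (good t); last by exists t.
  have [x' [y' [H1 H2 H3]]] := step _ _ _ t0 tB.
  by exists (x', y', t.2 / 2) => _; split=> //; split => //=; rewrite divr_gt0.
pose u n := iter n f (x0, y0, s0).
have ug n : good (u n) by elim: n => [|n IH] //=; have [] := Hf _ IH.
have us n : (u n).2 = s0 / 2 ^+ n.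
  elim: n => [|n IH]; first by rewrite expr0 divr1.
  by have [_ -> _ _] := Hf _ (ug n); rewrite -/(u n) IH exprSr invfM mulrA.
(* Used once per coordinate: lower ends increase, upper ends decrease, and every lower end lies
   below every upper end. *)
have mono (c : R * R * R -> R) : (forall t, good t -> c t <= c (f t) <= c t + t.2 / 2) ->
    (forall t, good t -> (f t).2 = t.2 / 2) ->
    exists r : R, forall n, c (u n) <= r <= c (u n) + (u n).2.
  move=> Hc Hs.
  have c1 n j : c (u n) <= c (u (j + n)%N).
    elim: j => [|j IH] //; rewrite addSn (le_trans IH)//.
    by have /andP[] := Hc _ (ug (j + n)%N).
  have c2 n j : c (u (j + n)%N) + (u (j + n)%N).2 <= c (u n) + (u n).2.
    elim: j => [|j IH] //; rewrite addSn (le_trans _ IH)// (_ : u _.+1 = f (u (j + n)%N))// Hs//.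
    have /andP[_ h] := Hc _ (ug (j + n)%N).
    rewrite (le_trans (lerD h (lexx _)))// -addrA lerD2l; lra.
  have c3 n j : c (u j) <= c (u n) + (u n).2.
    rewrite (le_trans (c1 j n))// addnC (le_trans _ (c2 n j))// lerDl.
    by rewrite ltW//; case: (ug (j + n)%N).
  exists (sup [set c (u n) | n in setT]) => n; apply/andP; split.
    apply: ub_le_sup; last by exists n.
    by exists (c (u 0%N) + (u 0%N).2) => _ [j _ <-]; exact: c3.
  apply: ge_sup; first by exists (c (u 0%N)), 0%N.
  by move=> _ [j _ <-]; exact: c3.
have [p1 Hp1] := mono (fun t => t.1.1) (fun t g => let: And4 _ _ h _ := Hf t g in h)
  (fun t g => let: And4 _ h _ _ := Hf t g in h).
have [p2 Hp2] := mono (fun t => t.1.2) (fun t g => let: And4 _ _ _ h := Hf t g in h)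
  (fun t g => let: And4 _ h _ _ := Hf t g in h).
exists (p1, p2) => d d0.
have [n nd] : exists n, (u n).2 < d.
  exists (Num.truncn (s0 / d)); rewrite us.
  rewrite ltr_pdivrMr ?exprn_gt0// mulrC -ltr_pdivrMr//.
  have := Num.Theory.truncnS_gt (s0 / d); move/lt_le_trans; apply.
  by rewrite -natrX ler_nat ltn_expl.
have [un0 unB] := ug n.
exists (u n).1.1, (u n).1.2, (u n).2; split => //.
by rewrite un0.
Qed.

(** The affine parts of P and Q contribute exactly (c - b) s^2, which k(p) s^2 cancels. The errors
    are 4 e s^2 for each of the two pairs of opposite edges and e s^2 for the double integral, hence
    the factor 9. *)
Lemma green_defect_local P Q k p a b c d : continuous P -> continuous Q -> continuous k ->
  rdiff P p a b -> rdiff Q p c d -> c - b = k p -> forall e, 0 < e -> exists2 dl, 0 < dl &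
  forall x y s, 0 < s < dl -> x <= p.1 <= x + s -> y <= p.2 <= y + s ->
    `|green_defect P Q k x y s| <= 9 * e * s ^+ 2.
Proof.
move=> cP cQ ck dP dQ cbk e e0.
have [d1 d10 H1] := dP _ e0; have [d2 d20 H2] := dQ _ e0.
have /cvgrPdist_le/(_ _ e0)/nbhs_ballP[d3 /= d30 H3] := ck p.
have dl0 : 0 < Num.min d1 (Num.min d2 d3) by rewrite !lt_min d10 d20 d30.
exists (Num.min d1 (Num.min d2 d3)) => // x y s; rewrite !lt_min => /andP[s0 /and3P[sd1 sd2 sd3]] px py.
have ss : 0 <= s by exact: ltW.
have close t : x <= t <= x + s -> `|t - p.1| <= s.
  by move=> tx; rewrite ler_norml; apply/andP; split; lra.
have close2 t : y <= t <= y + s -> `|t - p.2| <= s.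
  by move=> tx; rewrite ler_norml; apply/andP; split; lra.
have fP : fine (leb `[x, x + s[%classic) = s by rewrite leb_itv.
have fQ : fine (leb `[y, y + s[%classic) = s by rewrite leb_itv.
have y0 : y <= y <= y + s by rewrite lexx lerDl.
have ys : y <= y + s <= y + s by rewrite lexx lerDl ss.
have x0 : x <= x <= x + s by rewrite lexx lerDl.
have xs : x <= x + s <= x + s by rewrite lexx lerDl ss.
(* Both points lie within s of p in each coordinate, so each expansion errs by at most 2 e s, and
   F(p) drops out of the difference. *)
have HE (F : R * R -> R) (a' b' : R) q1 q2 : (forall q, `|q.1 - p.1| <= s -> `|q.2 - p.2| <= s ->
    `|F q - F p - a' * (q.1 - p.1) - b' * (q.2 - p.2)| <= e * (`|q.1 - p.1| + `|q.2 - p.2|)) ->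
    x <= q1.1 <= x + s -> y <= q1.2 <= y + s -> x <= q2.1 <= x + s -> y <= q2.2 <= y + s ->
    `|F q1 - F q2 - a' * (q1.1 - q2.1) - b' * (q1.2 - q2.2)| <= 4 * e * s.
  move=> HF A1 A2 A3 A4.
  have h1 := HF q1 (close _ A1) (close2 _ A2); have h2 := HF q2 (close _ A3) (close2 _ A4).
  have b1 := close _ A1; have b2 := close2 _ A2; have b3 := close _ A3; have b4 := close2 _ A4.
  rewrite -[X in `|X|](_ : (F q1 - F p - a' * (q1.1 - p.1) - b' * (q1.2 - p.2)) -
     (F q2 - F p - a' * (q2.1 - p.1) - b' * (q2.2 - p.2)) = _); last by ring.
  rewrite (le_trans (ler_normB _ _))// (le_trans (lerD h1 h2))// -mulrDr [4 * e]mulrC -mulrA ler_wpM2l ?(ltW e0)//.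
  lra.
have EP : `|edge (fun t => P (t, y)) x s - edge (fun t => P (t, y + s)) x s - (- b * s) * s| <= 4 * e * s * s.
  rewrite /edge -RintegralB//; try (by apply: edge_integrable; exact: continuous_slice1).
  have := @Rintegral_approx _ _ R leb `[x, x + s[%classic (fun t => P (t, y) - P (t, y + s)) (- b * s) (4 * e * s).
  rewrite fP; apply => //.
  - exact: leb_itv_lty.
  - apply: measurable_funB; apply: continuous_measurable_fun; exact: continuous_slice1.
  - move=> t; rewrite /= in_itv/= => /andP[t1 t2].
    have tx : x <= t <= x + s by rewrite t1 ltW.
    have := @HE P a b (t, y) (t, y + s) _ tx y0 tx ys; rewrite /= subrr mulr0 subr0.
    rewrite (_ : - b * s = b * (y - (y + s))); last by ring.
    apply => q q1 q2; apply: H1; first by rewrite (le_trans q1)// ltW.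
    by rewrite (le_trans q2)// ltW.
have EQ : `|edge (fun t => Q (x + s, t)) y s - edge (fun t => Q (x, t)) y s - (c * s) * s| <= 4 * e * s * s.
  rewrite /edge -RintegralB//; try (by apply: edge_integrable; exact: continuous_slice2).
  have := @Rintegral_approx _ _ R leb `[y, y + s[%classic (fun t => Q (x + s, t) - Q (x, t)) (c * s) (4 * e * s).
  rewrite fQ; apply => //.
  - exact: leb_itv_lty.
  - apply: measurable_funB; apply: continuous_measurable_fun; exact: continuous_slice2.
  - move=> t; rewrite /= in_itv/= => /andP[t1 t2].
    have tx : y <= t <= y + s by rewrite t1 ltW.
    have := @HE Q c d (x + s, t) (x, t) _ xs tx x0 tx; rewrite /= subrr mulr0 subr0.
    rewrite (_ : c * s = c * (x + s - x)); last by ring.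
    apply => q q1 q2; apply: H2; first by rewrite (le_trans q1)// ltW.
    by rewrite (le_trans q2)// ltW.
have fA : fine (area R (`[x, x + s[%classic `*` `[y, y + s[%classic)) = s * s by rewrite area_rect.
have EK : `|rint k x s y s - k p * (s * s)| <= e * (s * s).
  rewrite /rint -fA; apply: Rintegral_approx => //.
  - exact: measurableX.
  - by rewrite -/(area R) area_rect// ltry.
  - exact: continuous_measurable2.
  - move=> q [/=]; rewrite !in_itv/= => /andP[q1 q2] /andP[q3 q4].
    rewrite distrC; apply: H3; split => /=; rewrite /ball/= distrC.
      by rewrite (le_lt_trans _ sd3)// close// q1 ltW.
    by rewrite (le_lt_trans _ sd3)// close2// q3 ltW.
rewrite /green_defect -[X in `|X|](_ : (edge (fun t => P (t, y)) x s - edge (fun t => P (t, y + s)) x s - (- b * s) * s)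
  + (edge (fun t => Q (x + s, t)) y s - edge (fun t => Q (x, t)) y s - (c * s) * s)
  - (rint k x s y s - k p * (s * s)) = _); last by rewrite -cbk; ring.
rewrite (le_trans (ler_normB _ _))// (le_trans (lerD (ler_normD _ _) (lexx _)))//.
by rewrite (le_trans (lerD (lerD EP EQ) EK))// expr2; lra.
Qed.

(** Goursat's argument: since the defect is additive, some quarter of each square keeps the ratio of
    the defect to s^2; at the limit point this contradicts the local estimate. *)
Lemma green_defect_eq0 P Q k : continuous P -> continuous Q -> continuous k ->
  (forall p, exists a b c d, [/\ rdiff P p a b, rdiff Q p c d & c - b = k p]) ->
  forall x y s, 0 < s -> green_defect P Q k x y s = 0.
Proof.
move=> cP cQ ck H x y s s0; apply/eqP; apply: contraT => L0.
have LL : 0 < `|green_defect P Q k x y s| by rewrite normr_gt0.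
pose e := `|green_defect P Q k x y s| / s ^+ 2.
have e0 : 0 < e by rewrite divr_gt0// exprn_gt0.
have [||p Hp] := @bisection (fun x y s => e * s ^+ 2 <= `|green_defect P Q k x y s|) _ _ _ s0 (_ : (fun x y s => e * s ^+ 2 <= `|green_defect P Q k x y s|) x y s).
- by rewrite /e mulfVK// expf_neq0// gt_eqF.
- move=> x1 y1 t t0 Hs; apply: contrapT => N.
  have s2 : 0 <= t / 2 by rewrite divr_ge0// ltW.
  have N' x' y' : x1 <= x' <= x1 + t / 2 -> y1 <= y' <= y1 + t / 2 ->
      `|green_defect P Q k x' y' (t / 2)| < e * (t / 2) ^+ 2.
    by move=> h1 h2; rewrite ltNge; apply/negP => h; apply: N; exists x', y'.
  have xx : x1 <= x1 <= x1 + t / 2 by rewrite lexx lerDl.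
  have xs : x1 <= x1 + t / 2 <= x1 + t / 2 by rewrite lexx lerDl s2.
  have yy : y1 <= y1 <= y1 + t / 2 by rewrite lexx lerDl.
  have ys : y1 <= y1 + t / 2 <= y1 + t / 2 by rewrite lexx lerDl s2.
  have h1 := N' _ _ xx yy; have h2 := N' _ _ xx ys; have h3 := N' _ _ xs yy; have h4 := N' _ _ xs ys.
  move: Hs; rewrite green_defect_split ?(ltW t0)//; apply/negP; rewrite -ltNge.
  rewrite (le_lt_trans (ler_normD _ _))// (le_lt_trans (lerD (ler_normD _ _) (ler_normD _ _)))//.
  have -> : e * t ^+ 2 = e * (t / 2) ^+ 2 + e * (t / 2) ^+ 2 + (e * (t / 2) ^+ 2 + e * (t / 2) ^+ 2) by field.
  by rewrite !ltrD.
have [a [b [c [d [dP dQ cb]]]]] := H p.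
(* Any tolerance below e/9 contradicts the lower bound e s^2. *)
have e10 : 0 < e / 10 by rewrite divr_gt0.
have [dl dl0 Hl] := green_defect_local cP cQ ck dP dQ cb e10.
have [x2 [y2 [s1 [B1 s1d px py]]]] := Hp _ dl0.
have /andP[s10 _] := s1d.
have := le_trans B1 (Hl _ _ _ s1d px py).
rewrite ler_pM2r ?exprn_gt0//.
by move: e0; clear; lra.
Qed.

End GoursatGreen.

(** * Complex integration *)

Section ComplexIntegral.
Variable R : realType.
Local Notation RR := (measurableTypeR R * measurableTypeR R)%type.
Implicit Types (h f g : R[i] -> R[i]) (r D : R[i] -> R).

Definition rintegrable r : Prop :=
  (area R).-integrable [set: RR] (EFin \o (r \o @plane R)).

Definition rmeasurable r : Prop := measurable_fun [set: RR] (r \o @plane R).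

Lemma rmeasurable_Re h : cmeasurable h -> rmeasurable (fun w => Re (h w)).
Proof. by case. Qed.

Lemma rmeasurable_Im h : cmeasurable h -> rmeasurable (fun w => Im (h w)).
Proof. by case. Qed.

Lemma rmeasurableB r1 r2 : rmeasurable r1 -> rmeasurable r2 -> rmeasurable (fun w => r1 w - r2 w).
Proof. exact: measurable_funB. Qed.

Lemma rmeasurableM r1 r2 : rmeasurable r1 -> rmeasurable r2 -> rmeasurable (fun w => r1 w * r2 w).
Proof. exact: measurable_funM. Qed.

Lemma rmeasurableX r n : rmeasurable r -> rmeasurable (fun w => r w ^+ n).
Proof. exact: measurable_funX. Qed.

Lemma rmeasurable_cmod h : cmeasurable h -> rmeasurable (fun w => cmod (h w)).
Proof.
move=> [h1 h2]; rewrite /rmeasurable.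
rewrite (_ : _ \o _ = (fun p => Num.sqrt (Re (h (plane p)) ^+ 2 + Im (h (plane p)) ^+ 2))); last first.
  by apply/funext => p /=; rewrite cmodE.
have ms := continuous_measurable_fun (@sqrt_continuous R).
exact: (measurableT_comp ms (measurable_funD (measurable_funX 2 h1) (measurable_funX 2 h2))).
Qed.

Lemma cmeasurableD f g : cmeasurable f -> cmeasurable g -> cmeasurable (fun w => f w + g w).
Proof.
move=> [f1 f2] [g1 g2]; split.
  by under eq_fun do rewrite ReD; exact: measurable_funD.
by under eq_fun do rewrite ImD; exact: measurable_funD.
Qed.

Lemma cmeasurableN f : cmeasurable f -> cmeasurable (fun w => - f w).
Proof.
move=> [f1 f2]; split.
  by under eq_fun do rewrite ReN; exact: measurableT_comp.
by under eq_fun do rewrite ImN; exact: measurableT_comp.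
Qed.

Lemma cmeasurableB f g : cmeasurable f -> cmeasurable g -> cmeasurable (fun w => f w - g w).
Proof. by move=> mf mg; apply: cmeasurableD => //; exact: cmeasurableN. Qed.

Lemma cmeasurableM f g : cmeasurable f -> cmeasurable g -> cmeasurable (fun w => f w * g w).
Proof.
move=> [f1 f2] [g1 g2]; split.
  by under eq_fun do rewrite ReM; apply: measurable_funB; exact: measurable_funM.
by under eq_fun do rewrite ImM; apply: measurable_funD; exact: measurable_funM.
Qed.

Lemma cmeasurable_conj f : cmeasurable f -> cmeasurable (fun w => (f w)^*).
Proof.
move=> [f1 f2]; split.
  by under eq_fun do rewrite Re_conj.
by under eq_fun do rewrite Im_conj; exact: measurableT_comp.
Qed.

Lemma cmeasurable_cst (c : R[i]) : cmeasurable (fun=> c).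
Proof. by split; exact: measurable_cst. Qed.

Lemma cmeasurable_real r : rmeasurable r -> cmeasurable (fun w => real_complex R (r w)).
Proof. by move=> mr; split => //=; exact: measurable_cst. Qed.

Lemma cmeasurable_sum (I : Type) (s : seq I) (P : pred I) (F : I -> R[i] -> R[i]) :
  (forall i, cmeasurable (F i)) -> cmeasurable (fun w => \sum_(i <- s | P i) F i w).
Proof.
move=> mF; elim: s => [|i s IH].
  rewrite (_ : (fun _ => _) = fun=> 0); last by apply/funext => w; rewrite big_nil.
  exact: cmeasurable_cst.
rewrite (_ : (fun _ => _) = fun w => (if P i then F i w else 0) + \sum_(j <- s | P j) F j w); last first.
  by apply/funext => w; rewrite big_cons; case: ifP => // _; rewrite add0r.
by apply: cmeasurableD => //; case: (P i) => //; exact: cmeasurable_cst.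
Qed.

Lemma rintegrable_dom r D : rmeasurable r -> rintegrable D -> (forall w, `|r w| <= D w) ->
  rintegrable r.
Proof.
move=> mr iD rD; apply: (le_integrable _ _ _ iD) => //; first exact/measurable_EFinP.
by move=> p _ /=; rewrite lee_fin (le_trans (rD _))// ler_norm.
Qed.

Lemma rintegrableP r : rmeasurable r -> (forall w, 0 <= r w) -> cintegral_finite r -> rintegrable r.
Proof.
move=> mr r0 rf; apply/integrableP; split; first exact/measurable_EFinP.
by under eq_integral do rewrite /= ger0_norm//.
Qed.

Lemma rintegrable_finite r D : rmeasurable r -> (forall w, 0 <= r w <= D w) -> rintegrable D ->
  cintegral_finite r.
Proof.
move=> mr rD iD; have ir : rintegrable r.
  apply: (rintegrable_dom mr iD) => w; have /andP[r0 rd] := rD w.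
  by rewrite ger0_norm.
have /integrableP[_] := ir; rewrite /cintegral_finite.
apply: le_lt_trans; apply: eqW.
by apply: eq_integral => p _ /=; rewrite ger0_norm//; case/andP: (rD (plane p)).
Qed.

Lemma rintegrable_finiteW r : rintegrable r -> (forall w, 0 <= r w) -> cintegral_finite r.
Proof.
move=> ir r0; have /integrableP[mr _] := ir.
apply: (@rintegrable_finite r r) => //; first exact/measurable_EFinP.
by move=> w; rewrite r0 lexx.
Qed.

Lemma cintegrable_Re h : cintegrable h -> rintegrable (fun w => Re (h w)).
Proof.
move=> [mh fh]; have ic : rintegrable (fun w => cmod (h w)).
  by apply: rintegrableP => //; [exact: rmeasurable_cmod|move=> w; exact: cmod_ge0].
by apply: (rintegrable_dom (rmeasurable_Re mh) ic) => w; exact: Re_le_cmod.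
Qed.

Lemma cintegrable_Im h : cintegrable h -> rintegrable (fun w => Im (h w)).
Proof.
move=> [mh fh]; have ic : rintegrable (fun w => cmod (h w)).
  by apply: rintegrableP => //; [exact: rmeasurable_cmod|move=> w; exact: cmod_ge0].
by apply: (rintegrable_dom (rmeasurable_Im mh) ic) => w; exact: Im_le_cmod.
Qed.

Lemma cintegrable_cmod h : cintegrable h -> rintegrable (fun w => cmod (h w)).
Proof.
by move=> [mh fh]; apply: rintegrableP => //; [exact: rmeasurable_cmod|move=> w; exact: cmod_ge0].
Qed.

Lemma cintegrable_dom h D : cmeasurable h -> rintegrable D -> (forall w, cmod (h w) <= D w) ->
  cintegrable h.
Proof.
move=> mh iD hD; split=> //; apply: (rintegrable_finite _ _ iD); first exact: rmeasurable_cmod.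
by move=> w; rewrite cmod_ge0 hD.
Qed.

Lemma rintegrableD r1 r2 : rintegrable r1 -> rintegrable r2 -> rintegrable (fun w => r1 w + r2 w).
Proof. by move=> i1 i2; apply: eq_integrable (integrableD measurableT i1 i2). Qed.

Lemma rintegrableZ r (c : R) : rintegrable r -> rintegrable (fun w => c * r w).
Proof. by move=> i1; apply: eq_integrable (integrableZl measurableT c i1). Qed.

Lemma cintegrableD f g : cintegrable f -> cintegrable g -> cintegrable (fun w => f w + g w).
Proof.
move=> fi gi; apply: (@cintegrable_dom _ (fun w => cmod (f w) + cmod (g w))).
- by apply: cmeasurableD; [case: fi|case: gi].
- by apply: rintegrableD; exact: cintegrable_cmod.
- by move=> w; exact: cmodD.
Qed.

Lemma cintegrableZ f (c : R[i]) : cintegrable f -> cintegrable (fun w => c * f w).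
Proof.
move=> fi; apply: (@cintegrable_dom _ (fun w => cmod c * cmod (f w))).
- by apply: cmeasurableM; [exact: cmeasurable_cst|case: fi].
- by apply: rintegrableZ; exact: cintegrable_cmod.
- by move=> w; rewrite cmodM.
Qed.

Lemma cintegrableN f : cintegrable f -> cintegrable (fun w => - f w).
Proof. by move=> /(cintegrableZ (-1)); under eq_fun do rewrite mulN1r. Qed.

Lemma cintegrableB f g : cintegrable f -> cintegrable g -> cintegrable (fun w => f w - g w).
Proof. by move=> fi gi; apply: cintegrableD => //; exact: cintegrableN. Qed.

Lemma cintegrable0 : cintegrable (fun=> 0 : R[i]).
Proof.
split; first exact: cmeasurable_cst.
rewrite /cintegral_finite; under eq_integral do rewrite cmod0.
by rewrite integral0.
Qed.

Lemma cintegralD f g : cintegrable f -> cintegrable g ->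
  cintegral (fun w => f w + g w) = cintegral f + cintegral g.
Proof.
move=> fi gi; apply: complexP; rewrite ?ReD ?ImD /=.
  under eq_Rintegral do rewrite ReD.
  by apply: RintegralD => //; exact: cintegrable_Re.
under eq_Rintegral do rewrite ImD.
by apply: RintegralD => //; exact: cintegrable_Im.
Qed.

Lemma cintegralZ f (c : R[i]) : cintegrable f -> cintegral (fun w => c * f w) = c * cintegral f.
Proof.
move=> fi; have iRe := cintegrable_Re fi; have iIm := cintegrable_Im fi.
apply: complexP; rewrite ?ReM ?ImM /=.
  under eq_Rintegral do rewrite ReM.
  rewrite (RintegralB measurableT (rintegrableZ (Re c) iRe) (rintegrableZ (Im c) iIm)).
  by congr (_ - _); apply: RintegralZl.
under eq_Rintegral do rewrite ImM.
rewrite (RintegralD measurableT (rintegrableZ (Re c) iIm) (rintegrableZ (Im c) iRe)).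
by congr (_ + _); apply: RintegralZl.
Qed.

Lemma cintegralN f : cintegrable f -> cintegral (fun w => - f w) = - cintegral f.
Proof.
by move=> fi; rewrite -mulN1r -cintegralZ//; under [in RHS]eq_fun do rewrite mulN1r.
Qed.

Lemma cintegralB f g : cintegrable f -> cintegrable g ->
  cintegral (fun w => f w - g w) = cintegral f - cintegral g.
Proof. by move=> fi gi; rewrite cintegralD ?cintegralN//; exact: cintegrableN. Qed.

Lemma cintegral0 : cintegral (fun=> 0 : R[i]) = 0.
Proof.
by apply: complexP => /=; rewrite /Rintegral; under eq_integral do rewrite /=; rewrite integral0.
Qed.

Lemma cintegral_conj f : cintegrable f -> cintegral (fun w => (f w)^*) = (cintegral f)^*.
Proof.
move=> fi; have iIm := cintegrable_Im fi; apply: complexP; rewrite ?Re_conj ?Im_conj /=.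
  by under eq_Rintegral do rewrite Re_conj.
under eq_Rintegral do rewrite Im_conj -mulN1r.
by rewrite RintegralZl// mulN1r.
Qed.

Lemma cintegral_sum (I : Type) (s : seq I) (P : pred I) (F : I -> R[i] -> R[i]) :
  (forall i, cintegrable (F i)) ->
  cintegrable (fun w => \sum_(i <- s | P i) F i w) /\
  cintegral (fun w => \sum_(i <- s | P i) F i w) = \sum_(i <- s | P i) cintegral (F i).
Proof.
move=> iF; elim: s => [|i s [IH1 IH2]].
  rewrite (_ : (fun _ => _) = fun=> 0); last by apply/funext => w; rewrite big_nil.
  by rewrite big_nil; split; [exact: cintegrable0|exact: cintegral0].
rewrite big_cons; case: ifP => Pi; last first.
  rewrite (_ : (fun _ => _) = fun w => \sum_(j <- s | P j) F j w)//.
  by apply/funext => w; rewrite big_cons Pi.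
rewrite (_ : (fun _ => _) = fun w => F i w + \sum_(j <- s | P j) F j w); last first.
  by apply/funext => w; rewrite big_cons Pi.
by split; [exact: cintegrableD|rewrite cintegralD// IH2].
Qed.

Definition rintegral r : R := \int[area R]_p r (plane p).

(** The factor 2 is the price of estimating real and imaginary parts separately; it is harmless
    where the bound tends to 0. *)
Lemma cmod_cintegral h D : cintegrable h -> rintegrable D -> (forall w, cmod (h w) <= D w) ->
  cmod (cintegral h) <= 2 * rintegral D.
Proof.
move=> hi iD hD; rewrite (le_trans (cmod_le_ReIm _))// mulr_natl mulr2n lerD//=.
  rewrite (le_trans (le_normr_Rintegral _ (cintegrable_Re hi)))//.
  apply: le_Rintegral => //; last by move=> p _ /=; rewrite (le_trans (Re_le_cmod _)).
  exact: (integrable_norm (cintegrable_Re hi)).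
rewrite (le_trans (le_normr_Rintegral _ (cintegrable_Im hi)))//.
apply: le_Rintegral => //; last by move=> p _ /=; rewrite (le_trans (Im_le_cmod _)).
exact: (integrable_norm (cintegrable_Im hi)).
Qed.

Lemma rintegral_dct (r_ : nat -> R[i] -> R) r D : (forall n, rmeasurable (r_ n)) ->
  rmeasurable r -> (forall w, r_ ^~ w @ \oo --> r w) -> rintegrable D ->
  (forall n w, `|r_ n w| <= D w) -> (fun n => rintegral (r_ n)) @ \oo --> rintegral r.
Proof.
move=> mr_ mr cr iD rD.
have [] := @dominated_convergence _ _ _ (area R) [set: RR] measurableT
   (fun n p => (r_ n (plane p))%:E) (fun p => (r (plane p))%:E) (fun p => (D (plane p))%:E).
- by move=> n; apply/measurable_EFinP; exact: mr_.
- by apply/measurable_EFinP; exact: mr.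
- by apply: aeW => p _; apply: cvg_EFin; [exact: nearW|exact: cr].
- exact: iD.
- by apply: aeW => p n _; rewrite lee_fin.
move=> ir _ cv.
apply: fine_cvg; rewrite fineK//; last exact: integrable_fin_num.
Qed.

Lemma cintegral_dct (h_ : nat -> R[i] -> R[i]) h D : (forall n, cmeasurable (h_ n)) ->
  cmeasurable h -> (forall w, ccvg (h_ ^~ w) (h w)) -> rintegrable D ->
  (forall n w, cmod (h_ n w) <= D w) -> ccvg (fun n => cintegral (h_ n)) (cintegral h).
Proof.
move=> mh_ mh ch iD hD; apply: ccvg_ReIm.
  apply: (@rintegral_dct (fun n w => Re (h_ n w)) (fun w => Re (h w)) D) => //.
  - by move=> n; exact: rmeasurable_Re.
  - exact: rmeasurable_Re.
  - by move=> w; exact: ccvg_Re.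
  - by move=> n w; rewrite (le_trans (Re_le_cmod _)).
apply: (@rintegral_dct (fun n w => Im (h_ n w)) (fun w => Im (h w)) D) => //.
- by move=> n; exact: rmeasurable_Im.
- exact: rmeasurable_Im.
- by move=> w; exact: ccvg_Im.
- by move=> n w; rewrite (le_trans (Im_le_cmod _)).
Qed.

Lemma cmeasurable_lim (h_ : nat -> R[i] -> R[i]) h : (forall n, cmeasurable (h_ n)) ->
  (forall w, ccvg (h_ ^~ w) (h w)) -> cmeasurable h.
Proof.
move=> mh_ ch; split.
  apply: (measurable_fun_cvg (fun n => (mh_ n).1)) => p _; exact: ccvg_Re (ch _).
apply: (measurable_fun_cvg (fun n => (mh_ n).2)) => p _; exact: ccvg_Im (ch _).
Qed.

End ComplexIntegral.

(** * Wirtinger calculus *)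

Section Wirtinger.
Variable R : realType.
Implicit Types (h f g : R[i] -> R[i]) (w z xi A B : R[i]).

(* [wd h w A B]: h is real-differentiable at w, with Wirtinger derivatives
   A = dh/dw and B = dh/dw^*. *)
Definition wd h w A B : Prop := forall e : R, 0 < e -> exists2 d : R, 0 < d &
  forall xi, cmod xi <= d -> cmod (h (w + xi) - h w - A * xi - B * xi^*) <= e * cmod xi.

Definition ccont_at h w : Prop := forall e : R, 0 < e -> exists2 d : R, 0 < d &
  forall xi, cmod xi <= d -> cmod (h (w + xi) - h w) <= e.

Lemma wd_lip h w A B : wd h w A B -> exists2 d : R, 0 < d &
  forall xi, cmod xi <= d -> cmod (h (w + xi) - h w) <= (1 + cmod A + cmod B) * cmod xi.
Proof.
move=> /(_ 1 ltr01)[d d0 H]; exists d => // xi xid.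
rewrite (_ : h _ - h w = (h (w + xi) - h w - A * xi - B * xi^*) + A * xi + B * xi^*); last by ring.
rewrite (le_trans (cmodD _ _))// cmodM cmod_conj mulrDl lerD2r.
by rewrite (le_trans (cmodD _ _))// cmodM mulrDl lerD2r H.
Qed.

Lemma wd_ccont h w A B : wd h w A B -> ccont_at h w.
Proof.
move=> /wd_lip[d d0 H] e e0.
have K0 : 0 < 1 + cmod A + cmod B by rewrite -addrA ltr_pwDl// addr_ge0// cmod_ge0.
exists (Num.min d (e / (1 + cmod A + cmod B))); first by rewrite lt_min d0 divr_gt0.
move=> xi; rewrite le_min => /andP[x1 x2]; rewrite (le_trans (H _ x1))//.
by rewrite mulrC -ler_pdivlMr.
Qed.

Lemma wd_ext h h' w A B : (forall z, h z = h' z) -> wd h w A B -> wd h' w A B.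
Proof. by move=> /funext ->. Qed.

Lemma wd_cst (c : R[i]) w : wd (fun=> c) w 0 0.
Proof.
move=> e e0; exists 1 => // xi _.
by rewrite subrr !mul0r !subr0 cmod0 mulr_ge0 ?cmod_ge0// ltW.
Qed.

Lemma wd_id w : wd id w 1 0.
Proof.
move=> e e0; exists 1 => // xi _.
by rewrite mul0r mul1r subr0 [w + xi]addrC addrK subrr cmod0 mulr_ge0 ?cmod_ge0// ltW.
Qed.

Lemma wdD f g w A B A' B' : wd f w A B -> wd g w A' B' ->
  wd (fun z => f z + g z) w (A + A') (B + B').
Proof.
move=> hf hg e e0; have e20 : 0 < e / 2 by rewrite divr_gt0.
have [d d0 H] := hf _ e20; have [d' d'0 H'] := hg _ e20.
exists (Num.min d d'); first by rewrite lt_min d0.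
move=> xi; rewrite le_min => /andP[x1 x2].
rewrite (_ : f (w + xi) + g (w + xi) - (f w + g w) - (A + A') * xi - (B + B') * xi^* =
  (f (w + xi) - f w - A * xi - B * xi^*) + (g (w + xi) - g w - A' * xi - B' * xi^*)); last by ring.
have -> : e * cmod xi = e / 2 * cmod xi + e / 2 * cmod xi by rewrite -mulrDl -splitr.
by rewrite (le_trans (cmodD _ _))// lerD// ?H ?H'.
Qed.

Lemma wd_conj f w A B : wd f w A B -> wd (fun z => (f z)^*) w B^* A^*.
Proof.
move=> hf e e0; have [d d0 H] := hf _ e0; exists d => // xi xid.
rewrite -[X in cmod X]conjCK cmod_conj !rmorphB !rmorphM /= !conjCK.
by rewrite addrAC H.
Qed.

Lemma wdM f g w A B A' B' : wd f w A B -> wd g w A' B' ->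
  wd (fun z => f z * g z) w (A * g w + f w * A') (B * g w + f w * B').
Proof.
move=> hf hg e e0.
(* Each of the three summands of the error may cost a third of e; adding 1 keeps the denominators
   positive. *)
pose e1 := e / (3 * (cmod (g w) + 1)); pose e2 := e / (3 * (cmod A + cmod B + 1)).
pose e3 := e / (3 * (cmod (f w) + 1)).
have K1 : 0 < cmod (g w) + 1 by rewrite ltr_wpDl ?cmod_ge0.
have K2 : 0 < cmod A + cmod B + 1 by rewrite ltr_wpDl ?addr_ge0 ?cmod_ge0.
have K3 : 0 < cmod (f w) + 1 by rewrite ltr_wpDl ?cmod_ge0.
have e10 : 0 < e1 by rewrite divr_gt0// mulr_gt0.
have e20 : 0 < e2 by rewrite divr_gt0// mulr_gt0.
have e30 : 0 < e3 by rewrite divr_gt0// mulr_gt0.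
have [d1 d10 H1] := hf _ e10; have [d2 d20 H2] := wd_ccont hg e20.
have [d3 d30 H3] := hg _ e30; have [d4 d40 H4] := wd_ccont hg ltr01.
exists (Num.min d1 (Num.min d2 (Num.min d3 d4))); first by rewrite !lt_min d10 d20 d30.
move=> xi; rewrite !le_min => /and4P[x1 x2 x3 x4].
rewrite (_ : f (w + xi) * g (w + xi) - f w * g w - (A * g w + f w * A') * xi - (B * g w + f w * B') * xi^* =
  (f (w + xi) - f w - A * xi - B * xi^*) * g (w + xi) + (A * xi + B * xi^*) * (g (w + xi) - g w)
  + f w * (g (w + xi) - g w - A' * xi - B' * xi^*)); last by ring.
have E1 : cmod ((f (w + xi) - f w - A * xi - B * xi^*) * g (w + xi)) <= e / 3 * cmod xi.
  rewrite cmodM (@le_trans _ _ (e1 * cmod xi * (cmod (g w) + 1)))//.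
    rewrite ler_pM ?cmod_ge0 ?H1//.
    rewrite -[g (w + xi)](subrK (g w)) (le_trans (cmodD _ _))// addrC lerD2l.
    exact: H4.
  by rewrite /e1; apply: eqW; field; rewrite gt_eqF.
have E2 : cmod ((A * xi + B * xi^*) * (g (w + xi) - g w)) <= e / 3 * cmod xi.
  rewrite cmodM (@le_trans _ _ ((cmod A + cmod B) * cmod xi * e2))//.
    rewrite ler_pM ?cmod_ge0 ?H2//.
    by rewrite (le_trans (cmodD _ _))// !cmodM cmod_conj mulrDl.
  rewrite (@le_trans _ _ ((cmod A + cmod B + 1) * cmod xi * e2))//.
    by rewrite ler_wpM2r ?(ltW e20)// ler_wpM2r ?cmod_ge0// lerDl.
  by rewrite /e2; apply: eqW; field; rewrite gt_eqF.
have E3 : cmod (f w * (g (w + xi) - g w - A' * xi - B' * xi^*)) <= e / 3 * cmod xi.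
  rewrite cmodM (@le_trans _ _ ((cmod (f w) + 1) * (e3 * cmod xi)))//.
    by rewrite ler_pM ?cmod_ge0 ?H3// lerDl.
  by rewrite /e3; apply: eqW; field; rewrite gt_eqF.
rewrite (le_trans (cmodD _ _))// (le_trans (lerD (cmodD _ _) (lexx _)))//.
rewrite (le_trans (lerD (lerD E1 E2) E3))// -!mulrDl ler_wpM2r ?cmod_ge0//.
by move: e0; clear; lra.
Qed.

(** Continuity of f is enough because (f(w + xi) - f(w)) g(w + xi) is o(xi) when g vanishes at w.
    This serves the exceptional point in [stokes], where the cutoff factor is zero. *)
Lemma wdM_vanish f g w A B : ccont_at f w -> g w = 0 -> wd g w A B ->
  wd (fun z => f z * g z) w (f w * A) (f w * B).
Proof.
move=> cf gw0 hg e e0.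
pose e2 := e / (2 * (1 + cmod A + cmod B)); pose e3 := e / (2 * (cmod (f w) + 1)).
have K2 : 0 < 1 + cmod A + cmod B by rewrite -addrA ltr_pwDl// addr_ge0// cmod_ge0.
have K3 : 0 < cmod (f w) + 1 by rewrite ltr_wpDl ?cmod_ge0.
have e20 : 0 < e2 by rewrite divr_gt0// mulr_gt0.
have e30 : 0 < e3 by rewrite divr_gt0// mulr_gt0.
have [d1 d10 H1] := cf _ e20; have [d2 d20 H2] := wd_lip hg.
have [d3 d30 H3] := hg _ e30.
exists (Num.min d1 (Num.min d2 d3)); first by rewrite !lt_min d10 d20 d30.
move=> xi; rewrite !le_min => /and3P[x1 x2 x3].
rewrite (_ : f (w + xi) * g (w + xi) - f w * g w - f w * A * xi - f w * B * xi^* =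
  (f (w + xi) - f w) * (g (w + xi) - g w) + f w * (g (w + xi) - g w - A * xi - B * xi^*)); last first.
  by rewrite gw0; ring.
have E2 : cmod ((f (w + xi) - f w) * (g (w + xi) - g w)) <= e / 2 * cmod xi.
  rewrite cmodM (@le_trans _ _ (e2 * ((1 + cmod A + cmod B) * cmod xi)))//.
    by rewrite ler_pM ?cmod_ge0 ?H2 ?H1.
  by rewrite /e2; apply: eqW; field; rewrite gt_eqF.
have E3 : cmod (f w * (g (w + xi) - g w - A * xi - B * xi^*)) <= e / 2 * cmod xi.
  rewrite cmodM (@le_trans _ _ ((cmod (f w) + 1) * (e3 * cmod xi)))//.
    by rewrite ler_pM ?cmod_ge0 ?H3// lerDl.
  by rewrite /e3; apply: eqW; field; rewrite gt_eqF.
rewrite (le_trans (cmodD _ _))// (le_trans (lerD E2 E3))// -mulrDl ler_wpM2r ?cmod_ge0//.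
by rewrite -splitr.
Qed.

Lemma wd_comp_hol f g w a A B : wd f (g w) a 0 -> wd g w A B ->
  wd (fun z => f (g z)) w (a * A) (a * B).
Proof.
move=> hf hg e e0.
have K2 : 0 < 1 + cmod A + cmod B by rewrite -addrA ltr_pwDl// addr_ge0// cmod_ge0.
have K3 : 0 < cmod a + 1 by rewrite ltr_wpDl ?cmod_ge0.
pose e2 := e / (2 * (1 + cmod A + cmod B)); pose e3 := e / (2 * (cmod a + 1)).
have e20 : 0 < e2 by rewrite divr_gt0// mulr_gt0.
have e30 : 0 < e3 by rewrite divr_gt0// mulr_gt0.
have [d1 d10 H1] := hf _ e20; have [d2 d20 H2] := wd_lip hg.
have [d3 d30 H3] := hg _ e30; have [d4 d40 H4] := wd_ccont hg d10.
exists (Num.min d2 (Num.min d3 d4)); first by rewrite !lt_min d20 d30 d40.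
move=> xi; rewrite !le_min => /and3P[x2 x3 x4].
pose eta := g (w + xi) - g w.
have ge : g (w + xi) = g w + eta by rewrite /eta addrCA subrr addr0.
rewrite (_ : f (g (w + xi)) - f (g w) - a * A * xi - a * B * xi^* =
  (f (g w + eta) - f (g w) - a * eta - 0 * eta^*) + a * (g (w + xi) - g w - A * xi - B * xi^*)); last first.
  by rewrite ge; ring.
have E2 : cmod (f (g w + eta) - f (g w) - a * eta - 0 * eta^*) <= e / 2 * cmod xi.
  rewrite (le_trans (H1 _ (H4 _ x4)))// (@le_trans _ _ (e2 * ((1 + cmod A + cmod B) * cmod xi)))//.
    by rewrite ler_wpM2l ?(ltW e20)// H2.
  by rewrite /e2; apply: eqW; field; rewrite gt_eqF.
have E3 : cmod (a * (g (w + xi) - g w - A * xi - B * xi^*)) <= e / 2 * cmod xi.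
  rewrite cmodM (@le_trans _ _ ((cmod a + 1) * (e3 * cmod xi)))//.
    by rewrite ler_pM ?cmod_ge0 ?H3// lerDl.
  by rewrite /e3; apply: eqW; field; rewrite gt_eqF.
rewrite (le_trans (cmodD _ _))// (le_trans (lerD E2 E3))// -mulrDl ler_wpM2r ?cmod_ge0//.
by rewrite -splitr.
Qed.

Definition rder (phi : R -> R) (s a : R) : Prop := forall e : R, 0 < e -> exists2 d : R, 0 < d &
  forall t, `|t| <= d -> `|phi (s + t) - phi s - a * t| <= e * `|t|.

Lemma wd_comp_real (phi : R -> R) (r : R[i] -> R) w (a : R) A B : rder phi (r w) a ->
  wd (fun z => real_complex R (r z)) w A B ->
  wd (fun z => real_complex R (phi (r z))) w (real_complex R a * A) (real_complex R a * B).
Proof.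
move=> hf hg.
pose F z : R[i] := real_complex R (phi (Re z)).
have hF e : 0 < e -> exists2 d : R, 0 < d & forall t : R, `|t| <= d ->
   cmod (F (real_complex R (r w + t)) - F (real_complex R (r w)) - real_complex R a * real_complex R t) <= e * `|t|.
  move=> /hf[d d0 H]; exists d => // t td; rewrite /F/= -rmorphM -!rmorphB/= cmod_real.
  exact: H.
move=> e e0.
have K2 : 0 < 1 + cmod A + cmod B by rewrite -addrA ltr_pwDl// addr_ge0// cmod_ge0.
have K3 : 0 < `|a| + 1 by rewrite ltr_wpDl.
pose e2 := e / (2 * (1 + cmod A + cmod B)); pose e3 := e / (2 * (`|a| + 1)).
have e20 : 0 < e2 by rewrite divr_gt0// mulr_gt0.
have e30 : 0 < e3 by rewrite divr_gt0// mulr_gt0.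
have [d1 d10 H1] := hf _ e20; have [d2 d20 H2] := wd_lip hg.
have [d3 d30 H3] := hg _ e30; have [d4 d40 H4] := wd_ccont hg d10.
exists (Num.min d2 (Num.min d3 d4)); first by rewrite !lt_min d20 d30 d40.
move=> xi; rewrite !le_min => /and3P[x2 x3 x4].
pose eta := r (w + xi) - r w.
have ge : r (w + xi) = r w + eta by rewrite /eta addrCA subrr addr0.
have ce : cmod (real_complex R (r (w + xi)) - real_complex R (r w)) = `|eta| by rewrite -rmorphB cmod_real.
rewrite (_ : real_complex R (phi (r (w + xi))) - real_complex R (phi (r w)) - real_complex R a * A * xi - real_complex R a * B * xi^* =
  real_complex R (phi (r w + eta) - phi (r w) - a * eta) +
  real_complex R a * (real_complex R (r (w + xi)) - real_complex R (r w) - A * xi - B * xi^*)); last first.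
  by rewrite ge !rmorphB !rmorphM !rmorphD/=; ring.
have E2 : cmod (real_complex R (phi (r w + eta) - phi (r w) - a * eta)) <= e / 2 * cmod xi.
  have e1 : `|eta| <= d1 by rewrite -ce H4.
  rewrite cmod_real (le_trans (H1 _ e1))// (@le_trans _ _ (e2 * ((1 + cmod A + cmod B) * cmod xi)))//.
    by rewrite ler_wpM2l ?(ltW e20)// -ce H2.
  by rewrite /e2; apply: eqW; field; rewrite gt_eqF.
have E3 : cmod (real_complex R a * (real_complex R (r (w + xi)) - real_complex R (r w) - A * xi - B * xi^*)) <= e / 2 * cmod xi.
  rewrite cmodM cmod_real (@le_trans _ _ ((`|a| + 1) * (e3 * cmod xi)))//.
    by rewrite ler_pM ?cmod_ge0 ?H3// lerDl.
  by rewrite /e3; apply: eqW; field; rewrite gt_eqF.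
rewrite (le_trans (cmodD _ _))// (le_trans (lerD E2 E3))// -mulrDl ler_wpM2r ?cmod_ge0//.
by rewrite -splitr.
Qed.

Lemma derivable_rder (phi : R -> R) (s a : R) : is_derive s 1 phi a -> rder phi s a.
Proof.
move=> [dphi dE] e e0.
have /cvgrPdist_le/(_ _ e0) : h^-1 *: ((phi \o shift s) (h *: (1 : R^o)) - phi s) @[h --> 0^'] --> a.
  by rewrite -dE; exact: dphi.
move=> /nbhs_ballP[d /= d0 H]; exists (d / 2); first by rewrite divr_gt0.
move=> t td; have [->|t0] := eqVneq t 0.
  by rewrite addr0 subrr mulr0 subr0 !normr0 mulr0.
have := H t; rewrite /ball/= sub0r normrN => /(_ _ t0).
have td' : `|t| < d by rewrite (le_lt_trans td)// ltr_pdivrMr// ltr_pMr// ltr1n.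
move=> /(_ td'); rewrite scaler1 [t + s]addrC /GRing.scale/= => {}H.
rewrite -ler_pdivrMr ?normr_gt0// -normfV -normrM; apply: le_trans H.
rewrite distrC; apply: eqW; congr `|_|.
by field.
Qed.

Lemma ps_wd C D (A : nat -> R[i]) x : egf C D A -> wd (ps A) x (ps (dcoef A) x) 0.
Proof.
move=> AB e e0; have [D0 _] := AB; have C0 := egf_ge0 AB.
pose K := C * D ^+ 2 * expR (D * (cmod x + 1)).
have K0 : 0 <= K by rewrite !mulr_ge0// ?exprn_ge0// expR_ge0.
exists (Num.min 1 (e / (K + 1))); first by rewrite lt_min ltr01 divr_gt0// ltr_wpDl.
move=> xi; rewrite le_min => /andP[x1 x2].
rewrite mul0r subr0 (le_trans (ps_diff _ _ AB))// expr2 -mulrA [leRHS]mulrC ler_wpM2l ?cmod_ge0//.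
rewrite (@le_trans _ _ (cmod xi * K))//.
  rewrite ler_wpM2l ?cmod_ge0// ler_wpM2l ?mulr_ge0 ?exprn_ge0//.
  by rewrite ler_expR ler_wpM2l// lerD2l.
rewrite (@le_trans _ _ (cmod xi * (K + 1)))//; first by rewrite ler_wpM2l ?cmod_ge0// lerDl.
by rewrite -ler_pdivlMr// ltr_wpDl.
Qed.

(** Real parts of $h_x = A + B$ and $h_y = i(A - B)$. *)
Lemma wd_rdiff_Re h w A B : wd h w A B ->
  rdiff (fun p => Re (h (plane p))) (Re w, Im w)
    (Re A + Re B) (- (Im A - Im B)).
Proof.
move=> hw e e0; have [d d0 H] := hw _ e0; exists (d / 2); first by rewrite divr_gt0.
move=> q q1 q2; rewrite /= in q1 q2 *.
pose xi : R[i] := Complex (q.1 - Re w) (q.2 - Im w).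
have xid : cmod xi <= `|q.1 - Re w| + `|q.2 - Im w| by exact: cmod_le_ReIm.
have qw : plane q = w + xi by apply: complexP; rewrite ?ReD ?ImD /=; ring.
have := H xi; rewrite -planeE => /(_ _)/le_trans => {}H.
have H' : cmod (h (w + xi) - h w - A * xi - B * xi^*) <= e * (`|q.1 - Re w| + `|q.2 - Im w|).
  apply: H; last by rewrite ler_wpM2l ?(ltW e0).
  by rewrite (le_trans xid)// (le_trans (lerD q1 q2))// -splitr.
apply: le_trans H'; rewrite (le_trans _ (Re_le_cmod _))// qw.
rewrite !ReB !ReM Re_conj Im_conj /=.
by apply: eqW; congr `|_|; ring.
Qed.

Lemma wd_rdiff_Im h w A B : wd h w A B ->
  rdiff (fun p => Im (h (plane p))) (Re w, Im w)
    (Im A + Im B) (Re A - Re B).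
Proof.
move=> hw e e0; have [d d0 H] := hw _ e0; exists (d / 2); first by rewrite divr_gt0.
move=> q q1 q2; rewrite /= in q1 q2 *.
pose xi : R[i] := Complex (q.1 - Re w) (q.2 - Im w).
have xid : cmod xi <= `|q.1 - Re w| + `|q.2 - Im w| by exact: cmod_le_ReIm.
have qw : plane q = w + xi by apply: complexP; rewrite ?ReD ?ImD /=; ring.
have := H xi; rewrite -planeE => /(_ _)/le_trans => {}H.
have H' : cmod (h (w + xi) - h w - A * xi - B * xi^*) <= e * (`|q.1 - Re w| + `|q.2 - Im w|).
  apply: H; last by rewrite ler_wpM2l ?(ltW e0).
  by rewrite (le_trans xid)// (le_trans (lerD q1 q2))// -splitr.
apply: le_trans H'; rewrite (le_trans _ (Im_le_cmod _))// qw.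
rewrite !ImB !ImM Re_conj Im_conj /=.
by apply: eqW; congr `|_|; ring.
Qed.

Lemma ccont_continuous h : (forall w, ccont_at h w) ->
  continuous (fun p : R * R => Re (h (plane p))) /\
  continuous (fun p : R * R => Im (h (plane p))).
Proof.
move=> ch.
have H (p : R * R) e : 0 < e -> \forall q \near p, cmod (h (plane q) - h (plane p)) <= e.
  move=> e0; have [d d0 Hd] := ch (plane p) e e0.
  apply/nbhs_ballP; exists (d / 2); first by rewrite /= divr_gt0.
  move=> q [/= q1 q2].
  pose xi : R[i] := Complex (q.1 - p.1) (q.2 - p.2).
  have -> : plane q = plane p + xi by apply: complexP; rewrite ?ReD ?ImD /=; ring.
  apply: Hd; rewrite (le_trans (cmod_le_ReIm _))//= [d]splitr lerD//.
    by move: q1; rewrite /ball/= distrC; exact: ltW.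
  by move: q2; rewrite /ball/= distrC; exact: ltW.
split=> p; apply/cvgrPdist_le => e e0.
  apply: filterS (H p e e0) => q; apply: le_trans.
  by rewrite distrC -ReB Re_le_cmod.
apply: filterS (H p e e0) => q; apply: le_trans.
by rewrite distrC -ImB Im_le_cmod.
Qed.

Lemma ccont_measurable h : (forall w, ccont_at h w) -> cmeasurable h.
Proof. by move=> /ccont_continuous[h1 h2]; split; exact: continuous_measurable2. Qed.

Lemma ccont_atM f g w : ccont_at f w -> ccont_at g w -> ccont_at (fun z => f z * g z) w.
Proof.
move=> cf cg e e0.
have K1 : 0 < cmod (g w) + 1 by rewrite ltr_wpDl ?cmod_ge0.
have K3 : 0 < cmod (f w) + 1 by rewrite ltr_wpDl ?cmod_ge0.
have e1 : 0 < e / (2 * (cmod (g w) + 1)) by rewrite divr_gt0// mulr_gt0.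
have e3 : 0 < e / (2 * (cmod (f w) + 1)) by rewrite divr_gt0// mulr_gt0.
have [d1 d10 H1] := cf _ e1; have [d2 d20 H2] := cg _ e3; have [d3 d30 H3] := cg _ ltr01.
exists (Num.min d1 (Num.min d2 d3)); first by rewrite !lt_min d10 d20 d30.
move=> xi; rewrite !le_min => /and3P[x1 x2 x3].
rewrite (_ : f (w + xi) * g (w + xi) - f w * g w = (f (w + xi) - f w) * g (w + xi) + f w * (g (w + xi) - g w)); last by ring.
rewrite (le_trans (cmodD _ _))// !cmodM [e]splitr lerD//.
  apply: (@le_trans _ _ (e / (2 * (cmod (g w) + 1)) * (cmod (g w) + 1))).
    rewrite ler_pM ?cmod_ge0 ?H1// -[g (w + xi)](subrK (g w)) (le_trans (cmodD _ _))// addrC lerD2l.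
    exact: H3.
  by apply: eqW; field; rewrite gt_eqF.
apply: (@le_trans _ _ ((cmod (f w) + 1) * (e / (2 * (cmod (f w) + 1))))).
  by rewrite ler_pM ?cmod_ge0 ?H2// lerDl.
by apply: eqW; field; rewrite gt_eqF.
Qed.

Lemma ccont_atD f g w : ccont_at f w -> ccont_at g w -> ccont_at (fun z => f z + g z) w.
Proof.
move=> cf cg e e0; have e20 : 0 < e / 2 by rewrite divr_gt0.
have [d1 d10 H1] := cf _ e20; have [d2 d20 H2] := cg _ e20.
exists (Num.min d1 d2); first by rewrite !lt_min d10 d20.
move=> xi; rewrite !le_min => /andP[x1 x2]; rewrite opprD addrACA (le_trans (cmodD _ _))// [e]splitr.
by rewrite lerD ?H1 ?H2.
Qed.

End Wirtinger.

(** * Cutoffs and Stokes' theorem in the plane *)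

Section Stokes.
Variable R : realType.
Local Notation rc := (real_complex R).
Local Notation RR := (measurableTypeR R * measurableTypeR R)%type.
Implicit Types (h k : R[i] -> R[i]) (w z xi A B : R[i]).

Lemma wd_Re w : wd (fun z => rc (Re z)) w (Complex (1 / 2) 0) (Complex (1 / 2) 0).
Proof.
move=> e e0; exists 1 => // xi _.
rewrite [X in cmod X](_ : _ = 0) ?cmod0 ?mulr_ge0 ?cmod_ge0 ?(ltW e0)//.
apply: complexP; rewrite ?ReB ?ImB ?ReM ?ImM ?Re_conj ?Im_conj /= ?ReD; last by ring.
by field.
Qed.

Lemma wd_Im w : wd (fun z => rc (Im z)) w (Complex 0 (- (1 / 2))) (Complex 0 (1 / 2)).
Proof.
move=> e e0; exists 1 => // xi _.
rewrite [X in cmod X](_ : _ = 0) ?cmod0 ?mulr_ge0 ?cmod_ge0 ?(ltW e0)//.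
apply: complexP; rewrite ?ReB ?ImB ?ReM ?ImM ?Re_conj ?Im_conj /= ?ImD; last by ring.
by field.
Qed.

Definition pospart (s : R) : R := Num.max 0 s.

Lemma pospart_ge0 s : 0 <= pospart s.
Proof. by rewrite le_max lexx. Qed.

Lemma pospart_lip s t : `|pospart s - pospart t| <= `|s - t|.
Proof.
rewrite /pospart; case: (leP 0 s) => s0; case: (leP 0 t) => t0; rewrite ?subrr ?normr0//.
- by rewrite subr0 !ger0_norm//; lra.
- by rewrite sub0r normrN ger0_norm// ler0_norm; lra.
Qed.

(** Squaring removes the corner of the positive part: the first-order error is at most t^2
    everywhere, so [e] itself serves as the radius. Cutoffs built from this square have a continuous
    derivative. *)
Lemma rder_sqr_pospart s : rder (fun t => pospart t ^+ 2) s (2 * pospart s).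
Proof.
move=> e e0; exists e => // t te.
apply: (@le_trans _ _ (t ^+ 2)); last by rewrite -real_normK ?num_real// expr2 ler_wpM2r.
have tt : 0 <= t ^+ 2 by exact: sqr_ge0.
rewrite /pospart; case: (leP 0 s) => s0; case: (leP 0 (s + t)) => st0; rewrite ler_norml; apply/andP; split; nra.
Qed.

Lemma ccont_pospart (r : R[i] -> R) w : ccont_at (fun z => rc (r z)) w ->
  ccont_at (fun z => rc (pospart (r z))) w.
Proof.
move=> cr e e0; have [d d0 H] := cr e e0; exists d => // xi xid.
have := H xi xid; rewrite -!rmorphB !cmod_real; apply: le_trans.
exact: pospart_lip.
Qed.

(** The parameter [r] is an inverse width: the cutoff is 1 at the origin and 0 as soon as |r t| >=
    1. Small [r] exhausts the plane, large [r] isolates a point. *)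
Definition cut (r t : R) : R := pospart (1 - (r * t) ^+ 2) ^+ 2.
Definition dcut (r t : R) : R := - (4 * r ^+ 2 * t * pospart (1 - (r * t) ^+ 2)).

Lemma pospart_cut_le1 r t : pospart (1 - (r * t) ^+ 2) <= 1.
Proof. by rewrite ge_max ler01/= gerBl sqr_ge0. Qed.

Lemma cut_itv01 r t : 0 <= cut r t <= 1.
Proof. by rewrite /cut exprn_ge0 ?pospart_ge0//= exprn_ile1// ?pospart_ge0// pospart_cut_le1. Qed.

Lemma cut0 r : cut r 0 = 1.
Proof. by rewrite /cut /pospart mulr0 expr0n subr0 max_r// expr1n. Qed.

Lemma pospart_cut_out r t : 1 <= `|r * t| -> pospart (1 - (r * t) ^+ 2) = 0.
Proof.
move=> rt; rewrite /pospart max_l// subr_le0 -real_normK ?num_real//.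
by rewrite exprn_ege1.
Qed.

Lemma cut_out r t : 1 <= `|r * t| -> cut r t = 0.
Proof. by move=> rt; rewrite /cut pospart_cut_out// expr0n. Qed.

Lemma dcut_out r t : 1 <= `|r * t| -> dcut r t = 0.
Proof. by move=> rt; rewrite /dcut pospart_cut_out// mulr0 oppr0. Qed.

Lemma dcut_bound r t : 0 <= r -> `|dcut r t| <= 4 * r.
Proof.
move=> r0; have [rt|rt] := leP 1 `|r * t|; first by rewrite dcut_out// normr0 mulr_ge0.
rewrite /dcut normrN (_ : 4 * r ^+ 2 * t * pospart (1 - (r * t) ^+ 2) =
  4 * r * ((r * t) * pospart (1 - (r * t) ^+ 2))); last by ring.
rewrite normrM [`|4 * r|]ger0_norm ?mulr_ge0// ler_piMr ?mulr_ge0// normrM.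
rewrite -[leRHS](mulr1 1) ler_pM// ?(ltW rt)//.
by rewrite ger0_norm ?pospart_ge0// pospart_cut_le1.
Qed.

Lemma cut_near1 r t : `|cut r t - 1| <= 2 * (r * t) ^+ 2.
Proof.
have := sqr_ge0 (r * t); set s := (r * t) ^+ 2 => s0.
rewrite /cut -/s /pospart; case: (leP 0 (1 - s)) => H; rewrite ler_norml; apply/andP; split; nra.
Qed.

Lemma wd_eq h h' w A B A' B' : wd h w A B -> (forall z, h z = h' z) -> A = A' -> B = B' ->
  wd h' w A' B'.
Proof. by move=> H /funext <- <- <-. Qed.

Lemma wd_cut (r t0 : R) (c : R[i] -> R) w A B : wd (fun z => rc (c z)) w A B ->
  wd (fun z => rc (cut r (c z - t0))) w (rc (dcut r (c w - t0)) * A) (rc (dcut r (c w - t0)) * B).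
Proof.
move=> hc.
have h1 : wd (fun z => rc (r * (c z - t0))) w (rc r * A) (rc r * B).
  apply: wd_eq (wdM (wd_cst (rc r) w) (wdD hc (wd_cst (- rc t0) w))) _ _ _.
  - by move=> z; ring.
  - by ring.
  - by ring.
have h2 : wd (fun z => rc (1 - (r * (c z - t0)) ^+ 2)) w
   (- (rc (2 * (r * (c w - t0))) * (rc r * A))) (- (rc (2 * (r * (c w - t0))) * (rc r * B))).
  apply: wd_eq (wdD (wd_cst 1 w) (wdM (wd_cst (-1) w) (wdM h1 h1))) _ _ _.
  - by move=> z; ring.
  - by ring.
  - by ring.
apply: wd_eq (wd_comp_real (rder_sqr_pospart _) h2) _ _ _ => //; rewrite /dcut; ring.
Qed.

Definition bump r (z0 : R[i]) w : R := cut r (Re w - Re z0) * cut r (Im w - Im z0).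

(** The derivative of [bump] with respect to conj(w): 1/2 and i/2 are the corresponding Wirtinger
    derivatives of Re w and Im w. [dbump'] is its derivative with respect to w. *)
Definition dbump r (z0 : R[i]) w : R[i] :=
  rc (dcut r (Re w - Re z0)) * Complex (1 / 2) 0 * rc (cut r (Im w - Im z0)) +
  rc (cut r (Re w - Re z0)) * (rc (dcut r (Im w - Im z0)) * Complex 0 (1 / 2)).

Definition dbump' r (z0 : R[i]) w : R[i] :=
  rc (dcut r (Re w - Re z0)) * Complex (1 / 2) 0 * rc (cut r (Im w - Im z0)) +
  rc (cut r (Re w - Re z0)) * (rc (dcut r (Im w - Im z0)) * Complex 0 (- (1 / 2))).

Lemma wd_bump r z0 w : wd (fun z => rc (bump r z0 z)) w (dbump' r z0 w) (dbump r z0 w).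
Proof.
have := wdM (wd_cut r (Re z0) (wd_Re w)) (wd_cut r (Im z0) (wd_Im w)).
by apply: wd_ext => z; rewrite -rmorphM.
Qed.

Lemma bump_itv01 r z0 w : 0 <= bump r z0 w <= 1.
Proof.
have /andP[a b] := cut_itv01 r (Re w - Re z0).
have /andP[c d] := cut_itv01 r (Im w - Im z0).
by rewrite /bump mulr_ge0//= mulr_ile1.
Qed.

Lemma cmod_half1 : cmod (Complex (1 / 2) 0 : R[i]) = 1 / 2.
Proof. by rewrite (_ : Complex _ _ = rc (1 / 2))// cmod_real ger0_norm. Qed.

Lemma cmod_half2 : cmod (Complex 0 (1 / 2) : R[i]) = 1 / 2.
Proof. by rewrite cmodE/= expr0n add0r sqrtr_sqr ger0_norm. Qed.

Lemma dbump_bound r z0 w : 0 <= r -> cmod (dbump r z0 w) <= 4 * r.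
Proof.
move=> r0; rewrite (le_trans (cmodD _ _))// !cmodM cmod_half1 cmod_half2 !cmod_real.
have /andP[a b] := cut_itv01 r (Re w - Re z0).
have /andP[c d] := cut_itv01 r (Im w - Im z0).
have h1 := dcut_bound (Re w - Re z0) r0.
have h2 := dcut_bound (Im w - Im z0) r0.
rewrite !(ger0_norm a) !(ger0_norm c) (_ : 4 * r = 4 * r * (1 / 2) * 1 + 1 * (4 * r * (1 / 2))); last by field.
by rewrite lerD// ler_pM// ?mulr_ge0// ler_pM.
Qed.

Lemma bump_out r z0 w : 1 <= `|r * (Re w - Re z0)| \/ 1 <= `|r * (Im w - Im z0)| ->
  bump r z0 w = 0 /\ dbump r z0 w = 0.
Proof.
rewrite /bump /dbump => -[H|H]; rewrite !(cut_out H) !(dcut_out H); split; rewrite ?rmorph0; by ring.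
Qed.

Lemma bump_center r z0 : bump r z0 z0 = 1.
Proof. by rewrite /bump !subrr !cut0 mulr1. Qed.

Lemma ccont_dcut r t0 (c : R[i] -> R) w : (forall z, exists A B, wd (fun z => rc (c z)) z A B) ->
  ccont_at (fun z => rc (dcut r (c z - t0))) w.
Proof.
move=> hc; have [A [B hw]] := hc w.
have h0 := wdD hw (wd_cst (- rc t0) w).
have h1 := wdM (wd_cst (rc r) w) h0.
have h2 := wdD (wd_cst 1 w) (wdM (wd_cst (-1) w) (wdM h1 h1)).
have h3 : ccont_at (fun z => rc (1 - (r * (c z - t0)) ^+ 2)) w.
  move: (wd_ccont h2); congr (ccont_at _ _); apply/funext => z.
  by rewrite rmorphB rmorphXn rmorphM rmorphB rmorph1 expr2 mulN1r.
have := ccont_atM (wd_ccont (wdM (wd_cst (- rc (4 * r ^+ 2)) w) h0)) (ccont_pospart h3).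
congr (ccont_at _ _); apply/funext => z.
by rewrite /dcut -rmorphB -rmorphN -!rmorphM; congr (rc _); ring.
Qed.

Lemma ccont_dbump r z0 w : ccont_at (dbump r z0) w.
Proof.
have cRe := wd_cut r (Re z0) (wd_Re w); have cIm := wd_cut r (Im z0) (wd_Im w).
have dRe := @ccont_dcut r (Re z0) _ w (fun z => ex_intro _ _ (ex_intro _ _ (wd_Re z))).
have dIm := @ccont_dcut r (Im z0) _ w (fun z => ex_intro _ _ (ex_intro _ _ (wd_Im z))).
apply: ccont_atD.
  apply: ccont_atM; last exact: wd_ccont cIm.
  by apply: ccont_atM => //; exact: wd_ccont (wd_cst _ _).
apply: ccont_atM; first exact: wd_ccont cRe.
by apply: ccont_atM => //; exact: wd_ccont (wd_cst _ _).
Qed.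

(** Green's formula with P = Im h and Q = Re h: here $Q_x - P_y = Re(A + B) - Re(A - B) = 2 Re B$
    with B = k, and the boundary integrals vanish because h is zero on the border of the square. *)
Lemma stokes_compact_Re h k (z0 : R[i]) (M : R) : 0 < M ->
  (forall w, M <= `|Re w - Re z0| \/ M <= `|Im w - Im z0| -> h w = 0 /\ k w = 0) ->
  (forall w, exists A, wd h w A (k w)) -> (forall w, ccont_at k w) ->
  rintegral (fun w => Re (k w)) = 0.
Proof.
move=> M0 hk0 hw ck.
have ch w : ccont_at h w by have [A /wd_ccont] := hw w.
have [cRe cIm] := ccont_continuous ch; have [ckRe _] := ccont_continuous ck.
have ck2 : continuous (fun p : R * R => 2 * Re (k (plane p))).
  by move=> p; apply: cvgM; [exact: cvg_cst|exact: ckRe].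
have M20 : 0 < 2 * M by rewrite mulr_gt0.
have G := @green_defect_eq0 _ (fun p => Im (h (plane p))) (fun p => Re (h (plane p)))
  (fun p => 2 * Re (k (plane p))) cIm cRe ck2 _ (Re z0 - M) (Im z0 - M) (2 * M) M20.
have {G} : green_defect (fun p => Im (h (plane p))) (fun p => Re (h (plane p)))
  (fun p => 2 * Re (k (plane p))) (Re z0 - M) (Im z0 - M) (2 * M) = 0.
  apply: G => -[x y]; have [A hA] := hw (plane (x, y)).
  have dI := wd_rdiff_Im hA; have dR := wd_rdiff_Re hA.
  do 4 eexists; split; [exact: dI|exact: dR|].
  by rewrite /=; ring.
have E0 (f : R -> R) x s : f =1 (fun=> 0) -> edge f x s = 0.
  by move=> /funext ->; rewrite /edge Rintegral_cst// mul0r.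
have hRe t u : `|t - Re z0| = M -> h (plane (t, u)) = 0.
  by move=> H; apply: (hk0 _ _).1; left; rewrite /= H.
have hIm t u : `|t - Im z0| = M -> h (plane (u, t)) = 0.
  by move=> H; apply: (hk0 _ _).1; right; rewrite /= H.
have n1 (a : R) : `|a - M - a| = M by rewrite addrAC subrr add0r normrN ger0_norm// ltW.
have n2 (a : R) : `|a - M + 2 * M - a| = M.
  by rewrite (_ : a - M + 2 * M - a = M) ?ger0_norm ?(ltW M0)//; ring.
rewrite /green_defect !E0; try by move=> t; rewrite ?(hRe _ _ (n1 _)) ?(hRe _ _ (n2 _)) ?(hIm _ _ (n1 _)) ?(hIm _ _ (n2 _)).
rewrite !subr0 add0r sub0r => /eqP; rewrite oppr_eq0 /rint RintegralZl//; last 2 first.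
- exact: measurableX.
- by apply: rect_integrable => //; exact: ltW.
rewrite mulf_eq0 pnatr_eq0/= => /eqP <-.
rewrite /rintegral [RHS]Rintegral_mkcond; congr (\int[_]_(_ in _) _).
apply/funext => p; rewrite patchE; case: ifPn => // /negP pS.
suff -> : k (plane p) = 0 by [].
apply: (hk0 _ _).2 => /=; apply: contrapT => /not_orP[/negP p1 /negP p2]; apply: pS.
move: p1 p2; rewrite -!ltNge !ltr_norml => /andP[a b] /andP[c d].
by rewrite inE; split; rewrite /= in_itv/=; apply/andP; split; lra.
Qed.

Lemma stokes_compact h k (z0 : R[i]) (M : R) : 0 < M ->
  (forall w, M <= `|Re w - Re z0| \/ M <= `|Im w - Im z0| -> h w = 0 /\ k w = 0) ->
  (forall w, exists A, wd h w A (k w)) -> (forall w, ccont_at k w) ->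
  cintegral k = 0.
Proof.
move=> M0 hk0 hw ck; apply: complexP => /=; first exact: stokes_compact_Re M0 hk0 hw ck.
(* Multiplication by -i turns the imaginary part into a real part. *)
pose c : R[i] := Complex 0 (-1).
have := @stokes_compact_Re (fun w => c * h w) (fun w => c * k w) z0 M M0.
rewrite (_ : (fun w => Re (c * k w)) = fun w => Im (k w)); last first.
  by apply/funext => w; rewrite ReM /=; ring.
apply.
- by move=> w /hk0[-> ->]; rewrite mulr0.
- move=> w; have [A hA] := hw w; exists (c * A).
  by have := wdM (wd_cst c w) hA; rewrite !mul0r !add0r.
- by move=> w; apply: ccont_atM => //; exact: wd_ccont (wd_cst _ _).
Qed.

End Stokes.

(** * Stokes' theorem without compact support and with one exceptional point *)

Section StokesPlane.
Variable R : realType.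
Local Notation rc := (real_complex R).
Local Notation RR := (measurableTypeR R * measurableTypeR R)%type.
Implicit Types (h k : R[i] -> R[i]) (w z : R[i]).

Lemma harmonic_shift_cvg n0 (c : R) : (fun n => c * (n + n0).+1%:R^-1) @ \oo --> (0 : R).
Proof.
rewrite -(mulr0 c); apply: cvgM; first exact: cvg_cst.
have := @cvg_harmonic R; rewrite -(cvg_shiftn n0); exact.
Qed.

Lemma rintegral_box (S : set RR) (x s y s' c : R) : 0 <= s -> 0 <= s' ->
  S = `[x, x + s[%classic `*` `[y, y + s'[%classic ->
  rintegrable (fun w => ((fun=> c) \_ S) (Re w, Im w)) /\
  rintegral (fun w => ((fun=> c) \_ S) (Re w, Im w)) = c * (s * s').
Proof.
move=> s0 s'0 SE; have mS : measurable S by rewrite SE; exact: measurableX.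
have E : (fun w => ((fun=> c) \_ S) (Re w, Im w)) \o @plane R = (fun=> c) \_ S.
  by apply/funext => -[a b].
split.
  rewrite /rintegrable E -restrict_EFin; apply/(integrable_mkcond _ mS).
  by rewrite SE; apply: rect_integrable => // ?; exact: cvg_cst.
transitivity (\int[area R]_p ((fun=> c) \_ S) p); first by apply: eq_Rintegral => -[a b].
by rewrite -Rintegral_mkcond Rintegral_cst// SE area_rect.
Qed.

Lemma cmeasurable_bump r (z0 : R[i]) : cmeasurable (fun w => rc (bump r z0 w)).
Proof. by apply: ccont_measurable => w; exact: wd_ccont (wd_bump r z0 w). Qed.

Lemma cmeasurable_dbump r (z0 : R[i]) : cmeasurable (dbump r z0).
Proof. by apply: ccont_measurable => w; exact: ccont_dbump. Qed.

(** Multiply h by a wide cutoff minus a narrow one, both centred at z0. The wide cutoff has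
    derivative O(1/N) against the integrable h. The narrow one has derivative O(N), but on a square
    of area 4/N^2 where h is bounded. Their difference vanishes at z0, where h is only
    continuous. *)
Lemma stokes h k (z0 : R[i]) : (forall w, ccont_at h w) ->
  (forall w, w != z0 -> exists A, wd h w A (k w)) -> (forall w, ccont_at k w) ->
  cintegrable h -> cintegrable k -> cintegral k = 0.
Proof.
move=> ch hw ck ih ik.
have [dh dh0 Hh] := ch z0 1 ltr01; have [dk dk0 Hk] := ck z0 1 ltr01.
pose M := cmod (h z0) + cmod (k z0) + 1.
have M0 : 0 <= M by rewrite !addr_ge0 ?cmod_ge0.
(* From n0 on, the narrow square lies where h and k differ from their values at z0 by at most 1. *)
have [n0 n0d] : exists n0 : nat, 2 * (n0.+1%:R)^-1 <= Num.min dh dk.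
  exists (Num.truncn (2 / Num.min dh dk)).
  rewrite ler_pdivrMr// -ler_pdivrMl ?lt_min ?dh0// mulrC ltW//.
  exact: Num.Theory.truncnS_gt.
pose N n : R := (n + n0).+1%:R.
have N0 n : 0 < N n by rewrite ltr0n.
have N1 n : 1 <= N n by rewrite ler1n.
have Nd n : 2 * (N n)^-1 <= Num.min dh dk.
  apply: le_trans n0d; rewrite ler_pM2l// lef_pV2 ?posrE//.
  by rewrite ler_nat ltnS leq_addl.
pose b1 n := bump (N n)^-1 z0; pose b2 n := bump (N n) z0.
pose d1 n := dbump (N n)^-1 z0; pose d2 n := dbump (N n) z0.
have mk := ik.1; have mh := ih.1.
have b01 r (z : R[i]) w : `|bump r z w| <= 1.
  by have /andP[b0 b1'] := bump_itv01 r z w; rewrite ger0_norm.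
have ikb r : cintegrable (fun w => k w * rc (bump r z0 w)).
  apply: (cintegrable_dom _ (cintegrable_cmod ik)) => [|w].
    by apply: cmeasurableM => //; exact: cmeasurable_bump.
  by rewrite cmodM cmod_real ler_piMr ?cmod_ge0.
have ihd r : 0 <= r -> cintegrable (fun w => h w * dbump r z0 w).
  move=> r0; apply: (cintegrable_dom _ (rintegrableZ (4 * r) (cintegrable_cmod ih))) => [|w].
    by apply: cmeasurableM => //; exact: cmeasurable_dbump.
  by rewrite cmodM mulrC ler_wpM2r ?cmod_ge0// dbump_bound.
have Nge0 n : 0 <= N n by exact: ltW.
have NVge0 n : 0 <= (N n)^-1 by rewrite invr_ge0.
have I0 n : cintegral (fun w => k w * rc (b1 n w)) + cintegral (fun w => h w * d1 n w)
    - cintegral (fun w => k w * rc (b2 n w) + h w * d2 n w) = 0.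
  have i1 := cintegrableD (ikb (N n)^-1) (ihd _ (NVge0 n)).
  have i2 := cintegrableD (ikb (N n)) (ihd _ (Nge0 n)).
  rewrite -(cintegralD (ikb (N n)^-1) (ihd _ (NVge0 n))) -(cintegralB i1 i2).
  rewrite (_ : (fun w => _) = fun w => k w * (rc (b1 n w) - rc (b2 n w)) + h w * (d1 n w - d2 n w)); last first.
    by apply/funext => w; rewrite /b1 /b2 /d1 /d2; ring.
  have hchi w := wdD (wd_bump (N n)^-1 z0 w) (wdM (wd_cst (-1) w) (wd_bump (N n) z0 w)).
  have chi0 : rc (b1 n z0) + -1 * rc (b2 n z0) = 0 by rewrite /b1 /b2 !bump_center mulN1r subrr.
  have out w : N n <= `|Re w - Re z0| \/ N n <= `|Im w - Im z0| ->
     [/\ b1 n w = 0, b2 n w = 0, d1 n w = 0 & d2 n w = 0].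
    move=> H; have H1 : 1 <= `|(N n)^-1 * (Re w - Re z0)| \/ 1 <= `|(N n)^-1 * (Im w - Im z0)|.
      by case: H => H; [left|right]; rewrite normrM [`|_^-1|]ger0_norm// mulrC ler_pdivlMr// mul1r.
    have H2 : 1 <= `|N n * (Re w - Re z0)| \/ 1 <= `|N n * (Im w - Im z0)|.
      by case: H => H; [left|right]; rewrite normrM [`|N n|]ger0_norm// -[1](mulr1 1) ler_pM// (le_trans (N1 n)).
    have [e1 e2] := bump_out H1; have [e3 e4] := bump_out H2.
    by split.
  apply: (@stokes_compact _ (fun w => h w * (rc (b1 n w) + -1 * rc (b2 n w))) _ z0 (N n)) => //.
  - move=> w /out[-> -> -> ->]; rewrite subrr rmorph0 !mulr0 addr0; split=> //; by ring.
  (* At z0 the cutoff factor is zero, so [wdM_vanish] replaces the product rule. *)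
  - move=> w; have [->|wz] := eqVneq w z0.
      eexists; apply: wd_eq (wdM_vanish (ch z0) chi0 (hchi z0)) _ _ _ => //.
      by rewrite -/(d1 n) -/(d2 n); move: chi0; rewrite mulN1r => ->; ring.
    have [A hA] := hw w wz.
    eexists; apply: wd_eq (wdM hA (hchi w)) _ _ _ => //.
    by rewrite -/(d1 n) -/(d2 n) -/(b1 n) -/(b2 n); ring.
  - move=> w; apply: ccont_atD; apply: ccont_atM => //.
      have := wd_ccont (hchi w); congr (ccont_at _ _); apply/funext => z; by rewrite mulN1r.
    have := ccont_atD (ccont_dbump (N n)^-1 z0 w) (ccont_atM (wd_ccont (wd_cst (-1) w)) (ccont_dbump (N n) z0 w)).
    by congr (ccont_at _ _); apply/funext => z; rewrite mulN1r.
(* The wide cutoffs tend to 1 pointwise and are at most 1, so |k| is the majorant. *)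
have c1 : ccvg (fun n => cintegral (fun w => k w * rc (b1 n w))) (cintegral k).
  apply: (cintegral_dct _ mk _ (cintegrable_cmod ik)) => [n|w|n w].
  - by apply: cmeasurableM => //; exact: cmeasurable_bump.
  - pose x := Re w - Re z0; pose y := Im w - Im z0.
    apply: (@ccvg_squeeze _ _ _ (fun n => cmod (k w) * (2 * (x ^+ 2 + y ^+ 2)) * (N n)^-1)).
      move=> n; rewrite -[X in _ - X]mulr1 -mulrBr cmodM -mulrA ler_wpM2l ?cmod_ge0//.
      rewrite -(rmorph1 rc) -rmorphB cmod_real /b1 /bump.
      have hx := cut_near1 (N n)^-1 x; have hy := cut_near1 (N n)^-1 y.
      have /andP[x0 x1] := cut_itv01 (N n)^-1 x.
      have NN : (N n)^-1 ^+ 2 <= (N n)^-1 by rewrite expr2 ler_piMl// invf_le1.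
      rewrite (_ : cut _ _ * cut _ _ - 1 = cut (N n)^-1 x * (cut (N n)^-1 y - 1) + (cut (N n)^-1 x - 1)); last by rewrite -/x -/y; ring.
      rewrite (le_trans (ler_normD _ _))// normrM (ger0_norm x0).
      rewrite (@le_trans _ _ (2 * ((N n)^-1 * y) ^+ 2 + 2 * ((N n)^-1 * x) ^+ 2))//.
        by rewrite lerD// -[leRHS]mul1r ler_pM.
      rewrite [X in X <= _](_ : _ = 2 * (x ^+ 2 + y ^+ 2) * (N n)^-1 ^+ 2); last by ring.
      by rewrite ler_wpM2l// mulr_ge0// addr_ge0// sqr_ge0.
    exact: harmonic_shift_cvg.
  - by rewrite cmodM cmod_real ler_piMr ?cmod_ge0 ?b01.
have c2 : ccvg (fun n => cintegral (fun w => h w * d1 n w)) 0.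
  apply: (@ccvg_squeeze _ _ _ (fun n => (2 * (4 * rintegral (fun w => cmod (h w)))) * (N n)^-1)).
    move=> n; rewrite subr0.
    have -> : 2 * (4 * rintegral (fun w => cmod (h w))) * (N n)^-1 = 2 * rintegral (fun w => (4 * (N n)^-1) * cmod (h w)).
      rewrite /rintegral RintegralZl//; last exact: cintegrable_cmod.
      by ring.
    apply: cmod_cintegral; [exact: ihd|exact: rintegrableZ (cintegrable_cmod ih)|move=> w].
    by rewrite cmodM mulrC ler_wpM2r ?cmod_ge0// dbump_bound.
  exact: harmonic_shift_cvg.
(* The integrand is at most M (1 + 4 N) <= 5 M N on a square of area 4/N^2; with the factor 2 of
   [cmod_cintegral] this gives 40 M / N. *)
have c3 : ccvg (fun n => cintegral (fun w => k w * rc (b2 n w) + h w * d2 n w)) 0.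
  apply: (@ccvg_squeeze _ _ _ (fun n => (40 * M) * (N n)^-1)); last exact: harmonic_shift_cvg.
  move=> n; rewrite subr0.
  pose S : set RR := `[Re z0 - (N n)^-1, Re z0 - (N n)^-1 + 2 * (N n)^-1[%classic `*`
    `[Im z0 - (N n)^-1, Im z0 - (N n)^-1 + 2 * (N n)^-1[%classic.
  have s0 : 0 <= 2 * (N n)^-1 by rewrite mulr_ge0.
  have [iD ID] := @rintegral_box S (Re z0 - (N n)^-1) (2 * (N n)^-1) (Im z0 - (N n)^-1) (2 * (N n)^-1)
    (M * (1 + 4 * N n)) s0 s0 erefl.
  have := @cmod_cintegral _ (fun w => k w * rc (b2 n w) + h w * d2 n w) _ _ iD.
  move=> /(_ (cintegrableD (ikb _) (ihd _ (Nge0 n)))) H.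
  apply: (le_trans (H _)).
    move=> w; rewrite patchE; case: ifPn => wS; last first.
      have [|e1 e2] := @bump_out _ (N n) z0 w.
        apply: contrapT => /not_orP[/negP p1 /negP p2]; case/negP: wS.
        move: p1 p2; rewrite -!ltNge !normrM !(ger0_norm (Nge0 n)) ![N n * _]mulrC.
        rewrite -!ltr_pdivlMr// !mul1r !ltr_norml => /andP[u1 u2] /andP[v1 v2].
        rewrite inE; split; rewrite /= in_itv/=; apply/andP; split; move: u1 u2 v1 v2; move: ((N n)^-1) => q; lra.
      by rewrite /b2 /d2 e1 e2 rmorph0 !mulr0 addr0 cmod0.
    move: wS; rewrite inE => -[/=]; rewrite !in_itv/= => /andP[u1 u2] /andP[v1 v2].
    pose xi := w - z0.
    have wxi : w = z0 + xi by rewrite /xi addrCA subrr addr0.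
    have xid : cmod xi <= Num.min dh dk.
      apply: le_trans (Nd n); rewrite (le_trans (cmod_le_ReIm _))// mulr_natl mulr2n /xi ReB ImB.
      by rewrite lerD// ler_norml; apply/andP; split; move: u1 u2 v1 v2; move: ((N n)^-1) => q; lra.
    move: xid; rewrite le_min => /andP[x1 x2].
    have hM : cmod (h w) <= M.
      rewrite wxi -[h _](subrK (h z0)) (le_trans (cmodD _ _))//.
      by have := Hh _ x1; have := cmod_ge0 (k z0); rewrite /M; lra.
    have kM : cmod (k w) <= M.
      rewrite wxi -[k _](subrK (k z0)) (le_trans (cmodD _ _))//.
      by have := Hk _ x2; have := cmod_ge0 (h z0); rewrite /M; lra.
    rewrite (le_trans (cmodD _ _))// !cmodM cmod_real mulrDr mulr1 lerD//.
      by rewrite -[leRHS]mulr1 ler_pM ?cmod_ge0 ?b01.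
    by rewrite ler_pM ?cmod_ge0// dbump_bound.
  rewrite ID; have := N1 n; have := N0 n; move: (N n) => q q0 q1.
  rewrite -(ler_pM2r q0) -(ler_pM2r q0).
  rewrite (_ : _ * q * q = 8 * (M * (1 + 4 * q))); last by field; rewrite gt_eqF.
  rewrite (_ : 40 * M / q * q * q = 8 * (M * (5 * q))); last by field; rewrite gt_eqF.
  by rewrite ler_wpM2l// ler_wpM2l//; lra.
have := ccvgB (ccvgD c1 c2) c3; rewrite addr0 subr0 => c.
apply: (ccvg_unique c); apply: ccvg_ext (ccvg_cst 0) => n.
by rewrite I0.
Qed.

End StokesPlane.

(** * Gaussian moments *)

Section Gaussian.
Variable R : realType.
Local Notation rc := (real_complex R).
Local Notation RR := (measurableTypeR R * measurableTypeR R)%type.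
Local Notation leb := (@lebesgue_measure R).
Implicit Types (h k : R[i] -> R[i]) (w z : R[i]).

Lemma integral_prod_fun (phi : R -> R) (c : R) : measurable_fun [set: measurableTypeR R] phi ->
  (forall x, 0 <= phi x) -> (\int[leb]_x (phi x)%:E = c%:E)%E ->
  (\int[area R]_p (phi p.1 * phi p.2)%:E = (c * c)%:E)%E.
Proof.
move=> mphi phi0 ic.
have m2 : measurable_fun [set: RR] (fun p : RR => (phi p.1 * phi p.2)%:E).
  apply/measurable_EFinP; apply: measurable_funM.
    exact: (measurableT_comp mphi measurable_fst).
  exact: (measurableT_comp mphi measurable_snd).
rewrite (fubini_tonelli1 _ m2); last by move=> p; rewrite lee_fin mulr_ge0.
rewrite /fubini_F/=.
under eq_integral => x _.
  under eq_integral do rewrite EFinM.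
  rewrite ge0_integralZl//; last 3 first.
  - exact/measurable_EFinP.
  - by move=> y _; rewrite lee_fin.
  - by rewrite lee_fin.
  rewrite ic; over.
rewrite ge0_integralZr//; last 3 first.
- exact/measurable_EFinP.
- by move=> y _; rewrite lee_fin.
- by rewrite -ic integral_ge0// => x _; rewrite lee_fin.
by rewrite ic EFinM.
Qed.

Definition gauss w : R := expR (- cmod w ^+ 2).

Lemma gauss_ge0 w : 0 <= gauss w. Proof. exact: expR_ge0. Qed.

Lemma integral_gauss : (\int[area R]_p (gauss (plane p))%:E = pi%:E)%E.
Proof.
rewrite -(sqr_sqrtr (pi_ge0 R)) expr2 -(integral_prod_fun measurable_gauss_fun gauss_fun_ge0 integralT_gauss).
apply: eq_integral => -[x y] _ /=; congr EFin.
by rewrite /gauss sqr_cmod/= opprD expRD.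
Qed.

Lemma rmeasurable_cmod_id : rmeasurable (@cmod R).
Proof. by apply: (@rmeasurable_cmod _ id); apply: ccont_measurable => w; exact: wd_ccont (wd_id w). Qed.

Lemma rmeasurable_expR (r : R[i] -> R) : rmeasurable r -> rmeasurable (fun w => expR (r w)).
Proof. by move=> mr; apply: (measurableT_comp (@measurable_expR R) mr). Qed.

Lemma rmeasurable_cst (c : R) : rmeasurable (fun _ : R[i] => c).
Proof. exact: measurable_cst. Qed.

Lemma rmeasurable_gauss : rmeasurable gauss.
Proof.
apply: rmeasurable_expR.
rewrite (_ : (fun _ => _) = fun w => 0 - cmod w ^+ 2); last by apply/funext => w; rewrite sub0r.
by apply: rmeasurableB; [exact: rmeasurable_cst|apply: rmeasurableX; exact: rmeasurable_cmod_id].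
Qed.

(** The product of two standard normal densities is a constant multiple of this function, and its
    integral is 1 by Tonelli. *)
Lemma rintegrable_halfgauss : rintegrable (fun w : R[i] => expR (- (cmod w ^+ 2 / 2))).
Proof.
have mh : rmeasurable (fun w : R[i] => expR (- (cmod w ^+ 2 / 2))).
  apply: rmeasurable_expR.
  rewrite (_ : (fun _ => _) = fun w => 0 - cmod w ^+ 2 * 2^-1); last by apply/funext => w; rewrite sub0r.
  apply: rmeasurableB; first exact: rmeasurable_cst.
  by apply: rmeasurableM; [apply: rmeasurableX; exact: rmeasurable_cmod_id|exact: rmeasurable_cst].
apply: rintegrableP => //.
pose c := normal_peak (1 : R).
have c0 : 0 < c by rewrite normal_peak_gt0// oner_eq0.
have := integral_prod_fun (measurable_normal_pdf 0 1) (fun x => normal_pdf_ge0 0 1 x) (integral_normal_pdf 0 1).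
rewrite (_ : (\int[area R]_p _)%E = \int[area R]_p ((c ^+ 2)%:E * (expR (- (cmod (plane p) ^+ 2 / 2)))%:E))%E; last first.
  apply: eq_integral => -[x y] _ /=.
  rewrite !normal_pdfE ?oner_eq0// /normal_fun -EFinM; congr EFin.
  rewrite mulrACA -expRD -expr2 sqr_cmod/=; congr (_ * expR _).
  by rewrite !subr0 expr1n; field.
rewrite ge0_integralZl//; last 2 first.
- by apply/measurable_EFinP; exact: mh.
- by rewrite lee_fin exprn_ge0// ltW.
(* An infinite integral times the positive constant c^2 could not equal 1. *)
move=> E; rewrite /cintegral_finite ltNge leye_eq; apply/negP => /eqP I.
by move: E; rewrite I mulry gtr0_sg ?mul1e// exprn_gt0.
Qed.

(** Expanding $(B - t)^2 \ge 0$ gives $B t - t^2 \le B^2/2 - t^2/2$, which leaves half of the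
    Gaussian as majorant. *)
Lemma rintegrable_expgauss (B : R) : rintegrable (fun w => expR (B * cmod w) * gauss w).
Proof.
apply: (rintegrable_dom _ (rintegrableZ (expR (B ^+ 2 / 2)) rintegrable_halfgauss)).
  apply: rmeasurableM; last exact: rmeasurable_gauss.
  by apply: rmeasurable_expR; apply: rmeasurableM; [exact: rmeasurable_cst|exact: rmeasurable_cmod_id].
move=> w; rewrite ger0_norm ?mulr_ge0 ?expR_ge0// /gauss -!expRD ler_expR.
by have := sqr_ge0 (B - cmod w); rewrite sqrrB; lra.
Qed.

(** The growth condition for functions that involve conj(w) and hence are not power series in w. The
    constants carry no sign, which explains the absolute values in [egrowD]. *)
Definition egrow h : Prop := exists C B : R, forall w, cmod (h w) <= C * expR (B * cmod w).

Lemma egrowM h k : egrow h -> egrow k -> egrow (fun w => h w * k w).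
Proof.
move=> [C [B H]] [C' [B' K]]; exists (C * C'), (B + B') => w.
by rewrite cmodM mulrDl expRD mulrACA ler_pM ?cmod_ge0.
Qed.

Lemma egrow_conj h : egrow h -> egrow (fun w => (h w)^*).
Proof. by move=> [C [B H]]; exists C, B => w; rewrite cmod_conj. Qed.

Lemma egrow_id : egrow id.
Proof.
exists 1, 1 => w; rewrite !mul1r (le_trans _ (expR_ge1Dx _))//.
by rewrite lerDr.
Qed.

Lemma egrow_cst (c : R[i]) : egrow (fun=> c).
Proof. by exists (cmod c), 0 => w; rewrite mul0r expR0 mulr1. Qed.

Lemma egrowX h n : egrow h -> egrow (fun w => h w ^+ n).
Proof.
move=> H; elim: n => [|n IH]; first exact: egrow_cst 1.
by under eq_fun do rewrite exprS; exact: egrowM.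
Qed.

Lemma egrowD h k : egrow h -> egrow k -> egrow (fun w => h w + k w).
Proof.
move=> [C [B H]] [C' [B' K]]; exists (`|C| + `|C'|), (`|B| + `|B'|) => w.
rewrite (le_trans (cmodD _ _))// mulrDl lerD//.
  rewrite (le_trans (H w))// (@le_trans _ _ (`|C| * expR (B * cmod w)))//.
    by rewrite ler_wpM2r ?expR_ge0// ler_norm.
  rewrite ler_wpM2l// ler_expR ler_wpM2r ?cmod_ge0// (le_trans (ler_norm _))// lerDl//.
rewrite (le_trans (K w))// (@le_trans _ _ (`|C'| * expR (B' * cmod w)))//.
  by rewrite ler_wpM2r ?expR_ge0// ler_norm.
by rewrite ler_wpM2l// ler_expR ler_wpM2r ?cmod_ge0// (le_trans (ler_norm _))// lerDr.
Qed.

Lemma egrow_ps C B (A : nat -> R[i]) : egf C B A -> egrow (ps A).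
Proof. by move=> AB; exists C, B => w; exact: ps_bound. Qed.

Lemma cintegrable_egrow h : cmeasurable h -> egrow h -> cintegrable (fun w => h w * rc (gauss w)).
Proof.
move=> mh [C [B hC]].
apply: (cintegrable_dom _ (rintegrableZ C (rintegrable_expgauss B))) => [|w].
  by apply: cmeasurableM => //; apply: cmeasurable_real; exact: rmeasurable_gauss.
by rewrite cmodM cmod_real ger0_norm ?gauss_ge0// mulrA ler_wpM2r ?gauss_ge0.
Qed.

Lemma wd_exp n w : wd (fun z => z ^+ n) w (n%:R * w ^+ n.-1) 0.
Proof.
elim: n => [|n IH]; first by rewrite mul0r; exact: wd_cst.
apply: wd_eq (wdM (wd_id w) IH) _ _ _ => [z||]; rewrite ?exprS//.
  by rewrite mul1r /=; case: n IH => [|n] _; rewrite /= ?exprS; ring.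
by ring.
Qed.

Lemma wd_sqr_cmod w : wd (fun z => rc (cmod z ^+ 2)) w w^* w.
Proof.
apply: wd_eq (wdM (wd_id w) (wd_conj (wd_id w))) _ _ _ => [z||].
- by rewrite mulJ_cmod.
- by rewrite rmorph0; ring.
- by rewrite rmorph1; ring.
Qed.

Lemma is_derive_expRN (s : R) : is_derive s 1 (fun t => expR (- t)) (- expR (- s)).
Proof.
by apply: trigger_derive; rewrite /GRing.scale/=; ring.
Qed.

Lemma wd_gauss w : wd (fun z => rc (gauss z)) w (- (w^* * rc (gauss w))) (- (w * rc (gauss w))).
Proof.
have := wd_comp_real (derivable_rder (is_derive_expRN (cmod w ^+ 2))) (wd_sqr_cmod w).
by move=> H; apply: wd_eq H _ _ _ => // ; rewrite /gauss; ring.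
Qed.

Definition mono p q w : R[i] := w ^+ p * w^* ^+ q.

Lemma wd_mono p q w : wd (mono p q) w (p%:R * w ^+ p.-1 * w^* ^+ q) (w ^+ p * (q%:R * w^* ^+ q.-1)).
Proof.
have hq : wd (fun z => z^* ^+ q) w 0 (q%:R * w^* ^+ q.-1).
  apply: wd_eq (wd_conj (wd_exp q w)) _ _ _ => [z||]; rewrite ?rmorphXn ?rmorph0//.
  by rewrite rmorphM rmorphXn rmorph_nat.
by apply: wd_eq (wdM (wd_exp p w) hq) _ _ _ => //; ring.
Qed.

Lemma cmeasurable_mono p q : cmeasurable (mono p q).
Proof. by apply: ccont_measurable => w; exact: wd_ccont (wd_mono p q w). Qed.

Lemma egrow_mono p q : egrow (mono p q).
Proof. by apply: egrowM; apply: egrowX; [exact: egrow_id|apply: egrow_conj; exact: egrow_id]. Qed.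

Lemma cintegrable_mono p q : cintegrable (fun w => mono p q w * rc (gauss w)).
Proof. by apply: cintegrable_egrow; [exact: cmeasurable_mono|exact: egrow_mono]. Qed.

Definition moment p q : R[i] := cintegral (fun w => mono p q w * rc (gauss w)).

(** Stokes' theorem for $w^p \bar w^q e^{-|w|^2}$, whose dbar-derivative is the difference of the
    two integrands. At q = 0 the truncated predecessor is multiplied by 0. *)
Lemma moment_rec p q : moment p.+1 q = q%:R * moment p q.-1.
Proof.
have iq := cintegrableZ q%:R (cintegrable_mono p q.-1).
apply/esym/eqP; rewrite -subr_eq0 -cintegralZ; last exact: cintegrable_mono.
rewrite -(cintegralB iq (cintegrable_mono _ _)); apply/eqP.
have H w := wdM (wd_mono p q w) (wd_gauss w).
apply: (@stokes _ (fun w => mono p q w * rc (gauss w)) _ 0).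
- by move=> w; exact: wd_ccont (H w).
- move=> w _; eexists; apply: wd_eq (H w) _ _ _ => //.
  by rewrite /mono exprS; ring.
- move=> w; have := wd_ccont (wdD (wdM (wd_cst q%:R w) (wdM (wd_mono p q.-1 w) (wd_gauss w)))
       (wdM (wd_cst (-1) w) (wdM (wd_mono p.+1 q w) (wd_gauss w)))).
  by congr (ccont_at _ _); apply/funext => z; rewrite mulN1r.
- exact: cintegrable_mono.
- exact: cintegrableB iq (cintegrable_mono _ _).
Qed.

Lemma moment_conj p q : (moment p q)^* = moment q p.
Proof.
rewrite /moment -(cintegral_conj (cintegrable_mono p q)); congr cintegral; apply/funext => w.
by rewrite /mono !rmorphM !rmorphXn /= conjCK [X in _ * X](_ : _ = rc (gauss w)); [ring|apply: complexP; rewrite ?Re_conj ?Im_conj//= oppr0].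
Qed.

Lemma moment00 : moment 0 0 = rc pi.
Proof.
rewrite /moment (_ : (fun w => _) = fun w => rc (gauss w)); last first.
  by apply/funext => w; rewrite /mono !expr0 !mul1r.
apply: complexP; rewrite /= /Rintegral; first by rewrite integral_gauss.
by rewrite integral0.
Qed.

(** The recursion lowers both exponents together; when the first is 0 and the second is not,
    conjugation exchanges them and the recursion gives 0. *)
Lemma momentE p q : moment p q = if p == q then rc (pi * p`!%:R) else 0.
Proof.
elim: p q => [|p IH] [|q].
- by rewrite moment00 mulr1.
- by rewrite -moment_conj moment_rec mul0r rmorph0.
- by rewrite moment_rec mul0r.
rewrite moment_rec IH eqSS /=; case: eqP => [->|_]; last by rewrite mulr0.
by rewrite factS natrM !rmorphM !rmorph_nat; ring.
Qed.

End Gaussian.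

(** * The reproducing property *)

Section Holomorphic.
Variable R : realType.
Local Notation rc := (real_complex R).
Implicit Types (f h k u : R[i] -> R[i]) (w z : R[i]).

(** In R[i] only real numbers are comparable with 0, so tolerances and radii of the topology of R[i]
    can be traded for real ones. *)
Lemma rc_gt0_exists (e : R[i]) : 0 < e -> exists2 e1 : R, 0 < e1 & e = rc e1.
Proof.
move=> e0; have ee : e = rc (Re e) by rewrite RRe_real// gtr0_real.
by exists (Re e) => //; move: e0; rewrite ee ltcR.
Qed.

Lemma derivable_wd f z : derivable (f : R[i]^o -> R[i]^o) z 1 -> exists a, wd f z a 0.
Proof.
move=> /cvg_ex[a /= fa]; exists a => e e0.
have re0 : 0 < rc e by rewrite ltcR.
have /cvgrPdist_le/(_ _ re0)/nbhs_ballP[d /= d0 H] := fa.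
have [d1 d10 dE] := rc_gt0_exists d0.
exists (d1 / 2); first by rewrite divr_gt0.
move=> t td; have [->|t0] := eqVneq t 0.
  by rewrite addr0 subrr rmorph0 !mulr0 !subr0 cmod0 mulr0.
have := H t; rewrite /ball/= sub0r normrN => /(_ _ t0).
have td' : `|t| < d by rewrite normC_cmod dE ltcR (le_lt_trans td)// ltr_pdivrMr// ltr_pMr// ltr1n.
move=> /(_ td'); rewrite scaler1 [t + z]addrC /GRing.scale/= => {}H.
move: H; rewrite normC_cmod lecR => H.
rewrite mul0r subr0 -ler_pdivrMr ?cmod_gt0// -cmodV -cmodM; apply: le_trans H.
rewrite cmod_distC; apply: eqW; congr cmod.
by field.
Qed.

Lemma wd_derivable f z a : wd f z a 0 -> derivable (f : R[i]^o -> R[i]^o) z 1.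
Proof.
move=> fa; apply/cvg_ex; exists a; apply/cvgrPdist_le => /= e e0.
have [e1 e10 eE] := rc_gt0_exists e0.
have [d d0 H] := fa _ e10.
apply/nbhs_ballP; exists (rc d); first by rewrite /= ltcR.
move=> t; rewrite /ball/= sub0r normrN normC_cmod ltcR => td t0.
have := H t (ltW td); rewrite mul0r subr0 -ler_pdivrMr ?cmod_gt0// -cmodV -cmodM => {}H.
rewrite normC_cmod eE lecR; apply: le_trans H.
rewrite cmod_distC scaler1 [t + z]addrC /GRing.scale/=; apply: eqW; congr cmod.
by field.
Qed.

Lemma entire_wd f : entire f -> forall w, exists a, wd f w a 0.
Proof. by move=> ef w; exact: derivable_wd (ef w). Qed.

Lemma wd_entire f : (forall w, exists a, wd f w a 0) -> entire f.
Proof. by move=> ef w; have [a /wd_derivable] := ef w. Qed.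

Lemma entire_ccont f : entire f -> forall w, ccont_at f w.
Proof. by move=> /entire_wd ef w; have [a /wd_ccont] := ef w. Qed.

Lemma entire_ps C B (A : nat -> R[i]) : egf C B A -> entire (ps A).
Proof. by move=> AB; apply: wd_entire => w; exists (ps (dcoef A) w); exact: ps_wd AB. Qed.

Lemma entireM f h : entire f -> entire h -> entire (fun z => f z * h z).
Proof.
move=> /entire_wd ef /entire_wd eh; apply: wd_entire => w.
have [a ha] := ef w; have [b hb] := eh w.
by eexists; apply: wd_eq (wdM ha hb) _ _ _ => //; rewrite mul0r mulr0 addr0.
Qed.

Lemma entireX n : entire (fun z : R[i] => z ^+ n).
Proof. by apply: wd_entire => w; eexists; exact: wd_exp. Qed.

Lemma wd_local f h w A B (d : R) : 0 < d -> (forall xi, cmod xi <= d -> f (w + xi) = h (w + xi)) ->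
  wd f w A B -> wd h w A B.
Proof.
move=> d0 fh hf e e0; have [d1 d10 H] := hf e e0.
exists (Num.min d d1); first by rewrite lt_min d0.
move=> xi; rewrite le_min => /andP[x1 x2].
have := fh 0; rewrite cmod0 addr0 => /(_ (ltW d0)) <-.
by rewrite -fh// H.
Qed.

Lemma wd_inv w : w != 0 -> wd (fun z => z^-1) w (- w^-1 ^+ 2) 0.
Proof.
move=> w0 e e0; have cw : 0 < cmod w by rewrite cmod_gt0.
(* The first bound keeps |w + xi| >= |w|/2; the second then brings the error factor, at most 2 |xi|
   / |w|^3, below e. *)
exists (Num.min (cmod w / 2) (e * cmod w ^+ 3 / 2)).
  by rewrite lt_min !divr_gt0// mulr_gt0// exprn_gt0.
move=> xi; rewrite le_min => /andP[x1 x2].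
have cx : cmod w / 2 <= cmod (w + xi).
  have := cmodB (w + xi) xi; rewrite addrK => H.
  by move: (cmod (w + xi)) (cmod xi) (cmod w) H x1 => a b c H H1; lra.
have wx0 : w + xi != 0 by rewrite -cmod_gt0 (lt_le_trans _ cx)// divr_gt0.
rewrite (_ : _ - _ = xi * (xi * ((w + xi)^-1 * w^-1 ^+ 2))); last by field; rewrite w0 wx0.
rewrite cmodM [leRHS]mulrC ler_wpM2l ?cmod_ge0// cmodM [cmod (_^-1 * _)]cmodM cmodX !cmodV.
rewrite (@le_trans _ _ (e * cmod w ^+ 3 / 2 * ((cmod w / 2)^-1 * (cmod w)^-1 ^+ 2)))//.
  rewrite ler_pM ?cmod_ge0 ?mulr_ge0 ?invr_ge0 ?exprn_ge0 ?cmod_ge0// ?invr_ge0 ?cmod_ge0//.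
  rewrite ler_wpM2r ?exprn_ge0 ?invr_ge0 ?cmod_ge0// lef_pV2 ?posrE ?divr_gt0//.
  by rewrite (lt_le_trans _ cx)// divr_gt0.
apply: eqW; field.
by rewrite gt_eqF.
Qed.

(** With [a] the derivative of u at z this is the continuous extension across w = z. Continuity is
    all that is proved at z itself, which is the exceptional point that [stokes] permits. *)
Definition diffquot u (a z w : R[i]) : R[i] := if w == z then a else (u w - u z) / (w - z).

Lemma wd_diffquot u a z w b : wd u w b 0 -> w != z -> exists A, wd (diffquot u a z) w A 0.
Proof.
move=> hu wz; have wz0 : w - z != 0 by rewrite subr_eq0.
have h1 := wdD hu (wd_cst (- u z) w).
have hz : wd (fun y => y - z) w 1 0.
  by apply: wd_eq (wdD (wd_id w) (wd_cst (- z) w)) _ _ _; rewrite ?addr0.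
have h2 := @wd_comp_hol _ (fun y => y^-1) (fun y => y - z) w _ _ _ (wd_inv wz0) hz.
have h3 := wdM h1 h2.
(* Within half the distance to z the test w = z is false, so the quotient formula may be
   differentiated. *)
eexists; apply: (@wd_local _ _ _ _ _ (cmod (w - z) / 2)); first by rewrite divr_gt0// cmod_gt0.
  2: by apply: wd_eq h3 _ _ _ => //; ring.
move=> xi xid /=; rewrite /diffquot; case: eqP => // wxz.
have : cmod (w - z) = cmod xi by rewrite -wxz opprD addrA subrr add0r cmodN.
move=> E; move: xid; rewrite E => xid.
have x0 : 0 < cmod xi by rewrite -E cmod_gt0.
by have : cmod xi <= 0; [move: (cmod xi) xid => q; lra|rewrite leNgt x0].
Qed.

Lemma ccont_diffquot u a z : wd u z a 0 -> ccont_at (diffquot u a z) z.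
Proof.
move=> hu e e0; have [d d0 H] := hu e e0; exists d => // xi xid.
rewrite /diffquot eqxx; case: eqP => [_|/eqP]; first by rewrite subrr cmod0 ltW.
move=> xz; have x0 : xi != 0 by apply: contra xz => /eqP ->; rewrite addr0.
have := H _ xid; rewrite mul0r subr0 -ler_pdivrMr ?cmod_gt0// -cmodV -cmodM.
apply: le_trans; apply: eqW; congr cmod.
by rewrite [z + xi - z]addrAC subrr add0r; field.
Qed.

Lemma ccont_bounded h (rho : R) : (forall w, ccont_at h w) ->
  exists2 M : R, 0 <= M & forall w, cmod w <= rho -> cmod (h w) <= M.
Proof.
move=> /ccont_continuous[c1 c2].
have [M1 H1] := continuous_bounded_rect (- rho) (2 * rho) (- rho) (2 * rho) c1.
have [M2 H2] := continuous_bounded_rect (- rho) (2 * rho) (- rho) (2 * rho) c2.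
exists (`|M1| + `|M2|); first by rewrite addr_ge0.
move=> w wr; rewrite (le_trans (cmod_le_ReIm _))//.
have a1 : - rho <= Re w <= - rho + 2 * rho.
  have := le_trans (Re_le_cmod w) wr; rewrite ler_norml => /andP[? ?]; apply/andP; split; lra.
have a2 : - rho <= Im w <= - rho + 2 * rho.
  have := le_trans (Im_le_cmod w) wr; rewrite ler_norml => /andP[? ?]; apply/andP; split; lra.
have b1 := H1 (Re w, Im w) a1 a2; have b2 := H2 (Re w, Im w) a1 a2.
rewrite -!planeE in b1 b2.
by rewrite lerD// ?(le_trans b1) ?(le_trans b2)// ler_norm.
Qed.

End Holomorphic.

(** * The kernel series, its differential equation, and a dbar-primitive *)

Section Kernel.
Variables (R : realType) (m : nat).
Local Notation rc := (real_complex R).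
Implicit Types (f h u : R[i] -> R[i]) (w z : R[i]).

Definition kap (k : nat) : R[i] := m`!%:R / (k + m)`!%:R.

Lemma natf_neq0 n : (n`!%:R : R[i]) != 0.
Proof. by rewrite pnatr_eq0 -lt0n fact_gt0. Qed.

Lemma kap_neq0 k : kap k != 0.
Proof. by rewrite mulf_neq0 ?invr_eq0 ?natf_neq0. Qed.

Lemma kap0 : kap 0 = 1.
Proof. by rewrite /kap add0n divff ?natf_neq0. Qed.

Lemma kapS k : (k.+1 + m)%:R * kap k.+1 = kap k.
Proof.
have a0 : (k + m).+1%:R != 0 :> R[i] by rewrite pnatr_eq0.
rewrite /kap addSn factS natrM; move: ((k + m).+1%:R) a0 => a a0; field.
by rewrite natf_neq0 a0.
Qed.

Lemma kap_real k : kap k = rc (m`!%:R / (k + m)`!%:R).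
Proof. by rewrite rmorphM fmorphV !rmorph_nat. Qed.

Lemma conj_kap k : (kap k)^* = kap k.
Proof. by rewrite kap_real; apply: complexP; rewrite ?Re_conj ?Im_conj//= oppr0. Qed.

(** The inequality is $m!\,k! \le (k+m)!$: a binomial coefficient is at least 1. *)
Lemma egf_kap : egf 1 1 kap.
Proof.
split=> // k; rewrite kap_real cmod_real mul1r ger0_norm ?divr_ge0// /exp_coeff/= expr1n mul1r.
have f1 : 0 < k`!%:R :> R by rewrite ltr0n fact_gt0.
have f2 : 0 < (k + m)`!%:R :> R by rewrite ltr0n fact_gt0.
rewrite ler_pdivrMr// [leRHS]mulrC ler_pdivlMr// -natrM ler_nat.
have := bin_fact (leq_addl k m); rewrite addnK => <-.
by rewrite leq_pmull// bin_gt0 leq_addl.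
Qed.

Definition kerE (x : R[i]) : R[i] := ps kap x.

Lemma repro_kernelE z w : repro_kernel m z w = kerE (z * w^*).
Proof. by []. Qed.

Definition kerdE (x : R[i]) : R[i] := ps (dcoef kap) x.

(** Coefficientwise this is [kapS]; the term m on the right is the constant term of m E. *)
Lemma kerE_ode x : x * kerdE x + m%:R * kerE x = x * kerE x + m%:R.
Proof.
have c1 := ccvg_shift 1 (ps_cvg x egf_kap); have c0 := ps_cvg x egf_kap.
have cd := ps_cvg x (egf_dcoef egf_kap).
apply: (ccvg_unique (ccvgD (ccvgM (ccvg_cst x) cd) (ccvgM (ccvg_cst m%:R) c1))).
apply: ccvg_ext (ccvgD (ccvgM (ccvg_cst x) c0) (ccvg_cst m%:R)) => n.
rewrite /psum addn1 big_ord_recl expr0 mulr1 kap0 mulrDr mulr1 [RHS]addrCA [RHS]addrC; congr (_ + _).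
rewrite !mulr_sumr -big_split/=; apply: eq_bigr => k _.
by rewrite /bump/= ?add1n -(kapS k) /dcoef exprS natrD; ring.
Qed.

Lemma rc_weight w : rc (weight m w) = mono m m w * rc (gauss w).
Proof.
by rewrite /weight /mono rmorphM -exprMn mulJ_cmod -rmorphXn -exprM.
Qed.

(** Partial sum of $e^{|w|^2}$. After multiplication by the Gaussian its dbar-derivative telescopes:
    for [expsum m] with m > 0 only $-w|w|^{2(m-1)}e^{-|w|^2}/(m-1)!$ is left, which is the shape of
    the term to be cancelled. *)
Definition expsum n w : R[i] := \sum_(j < n) mono j j w / j`!%:R.

Lemma wd_expsum n w : exists A, wd (expsum n.+1) w A (w * expsum n w).
Proof.
elim: n => [|n [A IH]].
  exists 0; apply: wd_eq (wd_cst 1 w) _ _ _ => [z||] //.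
    by rewrite /expsum big_ord1 /mono !expr0 fact0 mulr1 invr1 mulr1.
  by rewrite /expsum big_ord0 mulr0.
eexists; apply: wd_eq (wdD IH (wdM (wd_mono n.+1 n.+1 w) (wd_cst (n.+1`!%:R)^-1 w))) _ _ _ => [z||].
- by rewrite /expsum [RHS]big_ord_recr.
- by [].
- rewrite /expsum [in RHS]big_ord_recr/= mulrDr; congr (_ + _).
  rewrite /mono exprS factS natrM; field.
  by rewrite nat1r natf_neq0 pnatr_eq0.
Qed.

(* The second summand cancels the contribution of the inhomogeneous term m of
   [kerE_ode] to the dbar-derivative. *)
Definition psi z w : R[i] := (mono m m w * kerE (z * w^*) + m`!%:R * expsum m w) * rc (gauss w).

Lemma wd_kerE_conj z w : wd (fun w => kerE (z * w^*)) w 0 (kerdE (z * w^*) * z).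
Proof.
have h1 : wd (fun w => z * w^*) w 0 z.
  by apply: wd_eq (wdM (wd_cst z w) (wd_conj (wd_id w))) _ _ _ => //; rewrite ?rmorph0 ?rmorph1; ring.
by apply: wd_eq (@wd_comp_hol _ (ps kap) (fun w => z * w^*) w _ _ _ (ps_wd (z * w^*) egf_kap) h1) _ _ _ => //; rewrite mulr0.
Qed.

Lemma egrow_kerE z : egrow (fun w => kerE (z * w^*)).
Proof.
exists 1, (cmod z) => w; have := ps_bound (z * w^*) egf_kap.
by rewrite !mul1r cmodM cmod_conj.
Qed.

Lemma cmeasurable_kerE z : cmeasurable (fun w => kerE (z * w^*)).
Proof. by apply: ccont_measurable => w; exact: wd_ccont (wd_kerE_conj z w). Qed.

Hypothesis m_gt0 : (0 < m)%N.

Lemma wd_psi z w : exists A, wd (psi z) w A ((z - w) * kerE (z * w^*) * rc (weight m w)).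
Proof.
have [A hT] := wd_expsum m.-1 w; rewrite prednK// in hT.
have h := wdM (wdD (wdM (wd_mono m m w) (wd_kerE_conj z w)) (wdM (wd_cst m`!%:R w) hT)) (wd_gauss w).
eexists; apply: wd_eq h _ _ _ => //.
have O := kerE_ode (z * w^*).
have TE : expsum m w = expsum m.-1 w + mono m.-1 m.-1 w / m.-1`!%:R.
  by rewrite -[in LHS](prednK m_gt0) /expsum big_ord_recr.
have fE : m`!%:R = m%:R * m.-1`!%:R :> R[i].
  by rewrite -natrM; congr _%:R; rewrite -[in LHS](prednK m_gt0) factS prednK.
have wE : w ^+ m = w * w ^+ m.-1 by rewrite -exprS prednK.
have ME : mono m m w = w * w^* * mono m.-1 m.-1 w.
  by rewrite /mono -(prednK m_gt0) !exprS /=; ring.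
rewrite rc_weight TE fE wE ME.
have -> : mono m.-1 m.-1 w = w ^+ m.-1 * w^* ^+ m.-1 by [].
have H : z * w^* * kerdE (z * w^*) = z * w^* * kerE (z * w^*) + m%:R - m%:R * kerE (z * w^*).
  by rewrite -O; ring.
move: H (natf_neq0 m.-1); move: (kerE _) (kerdE _) (rc _) (w ^+ m.-1) (w^* ^+ m.-1) (expsum m.-1 w) (m.-1`!%:R) => K dK g a b T F H F0.
(* Extracting $w|w|^{2(m-1)}$ isolates m E + x E' at x = z conj(w), the left side of the
   differential equation. *)
transitivity ((w * a * b * (m%:R * K + z * w^* * dK) - m%:R * w * (a * b)) * g - w * w^* * (a * b) * K * w * g).
  by field.
by rewrite H; ring.
Qed.

End Kernel.

(** * The projection fixes every member of the space *)

Section Reproducing.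
Variables (R : realType) (m : nat).
Local Notation rc := (real_complex R).
Local Notation kerE := (@kerE R m).
Implicit Types (f h u v phi : R[i] -> R[i]) (w z : R[i]).

(** From $|v\varphi| \le |v|^2 + |\varphi|^2$. Only square-integrability is available for members of
    the space, not a pointwise growth bound. *)
Lemma cintegrable_sqr_egrow v phi : cmeasurable v ->
  rintegrable (fun w => cmod (v w) ^+ 2 * gauss w) -> cmeasurable phi -> egrow phi ->
  cintegrable (fun w => v w * phi w * rc (gauss w)).
Proof.
move=> mv iv mphi ephi.
have i2 := cintegrable_cmod (cintegrable_egrow (cmeasurableM mphi mphi) (egrowM ephi ephi)).
apply: (cintegrable_dom _ (rintegrableD iv i2)) => [|w].
  apply: cmeasurableM; first exact: cmeasurableM.
  by apply: cmeasurable_real; exact: rmeasurable_gauss.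
rewrite !cmodM cmod_real ger0_norm ?gauss_ge0// -mulrDl ler_wpM2r ?gauss_ge0//.
by move: (cmod_ge0 (v w)) (cmod_ge0 (phi w)); move: (cmod (v w)) (cmod (phi w)) => a b a0 b0; nra.
Qed.

Lemma fock_sobolev_sqr u : fock_sobolev m u ->
  rintegrable (fun w => cmod (w ^+ m * u w) ^+ 2 * gauss w).
Proof.
move=> [eu [ezu fu]]; apply: rintegrableP => // [|w].
  apply: rmeasurableM; last exact: rmeasurable_gauss.
  by apply: rmeasurableX; apply: rmeasurable_cmod; apply: ccont_measurable; exact: entire_ccont.
by rewrite mulr_ge0 ?gauss_ge0// exprn_ge0 ?cmod_ge0.
Qed.

(** The weight is split evenly: $w^m$ goes to u, which becomes square-integrable against the
    Gaussian, and $\bar w^m$ to the kernel. *)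
Lemma cintegrable_kerE_weight u z : fock_sobolev m u ->
  cintegrable (fun w => u w * kerE (z * w^*) * rc (weight m w)).
Proof.
move=> fu; have eu := fu.1.
have := @cintegrable_sqr_egrow (fun w => w ^+ m * u w) (fun w => w^* ^+ m * kerE (z * w^*)) _ (fock_sobolev_sqr fu).
rewrite (_ : (fun w => _ * _ * rc (gauss w)) = fun w => u w * kerE (z * w^*) * rc (weight m w)); last first.
  by apply/funext => w; rewrite rc_weight /mono; ring.
apply.
- by apply: ccont_measurable; apply: entire_ccont; exact: fu.2.1.
- apply: cmeasurableM; last exact: cmeasurable_kerE.
  apply: ccont_measurable => w; have := wd_ccont (wd_mono 0 m w).
  by congr (ccont_at _ _); apply/funext => y; rewrite /mono expr0 mul1r.
- apply: egrowM; last exact: egrow_kerE.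
  by apply: egrowX; apply: egrow_conj; exact: egrow_id.
Qed.

Lemma egrow_expR (B : R) : egrow (fun w => rc (expR (B * cmod w))).
Proof. by exists 1, B => w; rewrite cmod_real mul1r ger0_norm ?expR_ge0. Qed.

Lemma cmeasurable_expR (B : R) : cmeasurable (fun w => rc (expR (B * cmod w))).
Proof.
apply: cmeasurable_real; apply: rmeasurable_expR; apply: rmeasurableM; first exact: rmeasurable_cst.
exact: rmeasurable_cmod_id.
Qed.

Lemma cintegrable_egrow_weight h : cmeasurable h -> egrow h ->
  cintegrable (fun w => h w * rc (weight m w)).
Proof.
move=> mh eh; rewrite (_ : (fun w => _) = fun w => h w * mono m m w * rc (gauss w)); last first.
  by apply/funext => w; rewrite rc_weight mulrA.
apply: cintegrable_egrow; first by apply: cmeasurableM => //; exact: cmeasurable_mono.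
by apply: egrowM => //; exact: egrow_mono.
Qed.

Lemma weight_ge0 w : 0 <= weight m w.
Proof. by rewrite /weight mulr_ge0 ?expR_ge0// exprn_ge0// cmod_ge0. Qed.

Lemma cmeasurable_weight : cmeasurable (fun w => rc (weight m w)).
Proof.
rewrite (_ : (fun w => _) = fun w => mono m m w * rc (gauss w)); last by apply/funext => w; rewrite rc_weight.
by apply: cmeasurableM; [exact: cmeasurable_mono|apply: cmeasurable_real; exact: rmeasurable_gauss].
Qed.

Lemma rintegrable_exp_weight (C B : R) : rintegrable (fun w => C * (expR (B * cmod w) * weight m w)).
Proof.
apply: rintegrableZ.
have := cintegrable_cmod (cintegrable_egrow_weight (cmeasurable_expR B) (egrow_expR B)).
congr rintegrable; apply/funext => w.
by rewrite cmodM !cmod_real !ger0_norm ?expR_ge0 ?weight_ge0.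
Qed.

(** The case u = 1 of the reproducing property, by termwise integration: $w^m \bar w^{m+k}$
    integrates to 0 unless k = 0. *)
Lemma cintegral_kerE z : cintegral (fun w => kerE (z * w^*) * rc (weight m w)) = rc (pi * m`!%:R).
Proof.
have ek := @egf_kap R m.
pose h_ n w := psum (kap R m) (z * w^*) n * rc (weight m w).
have mh n : cmeasurable (h_ n).
  apply: cmeasurableM; last exact: cmeasurable_weight.
  apply: cmeasurable_sum => k; apply: ccont_measurable => w.
  have := wd_ccont (wdM (wd_cst (kap R m k * z ^+ k) w) (wd_mono 0 k w)).
  by congr (ccont_at _ _); apply/funext => y; rewrite /mono expr0 mul1r exprMn mulrA.
have cv : ccvg (fun n => cintegral (h_ n)) (cintegral (fun w => kerE (z * w^*) * rc (weight m w))).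
  apply: (cintegral_dct mh _ _ (rintegrable_exp_weight 1 (cmod z))).
  - by apply: cmeasurableM; [exact: cmeasurable_kerE|exact: cmeasurable_weight].
  - by move=> w; apply: ccvgM (ccvg_cst _); exact: ps_cvg ek.
  - move=> n w; rewrite cmodM cmod_real (ger0_norm (weight_ge0 w)) mulrA ler_wpM2r ?weight_ge0//.
    by rewrite (le_trans (psum_bound _ n ek))// !mul1r cmodM cmod_conj.
apply: (ccvg_unique (ccvg_shift 1 cv)); apply: ccvg_ext (ccvg_cst _) => n.
rewrite /h_ /psum addn1.
have [ci E] := @cintegral_sum R _ (index_enum 'I_n.+1) xpredT
   (fun k w => (kap R m k * z ^+ k) * (mono m (m + k) w * rc (gauss w)))
   (fun k => cintegrableZ _ (cintegrable_mono _ _ _)).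
rewrite (_ : (fun w => _) = fun w => \sum_(k < n.+1) (kap R m k * z ^+ k) * (mono m (m + k) w * rc (gauss w))); last first.
  apply/funext => w; rewrite mulr_suml; apply: eq_bigr => k _.
  by rewrite rc_weight /mono exprD exprMn; ring.
rewrite E; under eq_bigr => k _ do rewrite (cintegralZ _ (cintegrable_mono _ _ _)) -/(moment R _ _) momentE.
rewrite big_ord_recl big1 ?addr0 => [|k _].
  by rewrite addn0 eqxx kap0 expr0 !mul1r.
by rewrite -[X in X == _]addn0 eqn_add2l/= mulr0.
Qed.

Hypothesis m_gt0 : (0 < m)%N.

(** By the case u = 1 the claim becomes that (u(z) - u(w)) K(z,w) times the weight integrates to 0.
    That function is the dbar-derivative of the difference quotient of u times psi, since the factor
    z - w produced by psi cancels the denominator. *)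
Lemma cintegral_reproducing u z : fock_sobolev m u ->
  cintegral (fun w => u w * kerE (z * w^*) * rc (weight m w)) = rc (pi * m`!%:R) * u z.
Proof.
move=> fu; have eu := fu.1.
have [a ha] := entire_wd eu z.
pose K w := kerE (z * w^*) * rc (weight m w).
have iu := cintegrable_kerE_weight z fu.
have iK : cintegrable K by apply: cintegrable_egrow_weight; [exact: cmeasurable_kerE|exact: egrow_kerE].
pose k w := (u z - u w) * kerE (z * w^*) * rc (weight m w).
have ik : cintegrable k.
  have := cintegrableB (cintegrableZ (u z) iK) iu; congr cintegrable.
  by apply/funext => w; rewrite /k /K; ring.
suff k0 : cintegral k = 0.
  have := cintegralB (cintegrableZ (u z) iK) iu.
  rewrite (cintegralZ _ iK) cintegral_kerE (_ : (fun w => _) = k); last first.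
    by apply/funext => w; rewrite /k /K; ring.
  by rewrite k0 => /esym/eqP; rewrite subr_eq0 mulrC => /eqP.
pose h w := diffquot u a z w * psi m z w.
have cpsi w : ccont_at (psi m z) w by have [A /wd_ccont] := wd_psi m_gt0 z w.
have ch w : ccont_at h w.
  apply: ccont_atM => //; have [->|wz] := eqVneq w z; first exact: ccont_diffquot.
  have [b hb] := entire_wd eu w.
  by have [A /wd_ccont] := wd_diffquot a hb wz.
have ck w : ccont_at k w.
  have [b hb] := entire_wd eu w.
  have := wd_ccont (wdM (wdM (wdD (wd_cst (u z) w) (wdM (wd_cst (-1) w) hb)) (wd_kerE_conj m z w))
     (wdM (wd_mono m m w) (wd_gauss w))).
  by congr (ccont_at _ _); apply/funext => y; rewrite /k rc_weight mulN1r.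
apply: (@stokes _ h k z) => //.
  move=> w wz; have [b hb] := entire_wd eu w.
  have [A hA] := wd_diffquot a hb wz; have [B hB] := wd_psi m_gt0 z w.
  eexists; apply: wd_eq (wdM hA hB) _ _ _ => //.
  rewrite /k /diffquot (negbTE wz); field.
  by rewrite subr_eq0.
(* Majorant of h. On the disc |w| <= |z| + 1 it is a constant, dominated by a multiple of the
   Gaussian ([i3]). Outside, |w - z| >= 1 removes the denominator and |w| >= 1 gives |u(w)| <= |w^m
   u(w)|, so [i1] and [i2] suffice. *)
have [M M0 HM] := ccont_bounded (cmod z + 1) ch.
pose phi w := mono m m w * kerE (z * w^*) + m`!%:R * expsum m w.
have mphi : cmeasurable phi.
  apply: cmeasurableD; first by apply: cmeasurableM; [exact: cmeasurable_mono|exact: cmeasurable_kerE].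
  apply: cmeasurableM; first exact: cmeasurable_cst.
  by apply: cmeasurable_sum => j; apply: cmeasurableM; [exact: cmeasurable_mono|exact: cmeasurable_cst].
have ephi : egrow phi.
  apply: egrowD; first by apply: egrowM; [exact: egrow_mono|exact: egrow_kerE].
  apply: egrowM; first exact: egrow_cst.
  rewrite /expsum; elim: m => [|n IH].
    by under eq_fun do rewrite big_ord0; exact: egrow_cst.
  under eq_fun do rewrite big_ord_recr/=; apply: egrowD => //.
  by apply: egrowM; [exact: egrow_mono|exact: egrow_cst].
have mv : cmeasurable (fun w => w ^+ m * u w) by apply: ccont_measurable; apply: entire_ccont; exact: fu.2.1.
have i1 := cintegrable_cmod (cintegrable_sqr_egrow mv (fock_sobolev_sqr fu) mphi ephi).
have i2 := rintegrableZ (cmod (u z)) (cintegrable_cmod (cintegrable_egrow mphi ephi)).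
have i3 := rintegrableZ (M * expR ((cmod z + 1) ^+ 2)) (rintegrable_expgauss 0).
apply: (cintegrable_dom _ (rintegrableD (rintegrableD i1 i2) i3)); first exact: ccont_measurable.
move=> w; have g0 := gauss_ge0 w.
have t1 : 0 <= cmod (w ^+ m * u w * phi w * rc (gauss w)) by exact: cmod_ge0.
have t2 : 0 <= cmod (u z) * cmod (phi w * rc (gauss w)) by rewrite mulr_ge0 ?cmod_ge0.
have t3 : 0 <= M * expR ((cmod z + 1) ^+ 2) * (expR (0 * cmod w) * gauss w).
  by rewrite !mulr_ge0 ?expR_ge0.
have [wr|wr] := leP (cmod w) (cmod z + 1).
  rewrite (le_trans (HM w wr))// -[leLHS]add0r lerD ?addr_ge0//.
  rewrite mul0r expR0 mul1r -mulrA -[leLHS]mulr1 ler_wpM2l// /gauss -expRD -[leLHS]expR0 ler_expR.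
  by rewrite subr_ge0 lerXn2r ?nnegrE ?addr_ge0 ?cmod_ge0.
have w1 : 1 <= cmod w by rewrite (le_trans _ (ltW wr))// lerDr cmod_ge0.
have wz1 : 1 <= cmod (w - z).
  have := cmodD (w - z) z; rewrite subrK => H.
  by move: (cmod w) (cmod z) (cmod (w - z)) H wr => x y t; lra.
have wz : w != z by rewrite -subr_eq0 -cmod_gt0 (lt_le_trans _ wz1).
rewrite -[leLHS]addr0 lerD//.
rewrite /h /diffquot (negbTE wz) /psi -/(phi w) -[X in _ <= cmod X + _]mulrA.
rewrite [leLHS]cmodM [X in _ <= X + _]cmodM -mulrDl ler_wpM2r ?cmod_ge0//.
rewrite [leLHS]cmodM cmodV cmodM cmodX.
have X : cmod (u w - u z) * (cmod (w - z))^-1 <= cmod (u w - u z).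
  by rewrite ler_piMr ?cmod_ge0// invf_le1// (lt_le_trans _ wz1).
rewrite (le_trans X)// (le_trans (cmodB _ _))// lerD2r ler_peMl ?cmod_ge0//.
by rewrite exprn_ege1.
Qed.

Lemma fock_proj_id u : fock_sobolev m u -> fock_proj m u = u.
Proof.
move=> fu; apply/funext => z; rewrite /fock_proj.
rewrite (_ : cintegral _ = rc (pi * m`!%:R) * u z); last exact: cintegral_reproducing.
rewrite mulKf// -(rmorph0 rc) (inj_eq (@complexI R)) mulf_neq0//.
by rewrite gt_eqF// pi_gt0.
Qed.

End Reproducing.

(** * The coefficient identity *)

Section Parseval.
Variables (R : realType) (m : nat).
Local Notation rc := (real_complex R).
Local Notation kap := (kap R m).
Local Notation kerE := (@kerE R m).
Implicit Types (A B F G : nat -> R[i]) (w z : R[i]).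

Definition pim : R[i] := rc (pi * m`!%:R).

Lemma pim_neq0 : pim != 0.
Proof.
rewrite /pim -(rmorph0 rc) (inj_eq (@complexI R)) mulf_neq0//.
by rewrite gt_eqF// pi_gt0.
Qed.

Lemma ccont_ps C D A : egf C D A -> forall w, ccont_at (ps A) w.
Proof. by move=> AB w; exact: wd_ccont (ps_wd w AB). Qed.

Lemma cmeasurable_ps C D A : egf C D A -> cmeasurable (ps A).
Proof. by move=> AB; apply: ccont_measurable; exact: ccont_ps AB. Qed.

Lemma cmeasurable_psum A n : cmeasurable (fun w => psum A w n).
Proof.
apply: cmeasurable_sum => k; apply: cmeasurableM; first exact: cmeasurable_cst.
by apply: ccont_measurable => w; exact: wd_ccont (wd_exp k w).
Qed.

Lemma cintegrable_mono_weight p q : cintegrable (fun w => mono p q w * rc (weight m w)).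
Proof. by apply: cintegrable_egrow_weight; [exact: cmeasurable_mono|exact: egrow_mono]. Qed.

Lemma cintegral_mono_weight p q : cintegral (fun w => mono p q w * rc (weight m w)) =
  if p == q then pim / kap p else 0.
Proof.
rewrite (_ : (fun w => _) = fun w => mono (m + p) (m + q) w * rc (gauss w)); last first.
  by apply/funext => w; rewrite rc_weight /mono !exprD; ring.
rewrite -/(moment R _ _) momentE eqn_add2l; case: ifP => // _.
rewrite /pim /kap !rmorphM !rmorph_nat [(m + p)%N]addnC; field.
by rewrite !natf_neq0.
Qed.

(** Dominated convergence on truncated series: monomials are orthogonal, and the normalised square
    norm of $w^k$ is 1 / [kap k]. *)
Lemma parseval C D A C' D' B : egf C D A -> egf C' D' B ->
  ccvg (fun n => \sum_(k < n) A k * (B k)^* / kap k)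
    (pim^-1 * cintegral (fun w => ps A w * (ps B w)^* * rc (weight m w))).
Proof.
move=> AB BB; have [D0 _] := AB; have [D'0 _] := BB.
pose h_ n w := psum A w n * (psum B w n)^* * rc (weight m w).
have cv : ccvg (fun n => cintegral (h_ n)) (cintegral (fun w => ps A w * (ps B w)^* * rc (weight m w))).
  apply: (cintegral_dct _ _ _ (rintegrable_exp_weight m (C * C') (D + D'))).
  - move=> n; apply: cmeasurableM; last exact: cmeasurable_weight.
    by apply: cmeasurableM; [|apply: cmeasurable_conj]; exact: cmeasurable_psum.
  - apply: cmeasurableM; last exact: cmeasurable_weight.
    by apply: cmeasurableM; [|apply: cmeasurable_conj]; [exact: cmeasurable_ps AB|exact: cmeasurable_ps BB].
  - move=> w; apply: ccvgM (ccvg_cst _).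
    by apply: ccvgM; [exact: ps_cvg AB|apply: ccvg_conj; exact: ps_cvg BB].
  - move=> n w; rewrite !cmodM cmod_conj cmod_real (ger0_norm (weight_ge0 _ _)) mulrA ler_wpM2r ?weight_ge0//.
    by rewrite mulrDl expRD mulrACA ler_pM ?cmod_ge0// psum_bound.
apply: ccvg_ext (ccvgM (ccvg_cst pim^-1) cv) => n; rewrite /h_.
have [ci E] := @cintegral_sum R _ (index_enum ('I_n * 'I_n)%type) xpredT
   (fun k w => (A k.1 * (B k.2)^*) * (mono k.1 k.2 w * rc (weight m w)))
   (fun k => cintegrableZ _ (cintegrable_mono_weight _ _)).
rewrite (_ : (fun w => _) = fun w => \sum_(k : 'I_n * 'I_n) (A k.1 * (B k.2)^*) * (mono k.1 k.2 w * rc (weight m w))); last first.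
  apply/funext => w; rewrite /psum rmorph_sum big_distrlr/= pair_big/= mulr_suml; apply: eq_bigr => k _.
  by rewrite /mono rmorphM rmorphXn; ring.
rewrite E -(pair_big xpredT xpredT (fun i j : 'I_n => cintegral (fun w => A i * (B j)^* * (mono i j w * rc (weight m w)))))/=.
rewrite mulr_sumr; apply: eq_bigr => i _.
rewrite (bigD1 i)//= big1 => [|j ji]; last first.
  rewrite (cintegralZ _ (cintegrable_mono_weight _ _)) cintegral_mono_weight.
  by rewrite ifN ?mulr0// eq_sym.
rewrite addr0 (cintegralZ _ (cintegrable_mono_weight _ _)) cintegral_mono_weight eqxx.
have := pim_neq0; have := kap_neq0 R m i; move: pim (kap i) => a b b0 a0; field.
by rewrite a0 b0.
Qed.

Definition delta (p k : nat) : R[i] := if k == p then 1 else 0.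

Lemma egf_delta p : egf p`!%:R 1 (delta p).
Proof.
split=> // k; rewrite /delta /exp_coeff/= expr1n mul1r; case: eqP => [->|_].
  by rewrite cmod1 divff// pnatr_eq0 -lt0n fact_gt0.
by rewrite cmod0 divr_ge0.
Qed.

Lemma ps_delta p w : ps (delta p) w = w ^+ p.
Proof.
apply: (ps_unique (egf_delta p)).
apply: (@ccvg_squeeze _ _ _ (fun n => (n <= p)%N%:R * cmod (w ^+ p))) => [n|].
  have [np|pn] := leqP n p.
    rewrite /psum big1 ?sub0r ?cmodN ?mul1r// => k _.
    by rewrite /delta ltn_eqF ?mul0r// (leq_trans (ltn_ord k)).
  rewrite /psum (bigD1 (Ordinal pn))//= big1 ?addr0 => [|k kp].
    by rewrite /delta eqxx mul1r subrr cmod0 mul0r.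
  by rewrite /delta ifN ?mul0r.
apply: cvg_near_cst; near=> n; rewrite leqNgt (_ : (p < n)%N) ?mul0r//; near: n.
exact: nbhs_infty_gt.
Unshelve. all: by end_near. Qed.

Definition shift (p : nat) F (k : nat) : R[i] := if (p <= k)%N then F (k - p)%N else 0.

Lemma cauchyprod_delta p F k : cauchyprod (delta p) F k = shift p F k.
Proof.
rewrite /cauchyprod /shift /delta; case: leqP => pk.
  rewrite (bigD1 (Ordinal (pk : p < k.+1)%N))//= eqxx mul1r big1 ?addr0// => j jp.
  by rewrite ifN ?mul0r.
by rewrite big1// => j _; rewrite ltn_eqF ?mul0r// (leq_trans _ pk)// ltn_ord.
Qed.

Lemma egf_shift C D F p : egf C D F -> egf (p`!%:R * C) (1 + D) (shift p F).
Proof.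
move=> FB; have := egfM (egf_delta p) FB; congr egf.
by apply/funext => k; rewrite cauchyprod_delta.
Qed.

Lemma ps_shift C D F p w : egf C D F -> ps (shift p F) w = w ^+ p * ps F w.
Proof.
move=> FB; rewrite -(ps_delta p w) -(psM w (egf_delta p) FB); congr (ps _ _).
by apply/funext => k; rewrite cauchyprod_delta.
Qed.

Lemma parseval_shift C D F C' D' G p q : egf C D F -> egf C' D' G ->
  ccvg (fun n => \sum_(k < n) shift p F k * (shift q G k)^* / kap k)
    (pim^-1 * cintegral (fun w => ps F w * (ps G w)^* * mono p q w * rc (weight m w))).
Proof.
move=> FB GB; have := parseval (egf_shift p FB) (egf_shift q GB).
rewrite (_ : (fun w => ps (shift p F) w * _ * _) = (fun w => ps F w * (ps G w)^* * mono p q w * rc (weight m w)))//.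
apply/funext => w; rewrite (ps_shift _ _ FB) (ps_shift _ _ GB) rmorphM rmorphXn /mono.
by ring.
Qed.

Lemma egf_scale C D F (y : R[i]) : egf C D F -> egf C (D * cmod y) (fun k => F k * y ^+ k).
Proof.
move=> [D0 FB]; split; first by rewrite mulr_ge0 ?cmod_ge0.
by move=> k; exact: egf_term.
Qed.

Lemma ps_scale C D F (x y : R[i]) : egf C D F -> ps F (x * y) = ps (fun k => F k * y ^+ k) x.
Proof.
move=> FB; apply/esym; apply: (ps_unique (egf_scale y FB)).
apply: ccvg_ext (ps_cvg (x * y) FB) => n; apply: eq_bigr => k _.
by rewrite exprMn; ring.
Qed.

(* Convergence to 0 is assumed only on the real line; boundedness of d, which
   replaces a radius of convergence, comes from t = 1. *)
Lemma real_series_eq0 (d : nat -> R[i]) :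
  (forall t : R, ccvg (fun n => \sum_(k < n) d k * rc t ^+ k) 0) -> forall n, d n = 0.
Proof.
move=> H.
have [M dM] : exists M : R, forall n, cmod (d n) <= M.
  have c1 := H 1; rewrite rmorph1 in c1.
  have : ccvg d 0.
    have := ccvgB (ccvg_shift 1 c1) c1; rewrite subrr; apply: ccvg_ext => n.
    by rewrite addn1 big_ord_recr/= expr1n mulr1 addrAC subrr add0r.
  rewrite /ccvg; under eq_fun do rewrite subr0.
  move=> c0; have /cvg_seq_bounded[M [_ HM]] : cvg ((fun n => cmod (d n)) @ \oo) by apply/cvg_ex; exists 0.
  exists (M + 1) => n; have := HM (M + 1); rewrite ltrDl => /(_ ltr01 n I).
  by rewrite /= ger0_norm ?cmod_ge0.
have M0 : 0 <= M by exact: le_trans (cmod_ge0 _) (dM 0%N).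
move=> n; elim/ltn_ind: n => n IH.
apply/eqP; rewrite -cmod_eq0; apply/eqP/le_anti; rewrite cmod_ge0 andbT.
(* With the earlier coefficients gone, dividing by t^n leaves a tail bounded by M (t + t^2 + ...) <=
   2 M t; then t tends to 0. *)
have key (t : R) : 0 < t -> t <= 1 / 2 -> cmod (d n) <= 2 * M * t.
  move=> t0 t1.
  have bnd N : cmod (\sum_(k < N + n.+1) d k * rc t ^+ k - d n * rc t ^+ n) <= 2 * M * t ^+ n.+1.
    rewrite addnC big_split_ord/= big_ord_recr/= big1 ?add0r => [|k _]; last by rewrite IH ?mul0r.
    rewrite addrAC subrr add0r (le_trans (cmod_sum _ _ _))//.
    apply: (@le_trans _ _ (\sum_(k < N) M * t ^+ n.+1 * t ^+ k)).
      apply: ler_sum => k _; rewrite cmodM cmodX cmod_real (gtr0_norm t0) -mulrA -exprD.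
      by rewrite ler_wpM2r// exprn_ge0// ltW.
    rewrite -mulr_sumr [leRHS](_ : _ = M * t ^+ n.+1 * 2); last by ring.
    rewrite ler_wpM2l ?mulr_ge0 ?exprn_ge0 ?(ltW t0)//.
    (* Sharper than the bound 2 so that it survives induction when t <= 1/2. *)
    have : \sum_(k < N) t ^+ k <= 2 * (1 - t ^+ N).
      elim: N => [|N IHN]; first by rewrite big_ord0 expr0 subrr mulr0.
      rewrite big_ord_recr/= exprS; have : 0 <= t ^+ N by rewrite exprn_ge0// ltW.
      by move: (t ^+ N) IHN => s IHN s0; nra.
    by have : 0 <= t ^+ N by [rewrite exprn_ge0// ltW]; move: (t ^+ N) => s; lra.
  have : cmod (0 - d n * rc t ^+ n) <= 2 * M * t ^+ n.+1.
    have cv := ccvgB (ccvg_shift n.+1 (H t)) (ccvg_cst (d n * rc t ^+ n)).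
    apply/ler_addgt0Pr => e e0.
    have /cvgrPdist_le/(_ _ e0)[N _ HN] := cv.
    have := HN N (leqnn _); rewrite /= sub0r normrN ger0_norm ?cmod_ge0// => h1.
    have h2 := bnd N.
    set a := 0 - _ in h1 *; set b := \sum_(k < N + n.+1) _ - _ in h1 h2.
    rewrite (_ : a = b - (b - a)); last by rewrite opprB addrC subrK.
    by rewrite (le_trans (cmodB _ _))// lerD.
  rewrite sub0r cmodN cmodM cmodX cmod_real (gtr0_norm t0) exprS mulrA ler_pM2r// exprn_gt0//.
apply/ler_addgt0Pr => e e0; rewrite add0r.
have K0 : 0 < 2 * M + 1 by rewrite ltr_wpDl// mulr_ge0.
have [a b] : 0 < Num.min (1 / 2) (e / (2 * M + 1)) /\ Num.min (1 / 2) (e / (2 * M + 1)) <= 1 / 2.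
  by rewrite lt_min divr_gt0// divr_gt0// ge_min lexx.
apply: (le_trans (key _ a b)).
apply: (@le_trans _ _ ((2 * M + 1) * Num.min (1 / 2) (e / (2 * M + 1)))).
  by rewrite ler_wpM2r ?(ltW a)// lerDl.
by rewrite mulrC -ler_pdivlMr// ge_min lexx orbT.
Qed.

(* The points 1 + k i have pairwise distinct conj(a) / a. *)
Lemma homogeneous_eq0 (c : nat -> R[i]) n :
  (forall a : R[i], \sum_(p < n.+1) c p * a^* ^+ p * a ^+ (n - p) = 0) ->
  forall p, (p <= n)%N -> c p = 0.
Proof.
move=> H.
(* Dividing the form by $a^n$ gives P at $\bar a / a$; its size is at most n + 1 and n + 1 distinct
   roots are exhibited. *)
pose P := \poly_(p < n.+1) c p.
suff P0 : P = 0.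
  move=> p pn; have := congr1 (fun Q : {poly R[i]} => Q`_p) P0.
  by rewrite coef_poly coef0 ltnS pn.
pose x k : R[i] := Complex 1 k%:R.
have x0 k : x k != 0 by rewrite -cmod_gt0 (lt_le_trans _ (Re_le_cmod _))//= normr1.
pose u k := (x k)^* / x k.
have ru k : root P (u k).
  rewrite rootE horner_poly; apply/eqP.
  have := H (x k); move/(congr1 (fun y => y / x k ^+ n)); rewrite mul0r mulr_suml => E.
  rewrite -[RHS]E; apply: eq_bigr => p _.
  have pn : (p <= n)%N by rewrite -ltnS.
  have -> : x k ^+ n = x k ^+ (n - p) * x k ^+ p by rewrite -exprD subnK.
  rewrite /u expr_div_n; field.
  by rewrite !expf_neq0.
have uI : injective u.
  move=> i j; rewrite /u => /eqP; rewrite eqr_div// => /eqP /(congr1 (@complex.Im R)).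
  rewrite !ImM !Im_conj !Re_conj /= !mul1r !mulr1 => E.
  have : i%:R = j%:R :> R by lra.
  by move/eqP; rewrite eqr_nat => /eqP.
apply: (@roots_geq_poly_eq0 _ _ (map u (iota 0 n.+1))).
- by apply/allP => _ /mapP[k _ ->]; exact: ru.
- by rewrite map_inj_uniq ?iota_uniq.
- by rewrite size_map size_iota size_poly.
Qed.

End Parseval.

(** * From the diagonal identity to Taylor coefficients *)

Section CoefficientIdentity.
Variables (R : realType) (m : nat).
Local Notation rc := (real_complex R).
Local Notation kap := (kap R m).
Local Notation kerE := (@kerE R m).
Local Notation pim := (pim R m).
Implicit Types (w z : R[i]).

Lemma conj_rc (t : R) : (rc t)^* = rc t.
Proof. by apply: complexP; rewrite ?Re_conj ?Im_conj//= oppr0. Qed.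

Definition kpow w (k : nat) : R[i] := kap k * w ^+ k.

Lemma egf_kpow w : egf 1 (1 * cmod w) (kpow w).
Proof. exact: egf_scale (egf_kap R m). Qed.

Lemma ps_kpow w z : ps (kpow w) z = kerE (z * w).
Proof. by rewrite /kerE (ps_scale z w (egf_kap R m)). Qed.

Lemma cmeasurable_kpow k : cmeasurable (fun w => kpow w k).
Proof.
apply: cmeasurableM; first exact: cmeasurable_cst.
by apply: ccont_measurable => w; exact: wd_ccont (wd_exp k w).
Qed.

Lemma egrow_kpow k : egrow (fun w => kpow w k).
Proof. by apply: egrowM; [exact: egrow_cst|apply: egrowX; exact: egrow_id]. Qed.

Lemma cmeasurable_kpow_conj k : cmeasurable (fun w => kpow w^* k).
Proof.
have := cmeasurable_conj (cmeasurable_kpow k); congr cmeasurable; apply/funext => w.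
by rewrite /kpow rmorphM rmorphXn /= conj_kap.
Qed.

Lemma egrow_kpow_conj k : egrow (fun w => kpow w^* k).
Proof. by apply: egrowM; [exact: egrow_cst|apply: egrowX; apply: egrow_conj; exact: egrow_id]. Qed.

Lemma egrow_sum (I : Type) (s : seq I) (P : pred I) (h : I -> R[i] -> R[i]) :
  (forall i, egrow (h i)) -> egrow (fun w => \sum_(i <- s | P i) h i w).
Proof.
move=> hh; elim: s => [|i s IH].
  by under eq_fun do rewrite big_nil; exact: egrow_cst.
rewrite (_ : (fun w => _) = fun w => (if P i then h i w else 0) + \sum_(j <- s | P j) h j w); last first.
  by apply/funext => w; rewrite big_cons; case: ifP => // _; rewrite add0r.
by apply: egrowD => //; case: (P i) => //; exact: egrow_cst.
Qed.

Variables (F G : nat -> R[i]) (CF BF CG BG : R).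
Hypotheses (FB : egf CF BF F) (GB : egf CG BG G).
Local Notation f := (ps F).
Local Notation g := (ps G).
Local Notation Gc := (fun k => (G k)^*).

(** The coefficient of $\bar z^p z^q$ in $(f(w)\overline{g(w)} -
    f(z)\overline{g(z)})\,K(w,z)K(z,w)$. *)
Definition defect p q w : R[i] :=
  f w * (g w)^* * kpow w p * kpow w^* q - cauchyprod (kpow w) Gc p * cauchyprod (kpow w^*) F q.

Lemma cintegrable_fg p q :
  cintegrable (fun w => f w * (g w)^* * kpow w p * kpow w^* q * rc (weight m w)).
Proof.
have mf := cmeasurable_ps FB; have mg := cmeasurable_conj (cmeasurable_ps GB).
have ef := egrow_ps FB; have eg := egrow_conj (egrow_ps GB).
apply: cintegrable_egrow_weight.
  by apply: cmeasurableM; [apply: cmeasurableM; [exact: cmeasurableM|exact: cmeasurable_kpow]|exact: cmeasurable_kpow_conj].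
by apply: egrowM; [apply: egrowM; [exact: egrowM|exact: egrow_kpow]|exact: egrow_kpow_conj].
Qed.

Lemma cintegrable_cauchy p q :
  cintegrable (fun w => cauchyprod (kpow w) Gc p * cauchyprod (kpow w^*) F q * rc (weight m w)).
Proof.
rewrite /cauchyprod; apply: cintegrable_egrow_weight.
  apply: cmeasurableM; apply: cmeasurable_sum => j; apply: cmeasurableM; try exact: cmeasurable_cst.
    exact: cmeasurable_kpow.
  exact: cmeasurable_kpow_conj.
apply: egrowM.
  apply: (@egrow_sum _ _ _ (fun (j : 'I_p.+1) w => kpow w j * (G (p - j)%N)^*)) => j.
  by apply: egrowM; [exact: egrow_kpow|exact: egrow_cst].
apply: (@egrow_sum _ _ _ (fun (j : 'I_q.+1) w => kpow w^* j * F (q - j)%N)) => j.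
by apply: egrowM; [exact: egrow_kpow_conj|exact: egrow_cst].
Qed.

Lemma cintegrable_defect p q : cintegrable (fun w => defect p q w * rc (weight m w)).
Proof.
have := cintegrableB (cintegrable_fg p q) (cintegrable_cauchy p q); congr cintegrable.
by apply/funext => w; rewrite /defect; ring.
Qed.

(** Only equal powers of w and conj(w) survive, which merges the two summation indices; q <= p makes
    0, ..., q their common range. *)
Lemma cintegral_cauchy p q : (q <= p)%N ->
  cintegral (fun w => cauchyprod (kpow w) Gc p * cauchyprod (kpow w^*) F q * rc (weight m w)) =
  pim * \sum_(l < q.+1) kap l * F (q - l)%N * (G (p - l)%N)^*.
Proof.
move=> qp.
pose c i j := kap i * Gc (p - i)%N * (kap j * F (q - j)%N).
have [ci E] := @cintegral_sum R _ (index_enum ('I_p.+1 * 'I_q.+1)%type) xpredT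
   (fun k w => c k.1 k.2 * (mono k.1 k.2 w * rc (weight m w)))
   (fun k => cintegrableZ _ (cintegrable_mono_weight _ _ _ _)).
rewrite (_ : (fun w => _) = fun w => \sum_(k : 'I_p.+1 * 'I_q.+1) c k.1 k.2 * (mono k.1 k.2 w * rc (weight m w))); last first.
  apply/funext => w; rewrite /cauchyprod big_distrlr/= pair_big/= mulr_suml; apply: eq_bigr => k _.
  by rewrite /c /kpow /mono; ring.
rewrite E -(pair_big xpredT xpredT (fun (i : 'I_p.+1) (j : 'I_q.+1) => cintegral (fun w => c i j * (mono i j w * rc (weight m w)))))/=.
rewrite exchange_big/= mulr_sumr; apply: eq_bigr => l _.
have lp : (l < p.+1)%N by rewrite (leq_trans (ltn_ord l)).
rewrite (bigD1 (Ordinal lp))//= big1 => [|j jl]; last first.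
  rewrite (cintegralZ _ (cintegrable_mono_weight _ _ _ _)) cintegral_mono_weight.
  by rewrite ifN ?mulr0//; apply: contra jl => /eqP jl; apply/eqP/val_inj.
rewrite addr0 (cintegralZ _ (cintegrable_mono_weight _ _ _ _)) cintegral_mono_weight eqxx /c.
have := kap_neq0 R m l; move: (kap l) => a a0; field.
by rewrite a0.
Qed.

(** The identity P(f conj(g) K_z)(z) = f(z) conj(g(z)) K(z,z), with its right side moved under the
    integral by means of P K_z = K_z. *)
Hypothesis diag : forall z, cintegral (fun w =>
  (f w * (g w)^* - f z * (g z)^*) * kerE (z * w^*) * kerE (w * z^*) * rc (weight m w)) = 0.

(* At z = t a the hypothesis is a power series in t whose coefficients are
   homogeneous polynomials in a and conj(a) with coefficients the integrals of the
   defects. *)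
Lemma cintegral_defect p q : cintegral (fun w => defect p q w * rc (weight m w)) = 0.
Proof.
pose D p q := cintegral (fun w => defect p q w * rc (weight m w)).
rewrite -/(D p q).
suff H n : forall k, (k <= n)%N -> D k (n - k)%N = 0.
  by have := H (p + q)%N p (leq_addr _ _); rewrite addKn.
apply: homogeneous_eq0 => a.
pose d k := \sum_(j < k.+1) D j (k - j)%N * a^* ^+ j * a ^+ (k - j).
apply: (@real_series_eq0 _ d _ n) => t.
pose A1 w k := kpow w k * a^* ^+ k; pose B1 w k := kpow w^* k * a ^+ k.
pose A2 w k := cauchyprod (kpow w) Gc k * a^* ^+ k; pose B2 w k := cauchyprod (kpow w^*) F k * a ^+ k.
have eA1 w : egf 1 (1 * cmod w * cmod a) (A1 w) by rewrite -(cmod_conj a); exact: egf_scale (egf_kpow w).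
have eB1 w : egf 1 (1 * cmod w * cmod a) (B1 w) by rewrite -(cmod_conj w); exact: egf_scale (egf_kpow w^*).
have eA2 w : egf (1 * CG) ((1 * cmod w + BG) * cmod a) (A2 w).
  by rewrite -(cmod_conj a); apply: egf_scale; apply: egfM (egf_kpow w) _; exact: egf_conj.
have eB2 w : egf (1 * CF) ((1 * cmod w + BF) * cmod a) (B2 w).
  by apply: egf_scale; rewrite -(cmod_conj w); apply: egfM (egf_kpow w^*) FB.
(* Truncation in total degree makes the integrand a finite combination of defects, so its integral
   is exactly a partial sum of the series in t; the limit of these integrals is [diag] at z = t
   a. *)
pose h_ N w := (f w * (g w)^* * psum (cauchyprod (A1 w) (B1 w)) (rc t) N -
  psum (cauchyprod (A2 w) (B2 w)) (rc t) N) * rc (weight m w).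
have hE N : h_ N = fun w => \sum_(k < N) \sum_(j < k.+1) (a^* ^+ j * a ^+ (k - j) * rc t ^+ k) * (defect j (k - j) w * rc (weight m w)).
  apply/funext => w; rewrite /h_ /psum mulr_sumr -sumrB mulr_suml; apply: eq_bigr => k _.
  rewrite /cauchyprod !mulr_suml mulr_sumr -sumrB mulr_suml; apply: eq_bigr => j _.
  by rewrite /defect /A1 /B1 /A2 /B2; ring.
have ih k (j : nat) : cintegrable (fun w => (a^* ^+ j * a ^+ (k - j) * rc t ^+ k) * (defect j (k - j) w * rc (weight m w))).
  by apply: cintegrableZ; exact: cintegrable_defect.
have ih2 k := @cintegral_sum R _ (index_enum 'I_k.+1) xpredT (fun j w => (a^* ^+ j * a ^+ (k - j) * rc t ^+ k) * (defect j (k - j) w * rc (weight m w)))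
  (fun j => ih k j).
have ih3 N := @cintegral_sum R _ (index_enum 'I_N) xpredT (fun k w => \sum_(j < k.+1) (a^* ^+ j * a ^+ (k - j) * rc t ^+ k) * (defect j (k - j) w * rc (weight m w)))
  (fun k => (ih2 k).1).
have -> : (fun N => \sum_(k < N) d k * rc t ^+ k) = fun N => cintegral (h_ N).
  apply/funext => N; rewrite hE (ih3 N).2; apply: eq_bigr => k _.
  rewrite (ih2 k).2 mulr_suml; apply: eq_bigr => j _.
  by rewrite (cintegralZ _ (cintegrable_defect _ _)) -/(D _ _); ring.
pose z := rc t * a.
have zc : z^* = rc t * a^* by rewrite rmorphM /= conj_rc.
rewrite -[X in ccvg _ X](diag z).
have CF0 := egf_ge0 FB; have CG0 := egf_ge0 GB; have BF0 := FB.1; have BG0 := GB.1.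
pose L := cmod a * `|t|.
have L0 : 0 <= L by rewrite mulr_ge0 ?cmod_ge0.
have mh N : cmeasurable (h_ N) by rewrite hE; exact: (ih3 N).1.1.
have ch w : ccvg (h_ ^~ w) ((f w * (g w)^* - f z * (g z)^*) * kerE (z * w^*) * kerE (w * z^*) * rc (weight m w)).
  have c1 := ps_cvg (rc t) (egfM (eA1 w) (eB1 w)); have c2 := ps_cvg (rc t) (egfM (eA2 w) (eB2 w)).
  have := ccvgM (ccvgB (ccvgM (ccvg_cst (f w * (g w)^*)) c1) c2) (ccvg_cst (rc (weight m w))).
  congr (ccvg _ _); congr (_ * _).
  rewrite (psM _ (eA1 w) (eB1 w)) (psM _ (eA2 w) (eB2 w)).
  rewrite -!(ps_scale _ _ (egf_kpow _)) -(ps_scale _ _ (egfM (egf_kpow w) (egf_conj GB))) -(ps_scale _ _ (egfM (egf_kpow w^*) FB)).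
  rewrite -zc -/z (psM _ (egf_kpow w) (egf_conj GB)) (psM _ (egf_kpow w^*) FB) !ps_kpow (conj_ps z GB).
  rewrite [z^* * w]mulrC.
  move: (kerE (w * z^*)) (kerE (z * w^*)) (ps F w) (ps G w)^* (ps F z) (ps Gc z^*) (rc (weight m w)) => k1 k2 a' b c e W.
  by clear; ring.
(* In the majorant, 2 L comes from the two kernel factors. The summand 1 covers f(w) conj(g(w)), and
   the summand expR ((BF + BG) * L) covers the partial sums that stand for f(z) conj(g(z)). *)
apply: (cintegral_dct mh _ ch (rintegrable_exp_weight m (CF * CG * (1 + expR ((BF + BG) * L))) (BF + BG + 2 * L))).
  exact: cmeasurable_lim mh ch.
move=> N w; rewrite cmodM cmod_real (ger0_norm (weight_ge0 _ _)) mulrA ler_wpM2r ?weight_ge0//.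
rewrite (le_trans (cmodB _ _))// cmodM cmodM cmod_conj.
have b1 := psum_bound (rc t) N (egfM (eA1 w) (eB1 w)); have b2 := psum_bound (rc t) N (egfM (eA2 w) (eB2 w)).
have bf := ps_bound w FB; have bg := ps_bound w GB.
have w0 := cmod_ge0 w.
rewrite mulrDr mulr1 mulrDl lerD//.
  apply: (@le_trans _ _ (CF * expR (BF * cmod w) * (CG * expR (BG * cmod w)) * (1 * 1 * expR (2 * L * cmod w)))).
    rewrite ler_pM ?mulr_ge0 ?cmod_ge0//; first by rewrite ler_pM ?cmod_ge0.
    apply: (le_trans b1); rewrite cmod_real /L; apply: eqW; congr (_ * expR _); ring.
  rewrite !mulrDl !expRD; apply: eqW; ring.
apply: (le_trans b2).
apply: (@le_trans _ _ (CF * CG * (expR ((BF + BG) * L) * expR (2 * L * cmod w)))).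
  rewrite -expRD cmod_real /L; apply: eqW.
  rewrite !mul1r [CG * CF]mulrC; congr (_ * expR _); ring.
rewrite -!mulrA ler_wpM2l// ler_wpM2l// ler_wpM2l ?expR_ge0// ler_expR.
rewrite -subr_ge0 (_ : _ - _ = (BF + BG) * cmod w); last by rewrite /L; ring.
by rewrite mulr_ge0// addr_ge0.
Qed.

Lemma coefficient_identity p q : (q <= p)%N ->
  kap p * kap q * (pim^-1 * cintegral (fun w => f w * (g w)^* * mono p q w * rc (weight m w))) =
  \sum_(l < q.+1) kap l * F (q - l)%N * (G (p - l)%N)^*.
Proof.
move=> qp; have := cintegralB (cintegrable_fg p q) (cintegrable_cauchy p q).
rewrite (_ : (fun w => _ - _) = fun w => defect p q w * rc (weight m w)); last first.
  by apply/funext => w; rewrite /defect; ring.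
rewrite cintegral_defect cintegral_cauchy// => /esym/eqP; rewrite subr_eq0 => /eqP E.
have im : cintegrable (fun w => f w * (g w)^* * mono p q w * rc (weight m w)).
  apply: cintegrable_egrow_weight.
    by apply: cmeasurableM; [apply: cmeasurableM; [exact: cmeasurable_ps FB|apply: cmeasurable_conj; exact: cmeasurable_ps GB]|exact: cmeasurable_mono].
  by apply: egrowM; [apply: egrowM; [exact: egrow_ps FB|apply: egrow_conj; exact: egrow_ps GB]|exact: egrow_mono].
rewrite mulrCA -(cintegralZ _ im) (_ : (fun w => _) = fun w => f w * (g w)^* * kpow w p * kpow w^* q * rc (weight m w)); last first.
  by apply/funext => w; rewrite /kpow /mono; ring.
by rewrite E mulKf// pim_neq0.
Qed.

End CoefficientIdentity.

(** * Exponential polynomials *)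

Section ExponentialPolynomials.
Variable K : numFieldType.
Implicit Types (S : seq K) (P : K -> {poly K}).

Lemma poly_nat_roots_eq0 (p : {poly K}) : (forall n : nat, p.[n.+1%:R] = 0) -> p = 0.
Proof.
move=> H; apply: (@roots_geq_poly_eq0 _ _ (map (fun n => n.+1%:R) (iota 0 (size p)))).
- by apply/allP => _ /mapP[k _ ->]; rewrite rootE H.
- rewrite map_inj_uniq ?iota_uniq// => i j /eqP.
  by rewrite eqr_nat eqSS => /eqP.
- by rewrite size_map size_iota.
Qed.

(* Induction on the total size: Q is the shift of P by one minus s0 P, and its
   size drops at s0. *)
Lemma exp_poly_independent S P : uniq S -> 0 \notin S ->
  (forall n : nat, \sum_(s <- S) (P s).[n%:R] * s ^+ n = 0) -> forall s, s \in S -> P s = 0.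
Proof.
move=> uS S0.
have [N] := ubnP (\sum_(s <- S) size (P s)); elim: N P => // N IH P PN H.
case: (altP (@allP _ (fun s => P s == 0) S)) => [h s sS|]; first exact/eqP/h.
move=> /allPn[s0 s0S P0].
pose Q s := s *: (P s \Po ('X + 1%:P)) - s0 *: P s.
have sz_comp s : size (P s \Po ('X + 1%:P)) = size (P s).
  by rewrite size_comp_poly2// size_XaddC.
have lc_comp s : lead_coef (P s \Po ('X + 1%:P)) = lead_coef (P s).
  by rewrite lead_coef_comp ?size_XaddC// lead_coefXaddC expr1n mulr1.
have szQ s : (size (Q s) <= size (P s))%N.
  rewrite (leq_trans (size_polyD _ _))// geq_max size_polyN.
  by rewrite (leq_trans (size_scale_leq _ _))/= ?sz_comp// size_scale_leq.
have cQ s : (Q s)`_(size (P s)).-1 = (s - s0) * lead_coef (P s).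
  by rewrite coefB !coefZ -{1}(sz_comp s) -/(lead_coef _) lc_comp mulrBl.
have szQ0 : (size (Q s0) < size (P s0))%N.
  rewrite -size_poly_gt0 in P0; rewrite -(prednK P0) ltnS.
  apply/leq_sizeP => j; rewrite leq_eqVlt => /orP[/eqP <-|]; first by rewrite cQ subrr mul0r.
  by rewrite prednK// => jj; rewrite nth_default// (leq_trans (szQ s0)).
have QN : (\sum_(s <- S) size (Q s) < N)%N.
  rewrite -ltnS (leq_trans _ PN)// ltnS (bigD1_seq s0)//= [leqRHS](bigD1_seq s0)//=.
  by rewrite -addSn leq_add// leq_sum.
have Q0 := IH Q QN.
have {}Q0 s : s \in S -> Q s = 0.
  apply: Q0 => n.
  have := H n.+1; have := congr1 (fun x => s0 * x) (H n); rewrite mulr0 => h1 h2.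
  transitivity (\sum_(x <- S) (P x).[n.+1%:R] * x ^+ n.+1 - s0 * \sum_(x <- S) (P x).[n%:R] * x ^+ n).
    rewrite mulr_sumr -sumrB; apply: eq_bigr => x _.
    by rewrite /Q hornerD hornerN !hornerZ horner_comp hornerD hornerX hornerC natr1 exprS; ring.
  by rewrite h2 h1 subrr.
have Pother s : s \in S -> s != s0 -> P s = 0.
  move=> sS ss0; have := cQ s; rewrite Q0// coef0 => /esym/eqP.
  by rewrite mulf_eq0 subr_eq0 (negbTE ss0)/= lead_coef_eq0 => /eqP.
case/eqP: P0; apply: poly_nat_roots_eq0 => n.
have := H n.+1; rewrite (bigD1_seq s0)//= big1_seq ?addr0 => [|s /andP[ss0 sS]].
  move/eqP; rewrite mulf_eq0 expf_eq0/= => /orP[/eqP//|/eqP s00].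
  by case/negP: S0; rewrite -s00.
by rewrite Pother// horner0 mul0r.
Qed.

Lemma sum_group (I : finType) (x : I -> K) (V : zmodType) (E : I -> V) :
  \sum_i E i = \sum_(s <- undup [seq x i | i : I]) \sum_(i | x i == s) E i.
Proof.
rewrite (exchange_big_dep xpredT)//=; apply: eq_bigr => i _.
have xS : x i \in undup [seq x i | i : I].
  by rewrite mem_undup; apply/mapP; exists i => //; rewrite mem_enum.
rewrite big_mkcond (bigD1_seq (x i))/= ?undup_uniq// eqxx big1 ?addr0// => s.
by rewrite eq_sym => /negbTE ->.
Qed.

(** Nodes may coincide or vanish. Grouping replaces the weights by their totals, and passing from n
    to n + 1 removes the zero node, which would be felt at n = 0. Zeros at all n + 1 still force the
    polynomial to be 0. *)
Lemma exp_poly_nodes (N : nat) (x c : 'I_N -> K) P :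
  (forall n : nat, \sum_i c i * (P (x i)).[n%:R] * x i ^+ n = 0) ->
  forall x0, x0 != 0 -> \sum_(i | x i == x0) c i != 0 -> P x0 = 0.
Proof.
move=> H x0 x00 cx0.
pose S := undup [seq x i | i : 'I_N]; pose beta s := \sum_(i | x i == s) c i.
pose S' := [seq s <- S | s != 0].
pose Q s := (beta s * s) *: (P s \Po ('X + 1%:P)).
have HS n : \sum_(s <- S') (Q s).[n%:R] * s ^+ n = 0.
  have := H n.+1; rewrite (sum_group x) -/S => E.
  rewrite big_filter -[RHS]E [RHS](bigID (fun s => s != 0))/= [X in _ = _ + X]big1 ?addr0; last first.
    move=> s /negPn/eqP ->; rewrite big1// => i /eqP ->.
    by rewrite exprS mul0r mulr0.
  apply: eq_bigr => s s0.
  rewrite (eq_bigr (fun i => c i * ((P s).[n.+1%:R] * s ^+ n.+1))) => [|i /eqP ->]; last by rewrite mulrA.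
  rewrite -mulr_suml -/(beta s) /Q hornerZ horner_comp hornerD hornerX hornerC natr1 exprS.
  by ring.
have x0S : x0 \in S'.
  rewrite mem_filter x00 mem_undup; apply: contraNT cx0 => nx.
  rewrite big1// => i /eqP xi; case/negP: nx; apply/mapP; exists i => //.
  by rewrite mem_enum.
have Q0 : Q x0 = 0.
  apply: (exp_poly_independent _ _ HS) x0S; first by rewrite filter_uniq ?undup_uniq.
  by rewrite mem_filter eqxx.
apply: poly_nat_roots_eq0 => n; have := congr1 (fun p => p.[n%:R]) Q0.
rewrite /Q hornerZ horner_comp hornerD hornerX hornerC natr1 horner0 => /eqP.
by rewrite mulf_eq0 mulf_eq0 (negbTE x00) (negbTE cx0)/= => /eqP.
Qed.

(** The falling factorial $(X+a)(X+a-1)\cdots(X+a-j+1)$. *)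
Definition ffp (a : K) j : {poly K} := \prod_(i < j) ('X + (a - i%:R)%:P).

Lemma ffp_nat (n a j : nat) : (ffp a%:R j).[n%:R] = ((n + a) ^_ j)%:R.
Proof.
elim: j => [|j IH]; first by rewrite /ffp big_ord0 hornerC ffactn0.
rewrite /ffp big_ord_recr/= hornerM -/(ffp a%:R j) IH ffactnSr natrM hornerD hornerX hornerC.
have [jn|nj] := leqP j (n + a); last by rewrite ffact_small// !mul0r.
by rewrite natrB// natrD addrA.
Qed.

Lemma ffp_at0 a j : (ffp a j).[- a] = (j == 0%N)%:R.
Proof.
rewrite /ffp horner_prod; case: j => [|j]; first by rewrite big_ord0.
by rewrite big_ord_recl/= hornerD hornerX hornerC subr0 addNr mul0r.
Qed.

Lemma ffp_at1 a j : (ffp a j).[1 - a] = (j < 2)%N%:R.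
Proof.
rewrite /ffp horner_prod; case: j => [|[|j]]; first by rewrite big_ord0.
  by rewrite big_ord1 hornerD hornerX hornerC subr0 subrK.
by rewrite 2!big_ord_recl/= [X in _ * (X * _)]hornerD hornerX hornerC addrA subrK subrr mul0r mulr0.
Qed.

End ExponentialPolynomials.

(** Vandermonde's identity multiplied by q!. *)
Lemma ffact_addn a b q : ((a + b) ^_ q = \sum_(j < q.+1) 'C(q, j) * (a ^_ j * b ^_ (q - j)))%N.
Proof.
rewrite -bin_ffact -binomial.Vandermonde big_distrl/=; apply: eq_bigr => j _.
have jq : (j <= q)%N by rewrite -ltnS.
by rewrite -(bin_fact jq) -!bin_ffact; ring.
Qed.

(** * The coefficient identity as exponential polynomials in n *)

Section Nodes.
Variables (R : realType) (m : nat).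
Local Notation rc := (real_complex R).
Local Notation kap := (kap R m).

(** This turns quotients of kernel coefficients into polynomials in the index, so that with q fixed
    the coefficient identity becomes an exponential polynomial in n. *)
Lemma kap_ratio k q : kap k / kap (k + q) = ((k + q + m) ^_ q)%:R.
Proof.
have le : (q <= k + q + m)%N by rewrite -addnA addnCA leq_addr.
have := ffact_fact le; rewrite (_ : k + q + m - q = k + m)%N; last by rewrite addnAC addnK.
move/(congr1 (fun n => n%:R : R[i])); rewrite natrM => E.
rewrite /kap -E; have := natf_neq0 R (k + m); have := natf_neq0 R m; have := natf_neq0 R (k + q + m).
rewrite -E mulf_eq0 negb_or => /andP[a b] c d; field.
by rewrite a c d.
Qed.

Variables (F : nat -> R[i]) (CF BF : R).
Hypothesis FB : egf CF BF F.

(** This is $x^r f^{(r)}(x)$, where f has the Taylor coefficients [F]. *)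
Definition phi r x := ps (fun t => F t * (t ^_ r)%:R) x.

(** A falling factorial is r! times a binomial coefficient, which is at most 2^t; doubling the type
    absorbs it. *)
Lemma egf_phi r : egf (r`!%:R * CF) (2 * BF) (fun t => F t * (t ^_ r)%:R).
Proof.
have [B0 FB'] := FB; split; first by rewrite mulr_ge0.
move=> t; rewrite cmodM cmod_nat.
have h : (t ^_ r)%:R <= r`!%:R * 2 ^+ t :> R.
  rewrite -natrX -natrM ler_nat -bin_ffact mulnC leq_mul2l; apply/orP; right.
  rewrite -[2%N]/(1 + 1)%N expnDn; have [rt|rt] := leqP r t; last by rewrite bin_small.
  by rewrite (bigD1 (Ordinal (rt : r < t.+1)%N))//= !exp1n !muln1 leq_addr.
rewrite (le_trans (ler_pM (cmod_ge0 _) _ (FB' t) h))//.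
by rewrite /exp_coeff/= exprMn; apply: eqW; ring.
Qed.

Variables (N : nat) (b nu : 'I_N -> R[i]).
Let G k : R[i] := kap k * \sum_i b i * (nu i)^* ^+ k.

(** The inner product of $w^p f$ and $w^q g$ enters only as the limit of its Parseval series, which
    keeps the argument free of integrals from here on. *)
Hypothesis coef_id : forall p q, (q <= p)%N -> exists2 L,
  ccvg (fun n => \sum_(k < n) shift p F k * (shift q G k)^* / kap k) L &
  kap p * kap q * L = \sum_(l < q.+1) kap l * F (q - l)%N * (G (p - l)%N)^*.

Lemma conj_G k : (G k)^* = kap k * \sum_i (b i)^* * nu i ^+ k.
Proof.
rewrite /G rmorphM /= conj_kap rmorph_sum; congr (_ * _); apply: eq_bigr => i _.
by rewrite rmorphM rmorphXn /= conjCK.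
Qed.

(* The polynomial in n multiplying nu^n at the node x when the coefficient
   identity for (n + q, q) is divided by kap (n + q), see [kap_ratio]; in the
   variable n + q + m it is written in the basis of falling factorials. *)
Definition node_poly q x : {poly R[i]} :=
  \sum_(j < q.+1) (kap q * 'C(q, j)%:R * phi (q - j) x - kap j * F (q - j)%N * x ^+ (q - j)) *: ffp (q + m)%:R j.

Lemma node_poly_sum q n : \sum_i (b i)^* * (node_poly q (nu i)).[n%:R] * nu i ^+ n = 0.
Proof.
have [L cL EL] := coef_id (leq_addl n q).
(* The Parseval series starts at index n + q. Its k-th term from there carries the ratio
   [kap (k + n) / kap (k + n + q)], a falling factorial of (n + q + m) + k; Vandermonde separates k
   from n, and the sums over k become [phi]. *)
have E1 : L = \sum_i (b i)^* * nu i ^+ n * \sum_(j < q.+1) 'C(q, j)%:R * ((n + q + m) ^_ j)%:R * phi (q - j) (nu i).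
  apply: (ccvg_unique (ccvg_shift (n + q) cL)).
  have csum (I : Type) (s : seq I) (u : I -> nat -> R[i]) (l : I -> R[i]) :
      (forall i, ccvg (u i) (l i)) -> ccvg (fun t => \sum_(i <- s) u i t) (\sum_(i <- s) l i).
    move=> ul; elim: s => [|i s IH].
      by rewrite big_nil; apply: ccvg_ext (ccvg_cst 0) => t; rewrite big_nil.
    by rewrite big_cons; apply: ccvg_ext (ccvgD (ul i) IH) => t; rewrite big_cons.
  pose u i t := (b i)^* * nu i ^+ n * \sum_(j < q.+1) 'C(q, j)%:R * ((n + q + m) ^_ j)%:R *
    psum (fun t => F t * (t ^_ (q - j))%:R) (nu i) t.
  have cu i : ccvg (u i) ((b i)^* * nu i ^+ n * \sum_(j < q.+1) 'C(q, j)%:R * ((n + q + m) ^_ j)%:R * phi (q - j) (nu i)).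
    apply: ccvgM (ccvg_cst _) _; apply: csum => j; apply: ccvgM (ccvg_cst _) _.
    exact: ps_cvg (egf_phi _).
  apply: ccvg_ext (csum _ _ _ _ cu) => t.
  apply/esym; rewrite [in LHS]addnC [LHS]big_split_ord/= [X in X + _]big1 ?add0r => [|k _]; last first.
    by rewrite /shift leqNgt ltn_ord/= mul0r mul0r.
  transitivity (\sum_(k < t) \sum_i \sum_(j < q.+1) (b i)^* * nu i ^+ n *
      ('C(q, j)%:R * ((n + q + m) ^_ j)%:R * (F k * (k ^_ (q - j))%:R * nu i ^+ k))).
    apply: eq_bigr => k _.
    rewrite /shift leq_addr addKn (leq_trans (leq_addl n q) (leq_addr k _)).
    rewrite (_ : n + q + k - q = k + n)%N; last by lia.
    rewrite conj_G (_ : n + q + k = k + n + q)%N; last by lia.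
    rewrite mulrA mulr_sumr mulr_suml; apply: eq_bigr => i _.
    transitivity ((b i)^* * nu i ^+ n * nu i ^+ k * F k * (kap (k + n) / kap (k + n + q))).
      by rewrite exprD; ring.
    rewrite kap_ratio (_ : k + n + q + m = (n + q + m) + k)%N; last by lia.
    rewrite ffact_addn natr_sum mulr_sumr; apply: eq_bigr => j _.
    by rewrite !natrM; ring.
  rewrite exchange_big/=; apply: eq_bigr => i _.
  rewrite /u exchange_big/= mulr_sumr; apply: eq_bigr => j _.
  by rewrite /psum !mulr_sumr.
have kp := kap_neq0 R m (n + q).
(* The same number from the right side of the coefficient identity, divided by [kap (n + q)]. *)
have E2 : kap q * L = \sum_i (b i)^* * nu i ^+ n * \sum_(l < q.+1) kap l * F (q - l)%N * ((n + q + m) ^_ l)%:R * nu i ^+ (q - l).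
  apply: (mulfI kp); rewrite mulrA EL mulr_sumr.
  under [RHS]eq_bigr do rewrite mulr_sumr mulr_sumr.
  rewrite exchange_big/=; apply: eq_bigr => l _.
  have lq : (l <= q)%N by rewrite -ltnS.
  rewrite conj_G mulrA mulr_sumr; apply: eq_bigr => i _.
  have -> : (n + q - l = n + (q - l))%N by rewrite addnBA.
  have := kap_ratio (n + (q - l)) l; rewrite -addnA subnK// => <-.
  by rewrite exprD; move: kp; move: (kap (n + q)) => a a0; field.
rewrite -[RHS](subrr (kap q * L)) {1}E1 E2 mulr_sumr -sumrB; apply: eq_bigr => i _.
rewrite /node_poly horner_sum !mulr_sumr mulr_suml -sumrB; apply: eq_bigr => j _.
by rewrite hornerZ ffp_nat addnA; ring.
Qed.

Hypothesis m_gt0 : (0 < m)%N.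

Lemma coefficients_const : (forall r, (0 < r)%N -> F r = 0) \/ (forall k, (0 < k)%N -> G k = 0).
Proof.
have [[x0 [x00 bx0]]|none] := pselect (exists x0, x0 != 0 /\ \sum_(i | nu i == x0) (b i)^* != 0).
  left => r r0.
  have P0 q : node_poly q x0 = 0.
    exact: (exp_poly_nodes (node_poly_sum q)) x00 bx0.
  (* Evaluation at -(q + m): only the term j = 0 survives. *)
  have H1 q : kap q * phi q x0 = F q * x0 ^+ q.
    have := congr1 (fun p : {poly R[i]} => p.[- (q + m)%:R]) (P0 q).
    rewrite horner0 /node_poly horner_sum big_ord_recl big1 ?addr0 => [|j _].
      by rewrite hornerZ ffp_at0 eqxx mulr1 [X in kap q * X%:R](_ : _ = 1%N) ?bin0// mulr1 subn0 kap0 mul1r => /eqP; rewrite subr_eq0 => /eqP.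
    by rewrite hornerZ ffp_at0 mulr0.
  (* Evaluation at 1 - (r + 1 + m): the terms j = 0 and j = 1 survive, and the first is zero by
     [H1]. *)
  have H2 : kap r.+1 * r.+1%:R * phi r x0 = kap 1 * F r * x0 ^+ r.
    have := congr1 (fun p : {poly R[i]} => p.[1 - (r.+1 + m)%:R]) (P0 r.+1).
    rewrite horner0 /node_poly horner_sum 2!big_ord_recl big1 ?addr0 => [|j _].
      rewrite !hornerZ !ffp_at1.
      have -> : (lift ord0 (ord0 : 'I_r.+1) : nat) = 1%N by [].
      have -> : ((ord0 : 'I_r.+2) : nat) = 0%N by [].
      rewrite bin0 bin1 !mulr1 subn0 subn1 kap0 mul1r H1 subrr add0r.
      by move/eqP; rewrite subr_eq0 => /eqP.
    by rewrite hornerZ ffp_at1 /= mulr0.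
  have H1r := H1 r.
  have k1 := kapS R m 0; rewrite kap0 in k1.
  have kr := kapS R m r.
  have kr0 := kap_neq0 R m r.
  (* Eliminating [phi r x0] multiplies F_r x0^r by (1 + m)(r + 1) on one side and by r + 1 + m on
     the other; the difference of these factors is r m. *)
  have Fr : F r * x0 ^+ r * (r%:R * m%:R) = 0.
    have e1 : (r.+1 + m)%:R != 0 :> R[i] by rewrite pnatr_eq0.
    have e2 : (1 + m)%:R != 0 :> R[i] by rewrite pnatr_eq0.
    have a1 : r.+1%:R * (F r * x0 ^+ r) = (r.+1 + m)%:R * kap 1 * (F r * x0 ^+ r).
      apply: (mulfI kr0); rewrite -{1}H1r.
      transitivity ((r.+1 + m)%:R * kap r.+1 * (r.+1%:R * (kap r * phi r x0))); first by rewrite kr; ring.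
      transitivity ((r.+1 + m)%:R * kap r * (kap r.+1 * r.+1%:R * phi r x0)); first by ring.
      by rewrite H2; ring.
    have a2 : (1 + m)%:R * (r.+1%:R * (F r * x0 ^+ r)) = (r.+1 + m)%:R * (F r * x0 ^+ r).
      by rewrite a1; transitivity ((r.+1 + m)%:R * ((1 + m)%:R * kap 1) * (F r * x0 ^+ r)); [ring|rewrite k1 mulr1].
    move/eqP: a2; rewrite -subr_eq0 => /eqP a2; rewrite -[RHS]a2 !natrD -!natr1; ring.
  move/eqP: Fr; rewrite !mulf_eq0 expf_eq0 (negbTE x00) andbF !pnatr_eq0.
  by rewrite gtn_eqF// gtn_eqF// !orbF => /eqP.
(* Here every nonzero node has total weight zero, and a zero node contributes nothing to a positive
   power. *)
right => k k0; apply/eqP; rewrite -(inj_eq (inv_inj (@conjCK R[i]))) rmorph0 conj_G.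
rewrite (sum_group nu) big1 ?mulr0// => s _.
rewrite (eq_bigr (fun i => (b i)^* * s ^+ k)) => [|i /eqP -> //].
rewrite -mulr_suml; have [->|s0] := eqVneq s 0; first by rewrite expr0n gtn_eqF// mulr0.
rewrite [X in X * _](_ : _ = 0) ?mul0r//; apply/eqP; apply: contra_notT none => H.
by exists s.
Qed.

End Nodes.

(** * Toeplitz and Hankel operators *)

Section Operators.
Variables (R : realType) (m : nat).
Local Notation rc := (real_complex R).
Local Notation kap := (kap R m).
Local Notation kerE := (@kerE R m).
Local Notation pim := (pim R m).
Local Notation K := (repro_kernel m).
Implicit Types (f g h u v phi : R[i] -> R[i]) (w z : R[i]).

(** The functions for which all integrals are known to converge. The class contains the kernels and
    their combinations, is closed under products and lies in $F^{2,m}$. *)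
Definition expclass u : Prop := exists C B A, egf C B A /\ u = ps A.

Lemma conjCM (a b : R[i]) : (a * b)^* = a^* * b^*.
Proof. exact: rmorphM. Qed.

Lemma kerE_conj x : (kerE x)^* = kerE x^*.
Proof.
rewrite /kerE (conj_ps _ (egf_kap R m)); congr (ps _ _); apply/funext => k; exact: conj_kap.
Qed.

Lemma expclass_kernel z : expclass (fun w => K w z).
Proof.
exists 1, (1 * cmod z^*), (fun k => kap k * z^* ^+ k); split; first exact: egf_scale (egf_kap R m).
by apply/funext => w; rewrite repro_kernelE /kerE (ps_scale _ _ (egf_kap R m)).
Qed.

Lemma expclassM u v : expclass u -> expclass v -> expclass (fun w => u w * v w).
Proof.
move=> [C [B [A [AB ->]]]] [C' [B' [A' [AB' ->]]]].
exists (C * C'), (B + B'), (cauchyprod A A'); split; first exact: egfM.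
by apply/funext => w; rewrite (psM _ AB AB').
Qed.

Lemma expclass_measurable u : expclass u -> cmeasurable u.
Proof. by move=> [C [B [A [AB ->]]]]; exact: cmeasurable_ps AB. Qed.

Lemma expclass_egrow u : expclass u -> egrow u.
Proof. by move=> [C [B [A [AB ->]]]]; exact: egrow_ps AB. Qed.

(** The coefficients have the form [kap k] times a combination of k-th powers of the conjugated
    points, which is what the argument with exponential polynomials requires of [G]. *)
Lemma kernel_span_coef N (c omega : 'I_N -> R[i]) :
  exists C B, egf C B (fun k => kap k * \sum_i c i * (omega i)^* ^+ k) /\
  (fun z => \sum_(i < N) c i * K z (omega i)) =
    ps (fun k => kap k * \sum_i c i * (omega i)^* ^+ k).
Proof.
pose A (i : 'I_N) k := c i * (kap k * (omega i)^* ^+ k).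
have Ai i : egf (cmod (c i) * 1) (1 * cmod (omega i)^*) (A i).
  by apply: egfZ; exact: egf_scale (egf_kap R m).
have Ae i : exists C B, egf C B (A i) by do 2 eexists; exact: Ai.
have [[C [B AB]] psA] := @egf_sum R _ (index_enum 'I_N) xpredT A Ae.
have AE : (fun k => \sum_i A i k) = fun k => kap k * \sum_i c i * (omega i)^* ^+ k.
  apply/funext => k; rewrite mulr_sumr; apply: eq_bigr => i _.
  by rewrite /A; ring.
exists C, B; rewrite -AE; split=> //; apply/funext => z; rewrite psA; apply: eq_bigr => i _.
rewrite /A (psZ _ _ (egf_scale _ (egf_kap R m))) -(ps_scale _ _ (egf_kap R m)).
by [].
Qed.

Lemma kernel_span_expclass u : kernel_span m u -> expclass u.
Proof.
move=> [N [c [omega [_ uE]]]]; have [C [B [AB E]]] := kernel_span_coef c omega.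
by exists C, B; eexists; split; [exact: AB|rewrite -E; apply/funext].
Qed.

Lemma kernel_span_kernel z : kernel_span m (fun w => K w z).
Proof.
exists 1%N, (fun=> 1), (fun=> z); split=> // w.
by rewrite big_ord1 mul1r.
Qed.

Lemma expclass_fock_sobolev u : expclass u -> fock_sobolev m u.
Proof.
move=> hu; have [C [B [A [AB uE]]]] := hu.
have eu : entire u by rewrite uE; exact: entire_ps AB.
have ezu : entire (fun z => z ^+ m * u z) := entireM (@entireX R m) eu.
split=> //; split=> //.
have e1 : egrow (fun z => z ^+ m * u z).
  by apply: egrowM; [apply: egrowX; exact: egrow_id|exact: expclass_egrow].
have m1 : cmeasurable (fun z => z ^+ m * u z) by apply: ccont_measurable; exact: entire_ccont.
have /cintegrable_cmod i1 := cintegrable_egrow (cmeasurableM m1 m1) (egrowM e1 e1).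
apply: rintegrable_finiteW => [|w]; last by rewrite mulr_ge0 ?expR_ge0// exprn_ge0// cmod_ge0.
move: i1; congr rintegrable; apply/funext => w.
by rewrite cmodM cmodM cmod_real ger0_norm ?gauss_ge0.
Qed.

Lemma fock_sobolevZ (c : R[i]) u : fock_sobolev m u -> fock_sobolev m (fun z => c * u z).
Proof.
move=> fu; have [eu [ezu _]] := fu; have i1 := fock_sobolev_sqr fu.
have ec : entire (fun=> c) by apply: wd_entire => w; exists 0; exact: wd_cst.
split; first exact: (entireM ec eu).
rewrite (_ : (fun z => _) = fun z => c * (z ^+ m * u z)); last by apply/funext => z; ring.
split; first exact: (entireM ec ezu).
apply: rintegrable_finiteW => [|w]; last by rewrite mulr_ge0 ?expR_ge0// exprn_ge0// cmod_ge0.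
have := rintegrableZ (cmod c ^+ 2) i1; congr rintegrable; apply/funext => w.
by rewrite [in RHS]cmodM exprMn mulrA.
Qed.

Lemma fock_sobolev0 : fock_sobolev m (fun=> 0 : R[i]).
Proof.
apply: expclass_fock_sobolev; exists 0, 0, (fun=> 0); split; first exact: egf0.
by apply/funext => z; rewrite ps_zero.
Qed.

Lemma L2_egrow phi : cmeasurable phi -> egrow phi -> L2 m phi.
Proof.
move=> mp ep; split=> //.
have /cintegrable_cmod i1 := cintegrable_egrow_weight m (cmeasurableM mp mp) (egrowM ep ep).
apply: rintegrable_finiteW => [|w]; last by rewrite mulr_ge0 ?weight_ge0// exprn_ge0// cmod_ge0.
move: i1; congr rintegrable; apply/funext => w.
by rewrite cmodM cmodM cmod_real ger0_norm ?weight_ge0.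
Qed.

Lemma cintegrable_kernel_egrow phi z : cmeasurable phi -> egrow phi ->
  cintegrable (fun w => phi w * K z w * rc (weight m w)).
Proof.
move=> mp ep; apply: cintegrable_egrow_weight.
  by apply: cmeasurableM => //; exact: cmeasurable_kerE.
by apply: egrowM => //; exact: egrow_kerE.
Qed.

Lemma toeplitz_symbol_egrow phi : cmeasurable phi -> egrow phi -> toeplitz_symbol m phi.
Proof.
move=> mp ep; split=> // z; apply: rintegrable_finiteW => [|w]; last first.
  by rewrite mulr_ge0 ?weight_ge0// mulr_ge0 ?cmod_ge0.
have := cintegrable_cmod (cintegrable_kernel_egrow z mp ep); congr rintegrable; apply/funext => w.
by rewrite !cmodM cmod_real ger0_norm ?weight_ge0.
Qed.

Lemma toeplitz_intro phi u : cmeasurable phi -> egrow phi -> expclass u ->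
  fock_sobolev m (fock_proj m (fun w => phi w * u w)) ->
  toeplitz m phi u (fock_proj m (fun w => phi w * u w)).
Proof.
move=> mp ep hu fP; split=> //; first exact: toeplitz_symbol_egrow.
  exact: expclass_fock_sobolev.
move=> z; apply: cintegrable_kernel_egrow; first by apply: cmeasurableM => //; exact: expclass_measurable.
by apply: egrowM => //; exact: expclass_egrow.
Qed.

Lemma fock_projZ (c : R[i]) phi :
  (forall z, cintegrable (fun w => phi w * K z w * rc (weight m w))) ->
  fock_proj m (fun w => c * phi w) = fun z => c * fock_proj m phi z.
Proof.
move=> ip; apply/funext => z; rewrite /fock_proj [RHS]mulrCA -(cintegralZ _ (ip z)); congr (_ * cintegral _).
by apply/funext => w; ring.
Qed.

Lemma cmeasurable_conjf g : expclass g -> cmeasurable (conjf g).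
Proof. by move=> /expclass_measurable/cmeasurable_conj. Qed.

Lemma egrow_conjf g : expclass g -> egrow (conjf g).
Proof. by move=> /expclass_egrow/egrow_conj. Qed.

Hypothesis m_gt0 : (0 < m)%N.

Lemma reproducing_expclass u z : expclass u ->
  cintegral (fun w => u w * K z w * rc (weight m w)) = pim * u z.
Proof. by move=> /expclass_fock_sobolev; exact: cintegral_reproducing. Qed.

Lemma conj_repro_kernel z w : (K z w)^* = K w z.
Proof. by rewrite !repro_kernelE kerE_conj rmorphM /= conjCK mulrC. Qed.

Lemma conj_reproducing u z : expclass u ->
  cintegral (fun w => (u w)^* * K w z * rc (weight m w)) = pim * (u z)^*.
Proof.
move=> hu; have pc : pim^* = pim by exact: conj_rc.
transitivity ((cintegral (fun w => u w * K z w * rc (weight m w)))^*); last first.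
  by rewrite reproducing_expclass// conjCM pc.
rewrite -(cintegral_conj (cintegrable_kernel_egrow z (expclass_measurable hu) (expclass_egrow hu))).
congr cintegral; apply/funext => w.
by rewrite !conjCM conj_rc conj_repro_kernel.
Qed.

(** Kernels are eigenvectors of Toeplitz operators with antiholomorphic symbol. In the integral, the
    evaluation kernel at y joins g under the conjugation, and g K_y is then reproduced at z. *)
Lemma fock_proj_conj_kernel g z : expclass g ->
  fock_proj m (fun w => (g w)^* * K w z) = fun y => (g z)^* * K y z.
Proof.
move=> hg; apply/funext => y; rewrite /fock_proj.
have E : (fun w => (g w)^* * K w z * K y w * rc (weight m w)) =
    fun w => (g w * K w y)^* * K w z * rc (weight m w).
  by apply/funext => w; rewrite conjCM conj_repro_kernel; ring.
rewrite E (conj_reproducing z (expclassM hg (expclass_kernel y))) mulKf ?pim_neq0//.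
by rewrite conjCM conj_repro_kernel.
Qed.

(** Hence such an operator maps combinations of kernels to combinations of kernels, which keeps
    products of operators defined on them. *)
Lemma fock_proj_conj_span g u : expclass g -> kernel_span m u ->
  kernel_span m (fock_proj m (fun w => conjf g w * u w)).
Proof.
move=> hg [N [c [omega [N0 uE]]]]; exists N, (fun i => c i * (g (omega i))^*), omega; split=> // z.
have iK (i : 'I_N) : cintegrable (fun w => c i * ((g w)^* * K w (omega i) * K z w * rc (weight m w))).
  apply: cintegrableZ; apply: cintegrable_kernel_egrow.
    apply: cmeasurableM; [exact: cmeasurable_conjf|exact: expclass_measurable (expclass_kernel _)].
  by apply: egrowM; [exact: egrow_conjf|exact: expclass_egrow (expclass_kernel _)].
have [_ E] := @cintegral_sum R _ (index_enum 'I_N) xpredT (fun i w => c i * ((g w)^* * K w (omega i) * K z w * rc (weight m w))) iK.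
rewrite /fock_proj (_ : (fun w => _) = fun w => \sum_(i < N) c i * ((g w)^* * K w (omega i) * K z w * rc (weight m w))); last first.
  apply/funext => w; rewrite uE /conjf !mulr_sumr !mulr_suml; apply: eq_bigr => i _.
  by ring.
rewrite E mulr_sumr; apply: eq_bigr => i _.
have iK' : cintegrable (fun w => (g w)^* * K w (omega i) * K z w * rc (weight m w)).
  apply: cintegrable_kernel_egrow.
    apply: cmeasurableM; [exact: cmeasurable_conjf|exact: expclass_measurable (expclass_kernel _)].
  by apply: egrowM; [exact: egrow_conjf|exact: expclass_egrow (expclass_kernel _)].
rewrite (cintegralZ _ iK') mulrCA -mulrA; congr (_ * _).
by have := congr1 (fun F => F z) (fock_proj_conj_kernel (omega i) hg).
Qed.

(** The terms are nonnegative and the constant one is 1; thus K(z,z) is a positive real and the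
    normalised kernel makes sense. *)
Lemma kerE_ge1 (s : R) : 0 <= s -> exists2 r : R, 1 <= r & kerE (rc s) = rc r.
Proof.
move=> s0; have cv := ps_cvg (rc s) (egf_kap R m).
pose a k : R := m`!%:R / (k + m)`!%:R * s ^+ k.
have E n : psum kap (rc s) n = rc (\sum_(k < n) a k).
  by rewrite rmorph_sum; apply: eq_bigr => k _; rewrite /a kap_real -rmorphXn -rmorphM.
exists (Re (kerE (rc s))); last first.
  apply: complexP => //=; have c := ccvg_Im (ccvg_ext E cv).
  by rewrite -(cvg_lim _ c)//= lim_cst.
have c := ccvg_Re (ccvg_shift 1 cv); rewrite -(cvg_lim _ c)//.
apply: limr_ge; first by apply/cvg_ex; eexists; exact: c.
apply: nearW => n; rewrite E/= addn1 big_ord_recl /a expr0 mulr1 add0n divff; last by rewrite pnatr_eq0 -lt0n fact_gt0.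
by rewrite lerDl sumr_ge0// => k _; rewrite mulr_ge0 ?divr_ge0 ?exprn_ge0.
Qed.

Lemma repro_kernel_diag z : K z z != 0 /\
  sqrtC (K z z) * (sqrtC (K z z))^* = K z z.
Proof.
have [r r1 E] := kerE_ge1 (sqr_ge0 (cmod z)).
have K0 : 0 <= K z z by rewrite repro_kernelE mulJ_cmod E ler0c (le_trans ler01).
split.
  rewrite repro_kernelE mulJ_cmod E -(rmorph0 rc) (inj_eq (@complexI R)) gt_eqF//.
  exact: lt_le_trans ltr01 r1.
by rewrite conj_Creal ?ger0_real ?sqrtC_ge0// -expr2 sqrtCK.
Qed.

Lemma berezinE phi z : cmeasurable phi -> egrow phi ->
  berezin m phi z = fock_proj m (fun w => phi w * K w z) z / K z z.
Proof.
move=> mp ep; have [K0 KK] := repro_kernel_diag z.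
rewrite /berezin /inner /fock_proj -mulrA; congr (_ * _).
have ik : cintegrable (fun w => phi w * K w z * K z w * rc (weight m w)).
  apply: cintegrable_kernel_egrow.
    by apply: cmeasurableM => //; exact: expclass_measurable (expclass_kernel _).
  by apply: egrowM => //; exact: expclass_egrow (expclass_kernel _).
rewrite mulrC -(cintegralZ _ ik); congr cintegral; apply/funext => w.
rewrite /normalized_kernel -[X in _ = X^-1 * _]KK conjCM conj_repro_kernel.
rewrite [X in _ * X * _]mulrC fmorphV.
have : sqrtC (K z z) != 0 by rewrite sqrtC_eq0.
move: (sqrtC _) => s s0; field.
by rewrite fmorph_eq0 s0.
Qed.

End Operators.

(** * The implications between the four statements *)

Section Implications.
Variables (R : realType) (m : nat).
Hypothesis m_gt0 : (0 < m)%N.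
Local Notation rc := (real_complex R).
Local Notation kerE := (@kerE R m).
Local Notation pim := (pim R m).
Local Notation K := (repro_kernel m).
Variables f g : R[i] -> R[i].
Hypotheses (hf : kernel_span m f) (hg : kernel_span m g).
Let ef := kernel_span_expclass hf.
Let eg := kernel_span_expclass hg.
Let fg w := f w * (g w)^*.
Implicit Types (h u v : R[i] -> R[i]) (z w : R[i]).

Lemma cmeasurable_fg : cmeasurable fg.
Proof. by apply: cmeasurableM; [exact: expclass_measurable|exact: cmeasurable_conjf]. Qed.

Lemma egrow_fg : egrow fg.
Proof. by apply: egrowM; [exact: expclass_egrow|exact: egrow_conjf]. Qed.

(** The common consequence of (a), (b) and (c), from which (d) is derived. It is (c) multiplied by
    K(z,z). *)
Definition fixed_diag : Prop :=
  forall z, fock_proj m (fun w => fg w * K w z) z = fg z * K z z.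

Lemma fixed_diag_berezin : fixed_diag <-> (forall z, berezin m fg z = fg z).
Proof.
split=> H z.
  have [K0 _] := repro_kernel_diag m z.
  by rewrite (berezinE _ _ cmeasurable_fg egrow_fg) H mulfK.
have [K0 _] := repro_kernel_diag m z.
by have := H z; rewrite (berezinE _ _ cmeasurable_fg egrow_fg) => /(canRL (divfK K0)).
Qed.

Lemma hankel_intro h u : expclass h -> expclass u ->
  hankel m (conjf h) u (fun z => conjf h z * u z - fock_proj m (fun w => conjf h w * u w) z).
Proof.
move=> eh eu; split=> //; first exact: expclass_fock_sobolev.
apply: L2_egrow; first by apply: cmeasurableM; [exact: cmeasurable_conjf|exact: expclass_measurable].
by apply: egrowM; [exact: egrow_conjf|exact: expclass_egrow].
Qed.

Lemma inner0r (u : R[i] -> R[i]) : inner m u (fun=> 0 : R[i]) = 0.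
Proof.
rewrite /inner (_ : (fun z : R[i] => _) = fun=> 0 : R[i]); last by apply/funext => z; rewrite rmorph0 mulr0 mul0r.
by rewrite cintegral0 mulr0.
Qed.

Lemma inner0l (u : R[i] -> R[i]) : inner m (fun=> 0 : R[i]) u = 0.
Proof.
rewrite /inner (_ : (fun z : R[i] => _) = fun=> 0 : R[i]); last by apply/funext => z; rewrite mul0r mul0r.
by rewrite cintegral0 mulr0.
Qed.

Lemma cintegrable_kk h z : cmeasurable h -> egrow h ->
  cintegrable (fun w => h w * (K w z * K z w) * rc (weight m w)).
Proof.
move=> mh eh; have := @cintegrable_kernel_egrow R m (fun w => h w * K w z) z.
rewrite (_ : (fun w => h w * K w z * _ * _) = fun w => h w * (K w z * K z w) * rc (weight m w)); last first.
  by apply/funext => w; ring.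
apply.
  by apply: cmeasurableM => //; exact: expclass_measurable (expclass_kernel _ _).
by apply: egrowM => //; exact: expclass_egrow (expclass_kernel _ _).
Qed.

Lemma cintegral_kk h z : expclass h ->
  cintegral (fun w => h w * (K w z * K z w) * rc (weight m w)) = pim * (h z * K z z).
Proof.
move=> eh; rewrite -(reproducing_expclass m_gt0 z (expclassM eh (expclass_kernel m z))).
by congr cintegral; apply/funext => w; ring.
Qed.

Lemma cintegral_conj_kk h z : expclass h ->
  cintegral (fun w => (h w)^* * (K w z * K z w) * rc (weight m w)) = pim * ((h z)^* * K z z).
Proof.
move=> eh; rewrite -[K z z](conj_repro_kernel m z z) -conjCM -(conj_reproducing m_gt0 z (expclassM eh (expclass_kernel m z))).
by congr cintegral; apply/funext => w; rewrite conjCM conj_repro_kernel; ring.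
Qed.

(** Pairing the vanishing product at K_z with K_z gives 0 = <H_conj(f) K_z, H_conj(g) K_z>. Both
    projections are known multiples of K_z, so four integrals result; three follow from the
    reproducing property and the fourth is P(f conj(g) K_z)(z) up to the constant factor. *)
Lemma hankel_fixed_diag :
  op_eq m (op_comp (adjoint m (hankel m (conjf f))) (hankel m (conjf g))) (op_zero m) -> fixed_diag.
Proof.
move=> [ex agree] z.
have [[v [h Hh Ah]] _] := ex _ (kernel_span_kernel m z).
have v0 : v = fun=> 0.
  apply: (agree _ _ _ (ex_intro2 _ _ h Hh Ah)); split=> //.
  exact: expclass_fock_sobolev (expclass_kernel m z).
have [_ _ hE] := Hh; have [_ _ /(_ _ _ (hankel_intro ef (expclass_kernel m z)))] := Ah.
rewrite v0 inner0r hE !(fock_proj_conj_kernel m_gt0 z) // /inner => /eqP.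
rewrite mulf_eq0 invr_eq0 (negbTE (pim_neq0 R m))/= => /eqP E.
have mg := expclass_measurable eg; have mf := expclass_measurable ef.
have i1 : cintegrable (fun w => fg w * (K w z * K z w) * rc (weight m w)).
  exact: cintegrable_kk cmeasurable_fg egrow_fg.
have i2 := cintegrable_kk z mf (expclass_egrow ef).
have i3 := cintegrable_kk z (cmeasurable_conjf eg) (egrow_conjf eg).
have i4 := cintegrable_kk z (cmeasurable_cst 1) (egrow_cst 1).
have i5 := cintegrableB (cintegrableB i1 (cintegrableZ (g z)^* i2)) (cintegrableB (cintegrableZ (f z) i3) (cintegrableZ (fg z) i4)).
(* The conjugate of [E], with (f(w) - f(z)) conj(g(w) - g(z)) multiplied out. *)
have E1 : cintegral (fun w => fg w * (K w z * K z w) * rc (weight m w)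
     - (g z)^* * (f w * (K w z * K z w) * rc (weight m w))
     - (f z * (conjf g w * (K w z * K z w) * rc (weight m w)) - fg z * (1 * (K w z * K z w) * rc (weight m w)))) = 0.
  rewrite -[RHS](rmorph0 (@Num.conj R[i])) -[in RHS]E -[LHS]conjCK -(cintegral_conj i5).
  congr (Num.conj _); congr cintegral; apply/funext => w.
  have conjCB (a b : R[i]) : (a - b)^* = a^* - b^* by exact: rmorphB.
  rewrite /fg /conjf -(conj_repro_kernel m w z).
  move: (conj_rc (weight m w)).
  generalize (rc (weight m w)) (K w z) (f w) (g w) (f z) (g z) => r a b c d e hr.
  by rewrite !(conjCB, conjCM, conjCK, conjC1, hr); ring.
have e1 : expclass (fun=> 1 : R[i]).
  exists 0`!%:R, 1, (delta R 0); split; first exact: egf_delta.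
  by apply/funext => w; rewrite ps_delta expr0.
move: E1; rewrite (cintegralB (cintegrableB i1 (cintegrableZ (g z)^* i2)) (cintegrableB (cintegrableZ (f z) i3) (cintegrableZ (fg z) i4))).
rewrite (cintegralB i1 (cintegrableZ (g z)^* i2)) (cintegralB (cintegrableZ (f z) i3) (cintegrableZ (fg z) i4)).
rewrite (cintegralZ _ i2) (cintegralZ _ i3) (cintegralZ _ i4) (cintegral_kk z ef) (cintegral_conj_kk z eg) (cintegral_kk z e1).
set I := cintegral _ => E2.
rewrite /fock_proj (_ : cintegral _ = I); last by congr cintegral; apply/funext => w; ring.
have -> : I = pim * (fg z * K z z).
  by apply/eqP; rewrite -subr_eq0; apply/eqP; rewrite -[RHS]E2 /fg; ring.
by rewrite mulKf// pim_neq0.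
Qed.

(** T_conj(g) K_z = conj(g(z)) K_z, and T_f then multiplies by f because the product is already in
    $F^{2,m}$; evaluate at z. *)
Lemma toeplitz_fixed_diag :
  op_eq m (op_comp (toeplitz m f) (toeplitz m (conjf g))) (toeplitz m fg) -> fixed_diag.
Proof.
move=> [ex agree] z.
have [[v [v1 H1 H2]] [w Hw]] := ex _ (kernel_span_kernel m z).
have vw := agree _ _ _ (ex_intro2 _ _ v1 H1 H2) Hw.
have [_ _ _ v1E _] := H1; have [_ _ _ vE _] := H2; have [_ _ _ wE _] := Hw.
rewrite -wE -vw vE v1E (fock_proj_conj_kernel m_gt0 z eg) (_ : (fun y => _) = fun y => (g z)^* * (f y * K y z)); last first.
  by apply/funext => y; ring.
rewrite fock_proj_id//; first by rewrite /fg; ring.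
by apply: fock_sobolevZ; apply: expclass_fock_sobolev; exact: expclassM ef (expclass_kernel m z).
Qed.

Lemma fixed_diag_const : fixed_diag -> constant_fun f \/ constant_fun g.
Proof.
move=> H; have [Nf [cf [of' [_ fE]]]] := hf; have [Ng [cg [og [_ gE]]]] := hg.
have [CF [BF [FB fps]]] := kernel_span_coef m cf of'.
have [CG [BG [GB gps]]] := kernel_span_coef m cg og.
set F := (fun k => _) in FB fps; set G := (fun k => _) in GB gps.
have {}fE : f = ps F by rewrite -fps; apply/funext.
have {}gE : g = ps G by rewrite -gps; apply/funext.
have e1 : expclass (fun=> 1 : R[i]).
  exists 0`!%:R, 1, (delta R 0); split; first exact: egf_delta.
  by apply/funext => w; rewrite ps_delta expr0.
(* K(z,z) is itself the normalised integral of |K_z|^2 against the weight, so the scalar f(z)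
   conj(g(z)) can be taken inside. *)
have diag z : cintegral (fun w => (ps F w * (ps G w)^* - ps F z * (ps G z)^*) * kerE (z * w^*) * kerE (w * z^*) * rc (weight m w)) = 0.
  have i1 := cintegrable_kk z cmeasurable_fg egrow_fg.
  have i4 := cintegrable_kk z (cmeasurable_cst 1) (egrow_cst 1).
  have := H z; rewrite /fock_proj => /(canRL (mulVKf (pim_neq0 R m))) E.
  rewrite (_ : (fun w => _) = fun w => fg w * (K w z * K z w) * rc (weight m w) - fg z * (1 * (K w z * K z w) * rc (weight m w))); last first.
    by apply/funext => w; rewrite /fg fE gE !repro_kernelE; ring.
  rewrite (cintegralB i1 (cintegrableZ (fg z) i4)) (cintegralZ _ i4) (cintegral_kk z e1).
  rewrite (_ : cintegral _ = pim * (fg z * K z z)); first by ring.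
  by rewrite -E; congr cintegral; apply/funext => w; ring.
have coef p q : (q <= p)%N -> exists2 L,
  ccvg (fun n => \sum_(k < n) shift p F k * (shift q G k)^* / kap R m k) L &
  kap R m p * kap R m q * L = \sum_(l < q.+1) kap R m l * F (q - l)%N * (G (p - l)%N)^*.
  move=> qp; eexists; first exact: (parseval_shift m p q FB GB).
  exact: coefficient_identity FB GB diag _ _ qp.
have const_ps (A : nat -> R[i]) C B : egf C B A -> (forall r, (0 < r)%N -> A r = 0) -> constant_fun (ps A).
  move=> AB A0; exists (A 0%N) => z.
  rewrite (_ : A = fun k => A 0%N * delta R 0 k); last first.
    by apply/funext => -[|k]; rewrite /delta/= ?mulr1// mulr0 A0.
  by rewrite (psZ _ _ (egf_delta R 0)) ps_delta expr0 /delta eqxx.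
have [F0|G0] := coefficients_const FB coef m_gt0.
  by left; rewrite fE; exact: const_ps FB F0.
by right; rewrite gE; exact: const_ps GB G0.
Qed.

(** A Hankel operator with constant symbol is zero wherever it is defined, since P u = u on the
    whole space; so every pairing <H_conj(f) u', H_conj(g) u> vanishes. On kernel combinations the
    value 0 is then exhibited for the adjoint. *)
Lemma const_hankel : constant_fun f \/ constant_fun g ->
  op_eq m (op_comp (adjoint m (hankel m (conjf f))) (hankel m (conjf g))) (op_zero m).
Proof.
have hankel_const h c u v : (forall z, h z = c) -> hankel m (conjf h) u v -> v = fun=> 0.
  move=> hc [fu _ ->]; apply/funext => z.
  rewrite (_ : (fun w => conjf h w * u w) = fun w => c^* * u w); last first.
    by apply/funext => w; rewrite /conjf hc.
  by rewrite fock_proj_id ?/conjf ?hc ?subrr//; exact: fock_sobolevZ.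
have vanish u v h : constant_fun f \/ constant_fun g -> hankel m (conjf f) u v ->
    forall u', hankel m (conjf g) u' h -> inner m v h = 0.
  move=> [[c fc]|[c gc]] Hv u' Hh.
    by rewrite (hankel_const f c u v fc Hv) inner0l.
  by rewrite (hankel_const g c u' h gc Hh) inner0r.
move=> cfg; split.
  move=> u hu; have eu := kernel_span_expclass hu; have fu := expclass_fock_sobolev m eu.
  split; last by exists (fun=> 0).
  have Hh := hankel_intro eg eu.
  exists (fun=> 0); eexists; first exact: Hh.
  split; last by move=> u' v' Hv'; rewrite inner0r; exact: vanish cfg Hv' _ Hh.
    have es := kernel_span_expclass (fock_proj_conj_span m_gt0 eg hu).
    apply: L2_egrow.
      apply: cmeasurableB; last exact: expclass_measurable es.
      by apply: cmeasurableM; [exact: cmeasurable_conjf|exact: expclass_measurable].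
    rewrite (_ : (fun z => _) = fun z => conjf g z * u z + (-1) * fock_proj m (fun w => conjf g w * u w) z); last first.
      by apply/funext => z; rewrite mulN1r.
    apply: egrowD; first by apply: egrowM; [exact: egrow_conjf|exact: expclass_egrow].
    by apply: egrowM; [exact: egrow_cst|exact: expclass_egrow es].
  exact: fock_sobolev0.
(* For a general u in the domain, the value v of the adjoint is orthogonal to each kernel, and the
   reproducing property turns this into v(z) = 0. *)
move=> u v w [h Hh [_ fv Ah]] [_ ->]; apply/funext => z.
have Hk := hankel_intro ef (expclass_kernel m z).
have := Ah _ _ Hk; rewrite (vanish _ _ _ cfg Hk _ Hh) /inner => /esym/eqP.
rewrite mulf_eq0 invr_eq0 (negbTE (pim_neq0 R m))/= => /eqP E.
have iv : cintegrable (fun w => v w * K z w * rc (weight m w)) by exact: cintegrable_kerE_weight.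
have := congr1 (@Num.conj R[i]) (cintegral_reproducing m_gt0 z fv).
rewrite -(cintegral_conj iv) (_ : (fun w => _) = fun w => K w z * (v w)^* * rc (weight m w)); last first.
  by apply/funext => y; rewrite !conjCM conj_rc conj_repro_kernel; ring.
rewrite E => /esym/eqP; rewrite conjC_eq0 mulf_eq0 (negbTE (pim_neq0 R m))/= => /eqP.
exact.
Qed.

(** For f = c both sides are c P(conj(g) u); for g = c they are P(conj(c) f u). Agreement on the
    full common domain uses P v = v for arbitrary members, not only for kernels. *)
Lemma const_toeplitz : constant_fun f \/ constant_fun g ->
  op_eq m (op_comp (toeplitz m f) (toeplitz m (conjf g))) (toeplitz m fg).
Proof.
move=> cfg; split.
  move=> u hu; have eu := kernel_span_expclass hu.
  have mcg := cmeasurable_conjf eg; have ecg := egrow_conjf eg.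
  have es := kernel_span_expclass (fock_proj_conj_span m_gt0 eg hu).
  have efs := expclassM ef es.
  split.
    eexists; eexists; first exact: (toeplitz_intro mcg ecg eu (expclass_fock_sobolev m es)).
    apply: toeplitz_intro => //; [exact: expclass_measurable|exact: expclass_egrow|].
    by rewrite fock_proj_id//; exact: expclass_fock_sobolev.
  eexists; apply: toeplitz_intro => //; [exact: cmeasurable_fg|exact: egrow_fg|].
  case: cfg => -[c cE].
    rewrite (_ : (fun w => _) = fun w => c * (conjf g w * u w)); last first.
      by apply/funext => w; rewrite /fg cE mulrA.
    rewrite fock_projZ; first by apply: fock_sobolevZ; exact: expclass_fock_sobolev.
    move=> z; apply: cintegrable_kernel_egrow; first by apply: cmeasurableM => //; exact: expclass_measurable.
    by apply: egrowM => //; exact: expclass_egrow.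
  rewrite (_ : (fun w => _) = fun w => c^* * (f w * u w)); last first.
    by apply/funext => w; rewrite /fg cE; ring.
  have fs := fock_sobolevZ c^* (expclass_fock_sobolev m (expclassM ef eu)).
  by rewrite fock_proj_id.
move=> u v w [v1 [_ fu i1 v1E fv1] [_ _ _ -> _]] [_ _ _ -> _].
case: cfg => -[c cE].
  rewrite (_ : (fun w => f w * v1 w) = fun w => c * v1 w); last by apply/funext => y; rewrite cE.
  rewrite (fock_proj_id m_gt0 (fock_sobolevZ c fv1)) v1E.
  rewrite (_ : (fun w => fg w * u w) = fun w => c * (conjf g w * u w)); last first.
    by apply/funext => y; rewrite /fg cE mulrA.
  by rewrite fock_projZ.
have {}v1E : v1 = fun w => c^* * u w.
  rewrite v1E (_ : (fun w => conjf g w * u w) = fun w => c^* * u w); last first.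
    by apply/funext => y; rewrite /conjf cE.
  by rewrite fock_proj_id//; exact: fock_sobolevZ.
by congr fock_proj; apply/funext => y; rewrite v1E /fg cE mulrA.
Qed.

End Implications.

Theorem theoremA (R : realType) (m : nat) (hm : (0 < m)%N)
    (f g : R[i] -> R[i]) (hf : kernel_span m f) (hg : kernel_span m g) :
  [<-> op_eq m (op_comp (adjoint m (hankel m (conjf f))) (hankel m (conjf g)))
               (op_zero m);
       op_eq m (op_comp (toeplitz m f) (toeplitz m (conjf g)))
               (toeplitz m (fun z => f z * (g z)^*));
       forall z, berezin m (fun w => f w * (g w)^*) z = f z * (g z)^*;
       constant_fun f \/ constant_fun g].
Proof.
tfae.
(* No direct passage from (a) to (b): the way leads through (d). *)
- move=> /(hankel_fixed_diag hm hf hg)/(fixed_diag_const hm hf hg).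
  exact: const_toeplitz.
- by move=> /(toeplitz_fixed_diag hm hf hg)/(fixed_diag_berezin hf hg).
- by move=> /(fixed_diag_berezin hf hg)/(fixed_diag_const hm hf hg).
- exact: const_hankel.
Qed.
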